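(* Let $(x^*,y^*,u^*,v^* )$ be a local solution of the combined program (CP) described in the context, and suppose that the value function $V$ is Lipschitz continuous around $x^*$. If RCPLD holds at $(x^*,y^*,u^*,v^* )$ for the constraint system of (CP), then $(x^*,y^*,u^*,v^* )$ is an M-stationary point of (CP).
   Context: Combined program. $F:\mathbb{R}^d\times\mathbb{R}^s\to\mathbb{R}$ is locally Lipschitz; $G:\mathbb{R}^d\times\mathbb{R}^s\to\mathbb{R}^p$, $H:\mathbb{R}^d\times\mathbb{R}^s\to\mathbb{R}^q$ are continuously differentiable; $f:\mathbb{R}^d\times\mathbb{R}^s\to\mathbb{R}$, $g:\mathbb{R}^d\times\mathbb{R}^s\to\mathbb{R}^m$, $h:\mathbb{R}^d\times\mathbb{R}^s\to\mathbb{R}^n$ are continuously differentiable and their partial derivatives in $y$ are continuously differentiable in $(x,y)$. $Y(x)=\{y:g(x,y)\le0,\ h(x,y)=0\}$, $V(x)=\inf_{y\in Y(x)}f(x,y)$. With $\nabla_yL(x,y,u,v)=\nabla_yf(x,y)+\nabla_yg(x,y)^Tu+\nabla_yh(x,y)^Tv$ and $\Omega^m=\{(a,b)\in\mathbb{R}^m\times\mathbb{R}^m:0\le a\perp b\ge0\}$, (CP) is: minimize $F(x,y)$ over $(x,y,u,v)\in\mathbb{R}^d\times\mathbb{R}^s\times\mathbb{R}^m\times\mathbb{R}^n$ subject to $f(x,y)-V(x)\le0$, $G(x,y)\le0$, $H(x,y)=0$, $h(x,y)=0$, $\nabla_yL(x,y,u,v)=0$, $(-g(x,y),u)\in\Omega^m$.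 Index sets at $(x^*,y^*,u^*,v^* )$: $I_G^*=\{i:G_i(x^*,y^* )=0\}$, $\mathcal{I}^*=\{i:g_i(x^*,y^* )=0,u_i^*>0\}$, $\mathcal{J}^*=\{i:g_i(x^*,y^* )=0,u_i^*=0\}$, $\mathcal{K}^*=\{i:g_i(x^*,y^* )<0,u_i^*=0\}$. The limiting subdifferential of a locally Lipschitz $\varphi$ is $\partial\varphi(z)=\{\lim\xi_k:\xi_k\in\widehat\partial\varphi(z_k),\ z_k\to z\}$ with $\widehat\partial\varphi(z)=\{\zeta:\varphi(z')-\varphi(z)-\langle\zeta,z'-z\rangle\ge o(\|z'-z\|)\}$. RCPLD for (CP). Write $z=(x,y,u,v)$, $z^*=(x^*,y^*,u^*,v^* )$ and regard all functions as functions of $z$. The inequality constraints are $\theta_0(z)=f(x,y)-V(x)\le 0$ (active at every feasible point) and $\theta_i(z)=G_i(x,y)\le0$, $i=1,\dots,p$, with active set $I_\theta^*=\{0\}\cup I_G^*$; the equality constraints $e_j(z)=0$, $j=1,\dots,M$, are all components of $H(x,y)=0$, $h(x,y)=0$, $\nabla_yL(z)=0$; the complementarity functions are $\mathcal{G}_i(z)=-g_i(x,y)$, $\mathcal{H}_i(z)=u_i$. RCPLD holds at $z^*$ if: (i) $\{\nabla e_j(z)\}_{j=1}^M\cup\{\nabla\mathcal{G}_i(z)\}_{i\in\mathcal{I}^*}\cup\{\nabla\mathcal{H}_i(z)\}_{i\in\mathcal{K}^*}$ has the same rank for all $z$ near $z^*$; (ii) let $\mathcal{I}_1\subseteq\{1,\dots,M\}$,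 $\mathcal{I}_2\subseteq\mathcal{I}^*$, $\mathcal{I}_3\subseteq\mathcal{K}^*$ index a basis (at $z^*$) of the span of the vectors in (i) at $z^*$. For any $\mathcal{I}_4\subseteq I_\theta^*$, $\mathcal{I}_5,\mathcal{I}_6\subseteq\mathcal{J}^*$: whenever there are $w_i^*\in\partial\theta_i(z^* )$ ($i\in\mathcal{I}_4$) and multipliers $\lambda_i\ge0$ ($i\in\mathcal{I}_4$), $\mu_j$ ($j\in\mathcal{I}_1$), $a_i$ ($i\in\mathcal{I}_2\cup\mathcal{I}_5$), $b_i$ ($i\in\mathcal{I}_3\cup\mathcal{I}_6$), not all zero, such that (setting $a_i=0$, $b_i=0$ for other indices) for every $i\in\mathcal{J}^*$ either $a_i>0,b_i>0$ or $a_ib_i=0$, and $$0=\sum_{i\in\mathcal{I}_4}\lambda_iw_i^*+\sum_{j\in\mathcal{I}_1}\mu_j\nabla e_j(z^* )-\sum_{i\in\mathcal{I}_2\cup\mathcal{I}_5}a_i\nabla\mathcal{G}_i(z^* )-\sum_{i\in\mathcal{I}_3\cup\mathcal{I}_6}b_i\nabla\mathcal{H}_i(z^* ),$$ then for all sequences $z^k\to z^*$, $z^k\ne z^*$, and $w_i^k\in\partial\theta_i(z^k)$ with $w_i^k\to w_i^*$ ($i\in\mathcal{I}_4$), the indexed family $\{w_i^k\}_{i\in\mathcal{I}_4}\cup\{\nabla e_j(z^k)\}_{j\in\mathcal{I}_1}\cup\{\nabla\mathcal{G}_i(z^k)\}_{i\in\mathcal{I}_2\cup\mathcal{I}_5}\cup\{\nabla\mathcal{H}_i(z^k)\}_{i\in\mathcal{I}_3\cup\mathcal{I}_6}$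 is linearly dependent for all sufficiently large $k$. M-stationarity of a feasible point $z^*$ for (CP): there exist $\lambda^V\ge0$, $\lambda_i^G\ge0$ ($i\in I_G^*$), $\lambda^H\in\mathbb{R}^q$, $\lambda^h\in\mathbb{R}^n$, $\lambda^L\in\mathbb{R}^s$, $a,b\in\mathbb{R}^m$ such that $$0\in\partial F(x^*,y^* )+\lambda^V\partial(f-V)(x^*,y^* )+\sum_{i\in I_G^*}\lambda_i^G\nabla G_i(x^*,y^* )+\nabla H(x^*,y^* )^T\lambda^H+\nabla h(x^*,y^* )^T\lambda^h+\nabla_{(x,y)}(\nabla_yL)(z^* )^T\lambda^L+\sum_{i\in\mathcal{I}^*\cup\mathcal{J}^*}a_i\nabla g_i(x^*,y^* ),$$ $\nabla_yg(x^*,y^* )\lambda^L-b=0$, $\nabla_yh(x^*,y^* )\lambda^L=0$, $b_i=0$ for $i\in\mathcal{I}^*$, $a_i=0$ for $i\in\mathcal{K}^*$, and for $i\in\mathcal{J}^*$ either $a_i>0,b_i>0$ or $a_ib_i=0$ (here $f-V$ is the function $(x,y)\mapsto f(x,y)-V(x)$). *)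

(* Defs.v *)
From mathcomp Require Import all_boot all_order all_algebra.
From mathcomp Require Import all_classical all_reals all_analysis.

Set Implicit Arguments.
Unset Strict Implicit.
Unset Printing Implicit Defensive.

Import Order.TTheory GRing.Theory Num.Theory.
Import numFieldNormedType.Exports.

Local Open Scope classical_set_scope.
Local Open Scope ring_scope.

Definition dotv (R : realType) (N : nat) (a b : 'rV[R]_N) : R :=
  \sum_i a 0 i * b 0 i.

Definition grad (R : realType) (N : nat) (phi : 'rV[R]_N -> R) (z : 'rV[R]_N) :
    'rV[R]_N :=
  \row_j 'D_(delta_mx 0 j) phi z.

Definition continuously_differentiable (R : realType) (N : nat)
    (W : normedModType R) (phi : 'rV[R]_N -> W) : Prop :=
  (forall z, differentiable phi z) /\ (forall v, continuous ('D_v phi)).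

Definition lipschitz_around (R : realType) (N : nat) (phi : 'rV[R]_N -> R)
    (z : 'rV[R]_N) : Prop :=
  exists2 A : set 'rV[R]_N, nbhs z A & [lipschitz phi w | w in A].

(* The condition spells out phi z' - phi z - <zeta, z' - z> >= o(|z' - z|).  The norm
   of ['rV[R]_N] is the sup norm; only its topology and its class up to
   equivalence of norms matter here and in [lipschitz_around]. *)
Definition regular_subdiff (R : realType) (N : nat) (phi : 'rV[R]_N -> R)
    (z : 'rV[R]_N) : set 'rV[R]_N :=
  [set zeta | forall eps : R, 0 < eps -> \forall z' \near z,
     - (eps * `|z' - z|) <= phi z' - phi z - dotv zeta (z' - z)].

(* No condition phi (z_k) --> phi z: this is the form of the limiting
   subdifferential for continuous (in particular locally Lipschitz) phi. *)
Definition limiting_subdiff (R : realType) (N : nat) (phi : 'rV[R]_N -> R)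
    (z : 'rV[R]_N) : set 'rV[R]_N :=
  [set xi | exists zk xik : nat -> 'rV[R]_N,
     [/\ zk @ \oo --> z, xik @ \oo --> xi &
         forall k, regular_subdiff phi (zk k) (xik k)]].

(* The members are listed with repetition, so that [free] on the result is
   linear independence of the indexed family. *)
Definition grad_family (R : realType) (N : nat) (E C : finType)
    (e : E -> 'rV[R]_N -> R) (cG cH : C -> 'rV[R]_N -> R)
    (I1 : {set E}) (I2 I3 : {set C}) (z : 'rV[R]_N) : seq 'rV[R]_N :=
  [seq grad (e j) z | j in I1] ++
  [seq grad (cG i) z | i in I2] ++
  [seq grad (cH i) z | i in I3].

(* RCPLD for the system theta_i <= 0, e_j = 0, 0 <= cG_i _|_ cH_i >= 0.
   [Itheta] is the active set of the inequalities; [I], [J], [K] are the indices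
   with cG = 0 < cH, cG = cH = 0 and cH = 0 < cG respectively. *)
Definition RCPLD (R : realType) (N : nat) (T E C : finType)
    (theta : T -> 'rV[R]_N -> R) (e : E -> 'rV[R]_N -> R)
    (cG cH : C -> 'rV[R]_N -> R)
    (Itheta : {set T}) (I J K : {set C}) (zs : 'rV[R]_N) : Prop :=
  (\forall z \near zs,
     \dim <<grad_family e cG cH [set: E]%SET I K z>>%VS =
     \dim <<grad_family e cG cH [set: E]%SET I K zs>>%VS) /\
  (forall (I1 : {set E}) (I2 I3 : {set C}),
     I2 \subset I -> I3 \subset K ->
     basis_of <<grad_family e cG cH [set: E]%SET I K zs>>%VS
              (grad_family e cG cH I1 I2 I3 zs) ->
   forall (I4 : {set T}) (I5 I6 : {set C}),
     I4 \subset Itheta -> I5 \subset J -> I6 \subset J ->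
   forall (ws : T -> 'rV[R]_N) (lam : T -> R) (mu : E -> R) (a b : C -> R),
     (forall i, i \in I4 -> limiting_subdiff (theta i) zs (ws i)) ->
     (forall i, i \in I4 -> 0 <= lam i) ->
     [|| [exists i in I4, lam i != 0], [exists j in I1, mu j != 0],
         [exists i in I2 :|: I5, a i != 0] | [exists i in I3 :|: I6, b i != 0]] ->
     (forall i, i \notin I2 :|: I5 -> a i = 0) ->
     (forall i, i \notin I3 :|: I6 -> b i = 0) ->
     (forall i, i \in J -> (0 < a i /\ 0 < b i) \/ a i * b i = 0) ->
     0 = \sum_(i in I4) lam i *: ws i + \sum_(j in I1) mu j *: grad (e j) zs
         - \sum_(i in I2 :|: I5) a i *: grad (cG i) zs
         - \sum_(i in I3 :|: I6) b i *: grad (cH i) zs ->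
   forall (zk : nat -> 'rV[R]_N) (wk : nat -> T -> 'rV[R]_N),
     zk @ \oo --> zs ->
     (forall k, zk k != zs) ->
     (forall i, i \in I4 -> forall k, limiting_subdiff (theta i) (zk k) (wk k i)) ->
     (forall i, i \in I4 -> (fun k => wk k i) @ \oo --> ws i) ->
   \forall k \near \oo,
     ~~ free ([seq wk k i | i in I4] ++
              grad_family e cG cH I1 (I2 :|: I5) (I3 :|: I6) (zk k))).

(* A point (x, y) is the concatenated row vector [w : 'rV_(d + s)], and
   (x, y, u, v) is [z : 'rV_(d + s + m + n)]. *)
Record program (R : realType) (d s m n p q : nat) := Program {
  objF : 'rV[R]_(d + s) -> R;
  conG : 'rV[R]_(d + s) -> 'rV[R]_p;
  conH : 'rV[R]_(d + s) -> 'rV[R]_q;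
  lowf : 'rV[R]_(d + s) -> R;
  lowg : 'rV[R]_(d + s) -> 'rV[R]_m;
  lowh : 'rV[R]_(d + s) -> 'rV[R]_n }.

Definition xyz (R : realType) (d s m n : nat) (z : 'rV[R]_(d + s + m + n)) :
  'rV[R]_(d + s) := lsubmx (lsubmx z).
Definition uz (R : realType) (d s m n : nat) (z : 'rV[R]_(d + s + m + n)) :
  'rV[R]_m := rsubmx (lsubmx z).
Definition vz (R : realType) (d s m n : nat) (z : 'rV[R]_(d + s + m + n)) :
  'rV[R]_n := rsubmx z.

Definition grady (R : realType) (d s : nat) (phi : 'rV[R]_(d + s) -> R)
    (w : 'rV[R]_(d + s)) : 'rV[R]_s :=
  grad (fun y => phi (row_mx (lsubmx w) y)) (rsubmx w).

(* Like ['J], the s x k matrix whose i-th column is the y-gradient of the i-th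
   component, i.e. the transpose of the usual Jacobian matrix. *)
Definition Jy (R : realType) (d s k : nat) (phi : 'rV[R]_(d + s) -> 'rV[R]_k)
    (w : 'rV[R]_(d + s)) : 'M[R]_(s, k) :=
  'J (fun y => phi (row_mx (lsubmx w) y)) (rsubmx w).

Definition lower_feasible (R : realType) (d s m n p q : nat)
    (P : program R d s m n p q) (x : 'rV[R]_d) : set 'rV[R]_s :=
  [set y | (forall i, lowg P (row_mx x y) 0 i <= 0) /\
           lowh P (row_mx x y) = 0].

Definition value_fun (R : realType) (d s m n p q : nat)
    (P : program R d s m n p q) (x : 'rV[R]_d) : \bar R :=
  ereal_inf [set (lowf P (row_mx x y))%:E | y in lower_feasible P x].

Definition value_lipschitz_around (R : realType) (d s m n p q : nat)
    (P : program R d s m n p q) (x : 'rV[R]_d) : Prop :=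
  (\forall x' \near x, value_fun P x' \is a fin_num) /\
  lipschitz_around (fun x' => fine (value_fun P x')) x.

(* f - V as a real function of (x, y), meaningful where V is finite. *)
Definition value_gap (R : realType) (d s m n p q : nat)
    (P : program R d s m n p q) (w : 'rV[R]_(d + s)) : R :=
  lowf P w - fine (value_fun P (lsubmx w)).

Definition gradyL (R : realType) (d s m n p q : nat)
    (P : program R d s m n p q) (w : 'rV[R]_(d + s)) (u : 'rV[R]_m)
    (v : 'rV[R]_n) : 'rV[R]_s :=
  grady (lowf P) w + u *m (Jy (lowg P) w)^T + v *m (Jy (lowh P) w)^T.

Definition Omega (R : realType) (m : nat) : set ('rV[R]_m * 'rV[R]_m) :=
  [set ab : 'rV[R]_m * 'rV[R]_m | [/\ forall i, 0 <= ab.1 0 i, forall i, 0 <= ab.2 0 i &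
                dotv ab.1 ab.2 = 0]].

Definition feasible (R : realType) (d s m n p q : nat)
    (P : program R d s m n p q) : set 'rV[R]_(d + s + m + n) :=
  [set z |
    ((lowf P (xyz z))%:E - value_fun P (lsubmx (xyz z)) <= 0)%E /\
    [/\ forall i, conG P (xyz z) 0 i <= 0,
        conH P (xyz z) = 0,
        lowh P (xyz z) = 0,
        gradyL P (xyz z) (uz z) (vz z) = 0 &
        Omega (- lowg P (xyz z), uz z)]].

Definition local_solution (R : realType) (d s m n p q : nat)
    (P : program R d s m n p q) (zs : 'rV[R]_(d + s + m + n)) : Prop :=
  feasible P zs /\
  \forall z \near zs, feasible P z -> objF P (xyz zs) <= objF P (xyz z).

Definition activeG (R : realType) (d s m n p q : nat)
    (P : program R d s m n p q) (z : 'rV[R]_(d + s + m + n)) : {set 'I_p} :=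
  [set i | conG P (xyz z) 0 i == 0]%SET.

Definition Iset (R : realType) (d s m n p q : nat)
    (P : program R d s m n p q) (z : 'rV[R]_(d + s + m + n)) : {set 'I_m} :=
  [set i | (lowg P (xyz z) 0 i == 0) && (0 < uz z 0 i)]%SET.

Definition Jset (R : realType) (d s m n p q : nat)
    (P : program R d s m n p q) (z : 'rV[R]_(d + s + m + n)) : {set 'I_m} :=
  [set i | (lowg P (xyz z) 0 i == 0) && (uz z 0 i == 0)]%SET.

Definition Kset (R : realType) (d s m n p q : nat)
    (P : program R d s m n p q) (z : 'rV[R]_(d + s + m + n)) : {set 'I_m} :=
  [set i | (lowg P (xyz z) 0 i < 0) && (uz z 0 i == 0)]%SET.

(* Index [None] is theta_0 and [Some i] is the constraint G_i. *)
Definition theta (R : realType) (d s m n p q : nat)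
    (P : program R d s m n p q) (i : option 'I_p)
    (z : 'rV[R]_(d + s + m + n)) : R :=
  if i is Some j then conG P (xyz z) 0 j else value_gap P (xyz z).

Definition active_theta (R : realType) (d s m n p q : nat)
    (P : program R d s m n p q) (z : 'rV[R]_(d + s + m + n)) :
    {set option 'I_p} :=
  [set i | if i is Some j then j \in activeG P z else true]%SET.

Definition equality (R : realType) (d s m n p q : nat)
    (P : program R d s m n p q) (j : 'I_(q + n + s))
    (z : 'rV[R]_(d + s + m + n)) : R :=
  row_mx (row_mx (conH P (xyz z)) (lowh P (xyz z)))
         (gradyL P (xyz z) (uz z) (vz z)) 0 j.

Definition compG (R : realType) (d s m n p q : nat)
    (P : program R d s m n p q) (i : 'I_m) (z : 'rV[R]_(d + s + m + n)) : R :=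
  - lowg P (xyz z) 0 i.

Definition compH (R : realType) (d s m n : nat) (i : 'I_m)
    (z : 'rV[R]_(d + s + m + n)) : R := uz z 0 i.

Definition RCPLD_CP (R : realType) (d s m n p q : nat)
    (P : program R d s m n p q) (zs : 'rV[R]_(d + s + m + n)) : Prop :=
  RCPLD (theta P) (equality P) (compG P) (@compH R d s m n)
    (active_theta P zs) (Iset P zs) (Jset P zs) (Kset P zs) zs.

Definition Mstationary (R : realType) (d s m n p q : nat)
    (P : program R d s m n p q) (zs : 'rV[R]_(d + s + m + n)) : Prop :=
  feasible P zs /\
  let ws := xyz zs in
  exists (lamV : R) (lamG : 'I_p -> R) (lamH : 'rV[R]_q) (lamh : 'rV[R]_n)
         (lamL : 'rV[R]_s) (a b : 'rV[R]_m) (xiF xiV : 'rV[R]_(d + s)),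
    [/\ 0 <= lamV,
        forall i, i \in activeG P zs -> 0 <= lamG i,
        limiting_subdiff (objF P) ws xiF &
        limiting_subdiff (value_gap P) ws xiV] /\
    0 = xiF + lamV *: xiV
        + \sum_(i in activeG P zs) lamG i *: grad (fun w => conG P w 0 i) ws
        + lamH *m ('J (conH P) ws)^T + lamh *m ('J (lowh P) ws)^T
        + lamL *m ('J (fun w => gradyL P w (uz zs) (vz zs)) ws)^T
        + \sum_(i in Iset P zs :|: Jset P zs)
             a 0 i *: grad (fun w => lowg P w 0 i) ws /\
    lamL *m Jy (lowg P) ws - b = 0 /\
    lamL *m Jy (lowh P) ws = 0 /\
    [/\ forall i, i \in Iset P zs -> b 0 i = 0,
        forall i, i \in Kset P zs -> a 0 i = 0 &
        forall i, i \in Jset P zs ->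
          (0 < a 0 i /\ 0 < b 0 i) \/ a 0 i * b 0 i = 0].

(* Main.v *)
Require Import Defs.
From mathcomp Require Import all_boot all_order all_algebra.
From mathcomp Require Import all_classical all_reals all_analysis.
From mathcomp Require Import ring lra.
Import Order.TTheory GRing.Theory Num.Theory.
Import numFieldNormedType.Exports.
Local Open Scope classical_set_scope.
Local Open Scope ring_scope.

(** The local minimizer is approximated by minimizers [(z1, z)] of
    [F z1 + |z - zs|^2/2 + k |z1 - z|^2/2 + k (quadratic penalty of the constraints at z)].
    Only [F] is evaluated at [z1], and at [z] the value-function constraint is the only
    nonsmooth term, so no sum rule for limiting subdifferentials is needed: [z1] yields a
    regular subgradient of [F], and [z] an exact stationarity equation whose nonsmooth part
    is a regular subgradient of [f - V] at the same point as all the gradients.  By the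
    constant rank condition the equality, [I] and [K] gradients can be rewritten in a fixed
    basis, and Caratheodory's reduction modulo their span makes the whole family of used
    gradients linearly independent without changing the signs of the other multipliers.
    Normalize the multipliers, together with the coefficient [tau] of the objective, to have
    l1-norm one and pass to the limit.  If the limit of [tau] is positive, dividing by it
    gives M-stationarity; if it is zero, the limit multipliers satisfy the hypotheses of
    RCPLD (ii), which contradicts the linear independence. *)

Set Implicit Arguments.
Unset Strict Implicit.
Unset Printing Implicit Defensive.

(** * Finite families of vectors *)

(** Compactness is used along a single ultrafilter on the indices: points, subgradients and
    normalized multipliers converge together, and the set of nonzero multipliers is eventually
    constant. A diagonal choice then returns to sequences, over which [limiting_subdiff] and [RCPLD]
    quantify.

    Local Lipschitz constants bound the subgradients, so a vanishing limit of [tau] really erases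
    the objective. RCPLD (ii) only concerns sequences avoiding [zs]; this costs nothing, because at
    [z = zs] every penalty multiplier vanishes and [tau = 1].

    The sign condition of M-stationarity comes from the shape of the complementarity penalty: it is
    a minimum of two smooth pieces, and on the piece attaining the minimum the two partial
    derivatives are both negative or one of them is zero. The reduction preserves this because it
    never reverses a sign on [J].

    If the limit multiplier of [f - V] is zero, its vector need not be a subgradient, whereas
    M-stationarity still asks for one; hence the separate proof that limiting subdifferentials are
    nonempty. *)

Definition indep (R : fieldType) (V : lmodType R) (K : finType) (S : {set K})
    (v : K -> V) : Prop :=
  forall c : K -> R, \sum_(k in S) c k *: v k = 0 -> forall k, k \in S -> c k = 0.

Lemma sum_enum_val (V : nmodType) (K : finType) (S : {set K}) (F : K -> V) :
  \sum_(k in S) F k = \sum_(i < #|S|) F (enum_val i).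
Proof. exact: big_enum_val. Qed.

(** Bridge between the sequence-based [free] of the definition of RCPLD and coefficient functions on
    an index set, the form in which all dependencies are manipulated. *)
Lemma free_image (R : fieldType) (V : vectType R) (K : finType) (S : {set K})
    (v : K -> V) : free [seq v k | k in S] <-> indep S v.
Proof.
have nthE (i : 'I_#|S|) : [tuple of [seq v k | k in S]]`_i = v (enum_val i).
  by rewrite /= nth_image.
split=> [/(@freeP _ _ _ [tuple of [seq v k | k in S]]) H c Hc k kS|H].
  rewrite -(enum_rankK_in kS kS); apply: (H (fun i => c (enum_val i))).
  by rewrite -[RHS]Hc [RHS]sum_enum_val; apply: eq_bigr => i _; rewrite nthE.
apply/(freeP (X := [tuple of [seq v k | k in S]])) => c Hc i.
(* Coefficients given by position in the enumeration become a function on all of [K]; the default 0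
   is only taken outside [S]. *)
pose c' k := if insub (index k (enum S)) is Some j then c j else 0.
have c'E j : c' (enum_val j) = c j.
  rewrite /c'; case: insubP => [j' _ jj'|].
    congr (c _); apply: val_inj; rewrite jj' /=.
    by rewrite /enum_val index_uniq ?enum_uniq// -cardE.
  by rewrite /enum_val index_uniq ?enum_uniq -?cardE// ltn_ord.
rewrite -c'E; apply: H; last exact: enum_valP.
rewrite -[RHS]Hc [LHS]sum_enum_val; apply: eq_bigr => j _.
by rewrite nthE c'E.
Qed.

Lemma mem_span_image (R : fieldType) (V : vectType R) (K : finType) (S : {set K})
    (v : K -> V) x :
  x \in <<[seq v k | k in S]>>%VS <->
  exists c : K -> R, x = \sum_(k in S) c k *: v k.
Proof.
split=> [|[c ->]]; last first.
  apply: memv_suml => k kS; apply/memvZ/memv_span.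
  by apply: map_f; rewrite mem_enum.
move=> /(@coord_span _ _ _ [tuple of [seq v k | k in S]]) ->.
pose d i := coord [tuple of [seq v k | k in S]] i x.
exists (fun k => if insub (index k (enum S)) is Some j then d j else 0).
rewrite [RHS]sum_enum_val; apply: eq_bigr => i _.
rewrite /= nth_image; congr (_ *: _).
case: insubP => [j' _ jj'|].
  congr (d _); apply: val_inj; rewrite jj' /=.
  by rewrite /enum_val index_uniq ?enum_uniq// -cardE.
by rewrite /enum_val index_uniq ?enum_uniq -?cardE// ltn_ord.
Qed.

Definition set_sum (I J : finType) (A : {set I}) (B : {set J}) : {set I + J} :=
  [set k | match k with inl i => i \in A | inr j => j \in B end]%SET.

Definition fun_sum (I J : Type) (V : Type) (f : I -> V) (g : J -> V) (k : I + J) : V :=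
  match k with inl i => f i | inr j => g j end.

(** A concatenation of families becomes one family over a disjoint union, repetitions included, so
    that a single multiplier function can serve all kinds of constraints. *)
Lemma image_sum (I J : finType) (V : Type) (A : {set I}) (B : {set J})
    (f : I -> V) (g : J -> V) :
  [seq f i | i in A] ++ [seq g j | j in B] =
  [seq fun_sum f g k | k in set_sum A B].
Proof.
rewrite /image_mem /enum_mem.
have -> : Finite.enum (I + J)%type = sum_enum I J by rewrite unlock.
rewrite /sum_enum filter_cat map_cat !filter_map -!map_comp; congr (_ ++ _).
  by congr map; apply: eq_filter => i; rewrite /= !inE.
by congr map; apply: eq_filter => i; rewrite /= !inE.
Qed.

Lemma big_set_sum (M : nmodType) (I J : finType) (A : {set I}) (B : {set J})
    (F : I + J -> M) :
  \sum_(k in set_sum A B) F k =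
  \sum_(i in A) F (inl i) + \sum_(j in B) F (inr j).
Proof.
by rewrite big_sumType /=; congr (_ + _); apply: eq_bigl => k; rewrite !inE.
Qed.

(** * Limits of finite sums and stability of linear independence *)

Lemma cvg_sum (R : numFieldType) (V : normedModType R) (T : Type) (I : Type)
    (F : set_system T) {FF : Filter F} (r : seq I) (P : pred I)
    (f : I -> T -> V) (l : I -> V) :
  (forall i, P i -> f i x @[x --> F] --> l i) ->
  \sum_(i <- r | P i) f i x @[x --> F] --> \sum_(i <- r | P i) l i.
Proof.
by move=> H; apply: cvg_big => // x; exact: (@add_continuous V).
Qed.

Lemma cvg_coord (R : realType) (T : Type) (F : set_system T) {FF : Filter F}
    m n (f : T -> 'M[R]_(m, n)) (l : 'M[R]_(m, n)) i j :
  f x @[x --> F] --> l -> f x i j @[x --> F] --> l i j.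
Proof.
move=> fl; have := @coord_continuous R m n i j l.
exact: cvg_comp.
Qed.

(** The rows of the limit matrix have a right inverse [B]. Near the limit [A (v t) *m B] is close to
    the identity, and a row [u] killed by [A (v t)] satisfies [u = u *m (1 - A (v t) *m B)], a
    contraction in the l1-norm, so [u = 0]. *)
Lemma indep_near (R : realType) (T : Type) (F : set_system T) {FF : Filter F}
    (N : nat) (K : finType) (S : {set K}) (v : T -> K -> 'rV[R]_N)
    (v0 : K -> 'rV[R]_N) :
  (forall k, k \in S -> v t k @[t --> F] --> v0 k) ->
  indep S v0 -> \forall t \near F, indep S (v t).
Proof.
move=> vv0 ind0.
pose A (w : K -> 'rV[R]_N) := \matrix_(i < #|S|) w (enum_val i).
have mulA (w : K -> 'rV[R]_N) (c : K -> R) :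
    (\row_i c (enum_val i)) *m A w = \sum_(k in S) c k *: w k.
  rewrite mulmx_sum_row [RHS]sum_enum_val; apply: eq_bigr => i _.
  by rewrite mxE rowK.
have /row_freeP[B AB] : row_free (A v0).
  rewrite -kermx_eq0; apply/rowV0P => u /sub_kermxP uA.
  have [k0|nok] := pickP (mem S); last first.
    by apply/rowP => i; have := nok (enum_val i); rewrite inE enum_valP.
  move=> k0S; pose c k := u 0 (enum_rank_in k0S k).
  have cE i : c (enum_val i) = u 0 i by rewrite /c enum_valK_in.
  apply/rowP => i; rewrite [RHS]mxE -cE; apply: ind0; last exact: enum_valP.
  by rewrite -mulA -[RHS]uA; congr (_ *m _); apply/rowP => j; rewrite mxE cE.
have cAB i j : (A (v t) *m B) i j @[t --> F] --> (1%:M : 'M[R]_#|S|) i j.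
  rewrite -AB [X in _ --> X]mxE.
  rewrite (_ : (fun t => _) = fun t => \sum_l A (v t) i l * B l j); last first.
    by apply/funext => t; rewrite mxE.
  apply: cvg_sum => l _; apply: cvgM; last exact: cvg_cst.
  rewrite mxE (_ : (fun t => _) = fun t => v t (enum_val i) 0 l); last first.
    by apply/funext => t; rewrite mxE.
  by apply: cvg_coord; apply: vv0; exact: enum_valP.
(* Entries below this bound give the contraction factor [#|S| / (#|S| + 1) < 1]; the successor also
   covers the empty set. *)
have e0 : 0 < (#|S|.+1)%:R^-1 :> R by rewrite invr_gt0 ltr0n.
have near_small : \forall t \near F, forall ij : 'I_#|S| * 'I_#|S|,
    `|(1%:M : 'M[R]_#|S|) ij.1 ij.2 - (A (v t) *m B) ij.1 ij.2| < (#|S|.+1)%:R^-1.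
  apply: filter_forall => -[i j] /=.
  by have /cvgrPdist_lt := cAB i j; apply.
apply: filterS near_small => t small c.
rewrite -mulA => cA0.
set u := \row_i _ in cA0.
have uE : u = u *m (1%:M - A (v t) *m B).
  by rewrite mulmxBr mulmx1 mulmxA cA0 mul0mx subr0.
have le_sum j : `|u 0 j| <= (#|S|.+1)%:R^-1 * \sum_i `|u 0 i|.
  rewrite {1}uE mxE mulr_sumr; apply: le_trans (ler_norm_sum _ _ _) _.
  apply: ler_sum => i _; rewrite normrM mulrC ler_wpM2r//.
  by rewrite [X in `|X|]mxE [X in _ + X]mxE; exact/ltW/(small (i, j)).
have : \sum_i `|u 0 i| <= \sum_(j < #|S|) (#|S|.+1)%:R^-1 * \sum_i `|u 0 i|.
  by apply: ler_sum => j _; exact: le_sum.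
rewrite sumr_const card_ord -mulrnAl -mulr_natl.
have s0 : 0 <= \sum_i `|u 0 i| by exact: sumr_ge0.
have lt1 : #|S|%:R * (#|S|.+1)%:R^-1 < 1 :> R.
  by rewrite ltr_pdivrMr ?ltr0n// mul1r ltr_nat.
move=> le1; have s00 : \sum_i `|u 0 i| = 0.
  apply/eqP; rewrite eq_le s0 andbT leNgt; apply/negP => spos.
  have : #|S|%:R * (#|S|.+1)%:R^-1 * \sum_i `|u 0 i| < \sum_i `|u 0 i|.
    by rewrite -[ltRHS]mul1r ltr_pM2r.
  by rewrite ltNge le1.
move=> k kS; have := le_sum (enum_rank_in kS k).
by rewrite s00 mulr0 normr_le0 mxE enum_rankK_in// => /eqP.
Qed.

(** * Selection of independent subfamilies *)

Lemma exists_basis (R : fieldType) (V : vectType R) (K : finType) (A : {set K})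
    (v : K -> V) : exists S : {set K}, [/\ S \subset A,
      free [seq v k | k in S] &
      <<[seq v k | k in S]>>%VS = <<[seq v k | k in A]>>%VS].
Proof.
pose good (S : {set K}) := (S \subset A) && free [seq v k | k in S].
have good0 : good finset.set0.
  rewrite /good finset.sub0set /=; by apply/free_image => c _ k; rewrite inE.
case: (@arg_maxnP _ finset.set0 good (fun S => #|S|) good0) => S /andP[SA Sfree] Smax.
exists S; split => //; apply/eqP.
have sub : (<<[seq v k | k in S]>> <= <<[seq v k | k in A]>>)%VS.
  apply: sub_span => x /mapP[k]; rewrite mem_enum => kS ->.
  apply: map_f; rewrite mem_enum; exact: (fintype.subsetP SA).
rewrite eqEsubv sub /=; apply/span_subvP => x /mapP[k]; rewrite mem_enum => kA ->.
have [kS|kS] := boolP (k \in S); first by apply/memv_span/map_f; rewrite mem_enum.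
apply/negPn/negP => kspan.
have : good (k |: S)%SET.
  rewrite /good finset.subUset finset.sub1set kA SA /=.
  have /perm_free -> : perm_eq [seq v i | i in (k |: S)%SET] (v k :: [seq v i | i in S]).
    rewrite -[_ :: _]/(map v (k :: enum S)); apply: perm_map.
    apply: uniq_perm; rewrite /= ?enum_uniq ?mem_enum ?kS//.
    by move=> i; rewrite in_cons !mem_enum !inE.
  by rewrite free_cons kspan Sfree.
move=> /Smax; rewrite cardsU1 kS /=; by rewrite add1n ltnn.
Qed.

(* Carathéodory's reduction modulo a subspace: a minimal sub-support works, since a
   dependency lets one move along it until the first coefficient vanishes. *)
Lemma caratheodory (R : realFieldType) (V : vectType R) (K : finType)
    (U : {vspace V}) (v : K -> V) (c : K -> R) :
  exists c' : K -> R,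
    [/\ \sum_k c k *: v k - \sum_k c' k *: v k \in U,
        forall k, c' k != 0 -> 0 < c' k * c k &
        forall e : K -> R, (forall k, c' k = 0 -> e k = 0) ->
          \sum_k e k *: v k \in U -> forall k, e k = 0].
Proof.
have [n] := ubnP #|[set k | c k != 0]%SET|; elim: n c => // n IH c cn.
pose bad (e : K -> R) := [/\ forall k, c k = 0 -> e k = 0,
  \sum_k e k *: v k \in U & exists k, e k != 0].
have [[e [e0 eU [k1 ek1]]]|nobad] := pselect (exists e, bad e); last first.
  exists c; split=> [|k ck|e e0 eU k].
  - by rewrite subrr mem0v.
  - by rewrite -expr2 exprn_even_gt0.
  - apply/eqP/negPn/negP => ek; apply: nobad; exists e; split => //.
    by exists k.
have {e e0 eU k1 ek1} [e [e0 eU [k1 ek1]]] : exists e : K -> R,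
    [/\ forall k, c k = 0 -> e k = 0, \sum_k e k *: v k \in U &
     exists k, 0 < e k / c k].
  have ck1 : c k1 != 0 by apply: contra ek1 => /eqP /e0 ->.
  have [ec|ec] := ltP 0 (e k1 / c k1); first by exists e; split => //; exists k1.
  exists (fun k => - e k); split=> [k ck||].
  - by rewrite e0 ?oppr0.
  - rewrite (eq_bigr (fun k => - (e k *: v k))) => [|k _]; last by rewrite scaleNr.
    by rewrite sumrN memvN.
  - exists k1; rewrite mulNr oppr_gt0 lt_neqAle ec andbT.
    by rewrite mulf_neq0// invr_neq0.
case: (@arg_maxP _ _ _ k1 xpredT (fun k => e k / c k) isT) => k2 _ k2max.
have k2pos : 0 < e k2 / c k2 by apply: lt_le_trans ek1 _; exact: k2max.
have ck2 : c k2 != 0.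
  by apply: contraTN k2pos => /eqP ->; rewrite invr0 mulr0 ltxx.
(* Longest admissible step: all ratios [e k / c k] are at most [1 / t], so no coefficient of
   [c - t e] changes sign, and the one at [k2] becomes zero. *)
pose t := (e k2 / c k2)^-1.
have t0 : 0 < t by rewrite invr_gt0.
pose d k := c k - t * e k.
have dk2 : d k2 = 0.
  rewrite /d /t invf_div mulrAC -mulrA divff ?mulr1 ?subrr//.
  by apply: contraTN k2pos => /eqP ->; rewrite mul0r ltxx.
have dc k : c k = 0 -> d k = 0 by move=> ck; rewrite /d ck e0// mulr0 subrr.
have dpos k : 0 <= d k * c k.
  have [ck|ck] := eqVneq (c k) 0; first by rewrite ck mulr0.
  have -> : d k * c k = (1 - t * (e k / c k)) * (c k) ^+ 2.
    by rewrite /d; field.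
  rewrite mulr_ge0 ?sqr_ge0// subr_ge0.
  by rewrite -[leRHS](mulVf (lt0r_neq0 k2pos)) ler_pM2l//; exact: k2max.
have dn : (#|[set k | d k != 0%R]%SET| < n)%N.
  rewrite -ltnS; apply: leq_trans cn; apply: proper_card; apply/fintype.properP; split.
    by apply/fintype.subsetP => k; rewrite !inE; apply: contra => /eqP /dc ->.
  by exists k2; rewrite !inE ?dk2 ?eqxx.
have [c' [c'U c'pos c'ind]] := IH d dn.
exists c'; split => //.
- rewrite -[X in X - _](subrK (\sum_k d k *: v k)) -addrA memvD//.
  rewrite -sumrB (eq_bigr (fun k => t *: (e k *: v k))) => [|k _].
    by rewrite -scaler_sumr memvZ.
  by rewrite -scalerBl /d opprB addrC subrK scalerA.
- move=> k ck'; have ckd := c'pos k ck'.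
  have dk : d k != 0 by apply: contraTN ckd => /eqP ->; rewrite mulr0 ltxx.
  have ck : c k != 0 by apply: contra dk => /eqP /dc ->.
  have dcpos : 0 < d k * c k by rewrite lt_neqAle dpos andbT eq_sym mulf_neq0.
  have := mulr_gt0 ckd dcpos.
  have -> : c' k * d k * (d k * c k) = (c' k * c k) * d k ^+ 2 by ring.
  by rewrite pmulr_lgt0// exprn_even_gt0.
Qed.

(** * Regular sub- and superdifferentials *)

Lemma norm_coord_le (R : realType) m n (x : 'M[R]_(m, n)) i j : `|x i j| <= `|x|.
Proof.
by rewrite [leRHS]/Num.norm /= mx_normrE; apply: (le_bigmax _ _ (i, j)).
Qed.

Lemma norm_mx_le (R : realType) m n (x : 'M[R]_(m, n)) C :
  0 <= C -> (forall i j, `|x i j| <= C) -> `|x| <= C.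
Proof.
move=> C0 H; rewrite [leLHS]/Num.norm /= mx_normrE.
by apply: bigmax_le => // -[i j] _ /=.
Qed.

Section Dot.
Variables (R : realType) (N : nat).
Implicit Types (x y z : 'rV[R]_N).

Lemma dotvC x y : dotv x y = dotv y x.
Proof. by apply: eq_bigr => i _; rewrite mulrC. Qed.

Lemma dotvDl x y z : dotv (x + y) z = dotv x z + dotv y z.
Proof. by rewrite -big_split; apply: eq_bigr => i _; rewrite mxE mulrDl. Qed.

Lemma dotvZl k x y : dotv (k *: x) y = k * dotv x y.
Proof. by rewrite mulr_sumr; apply: eq_bigr => i _; rewrite mxE mulrA. Qed.

Lemma dotvNl x y : dotv (- x) y = - dotv x y.
Proof. by rewrite -scaleN1r dotvZl mulN1r. Qed.

Lemma dotvDr x y z : dotv z (x + y) = dotv z x + dotv z y.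
Proof. by rewrite !(dotvC z) dotvDl. Qed.

Lemma dotvZr k x y : dotv y (k *: x) = k * dotv y x.
Proof. by rewrite !(dotvC y) dotvZl. Qed.

Lemma dotvNr x y : dotv x (- y) = - dotv x y.
Proof. by rewrite !(dotvC x) dotvNl. Qed.

Lemma dotv0l y : dotv 0 y = 0.
Proof. by rewrite -(scale0r 0) dotvZl mul0r. Qed.

Lemma dotv_delta x j : dotv x (delta_mx 0 j) = x 0 j.
Proof.
rewrite /dotv (bigD1 j)//= big1 ?addr0 ?mxE ?eqxx ?mulr1// => i ij.
by rewrite mxE (negbTE ij) mulr0.
Qed.

Lemma norm_dotv_le x y : `|dotv x y| <= (\sum_i `|x 0 i|) * `|y|.
Proof.
rewrite mulr_suml; apply: le_trans (ler_norm_sum _ _ _) _.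
by apply: ler_sum => i _; rewrite normrM ler_wpM2l// norm_coord_le.
Qed.

(** With [sqr_norm_le_dotv], this compares the smooth Euclidean square used in the penalties with
    the sup norm that measures increments. *)
Lemma dotv_sq_le x : dotv x x <= N%:R * `|x| ^+ 2.
Proof.
have -> : N%:R * `|x| ^+ 2 = \sum_(i < N) `|x| ^+ 2.
  by rewrite sumr_const card_ord mulr_natl.
apply: ler_sum => i _; rewrite -expr2 -real_normK ?num_real//.
by rewrite lerXn2r ?nnegrE// norm_coord_le.
Qed.

Lemma dotv_ge0 x : 0 <= dotv x x.
Proof. by apply: sumr_ge0 => i _; rewrite -expr2 sqr_ge0. Qed.

Lemma sqr_norm_le_dotv x : `|x| ^+ 2 <= dotv x x.
Proof.
have H i : (x 0 i) ^+ 2 <= dotv x x.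
  rewrite /dotv (bigD1 i)//= -expr2 lerDl; apply: sumr_ge0 => j _.
  by rewrite -expr2 sqr_ge0.
have d0 := dotv_ge0 x.
rewrite -[leRHS](sqr_sqrtr d0) lerXn2r ?nnegrE ?sqrtr_ge0//.
apply: norm_mx_le; first exact: sqrtr_ge0.
by move=> i j; rewrite ord1 -sqrtr_sqr ler_sqrt.
Qed.

End Dot.

(* Membership in the regular superdifferential. *)
Definition upper_grad (R : realType) (N : nat) (phi : 'rV[R]_N -> R)
    (z gam : 'rV[R]_N) : Prop :=
  forall eps : R, 0 < eps -> \forall z' \near z,
    phi z' - phi z - dotv gam (z' - z) <= eps * `|z' - z|.

(** Differentiability with gradient [gam], split so that its two one-sided halves are
    [regular_subdiff] and [upper_grad]. *)
Definition frechet (R : realType) (N : nat) (phi : 'rV[R]_N -> R)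
    (z gam : 'rV[R]_N) : Prop :=
  forall eps : R, 0 < eps -> \forall z' \near z,
    `|phi z' - phi z - dotv gam (z' - z)| <= eps * `|z' - z|.

(* Calmness with one constant at all points near [z] is used in place of local Lipschitz
   continuity: for continuously differentiable functions it needs no mean value theorem. *)
Definition calm (R : realType) (N : nat) (phi : 'rV[R]_N -> R) (L : R)
    (z : 'rV[R]_N) : Prop :=
  \forall z' \near z, `|phi z' - phi z| <= L * `|z' - z|.

Section Frechet.
Variables (R : realType) (N : nat).
Implicit Types (z gam zeta : 'rV[R]_N) (phi : 'rV[R]_N -> R).

Lemma near_dist_lt (z : 'rV[R]_N) e : 0 < e -> \forall z' \near z, `|z' - z| < e.
Proof. by move=> e0; near=> z'; rewrite distrC; near: z'; exact: cvgr_dist_lt. Unshelve. all: by end_near. Qed.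

(** A one-sided bound suffices since every direction may be tested: the step of length [e / 2] along
    coordinate [j], signed like [zeta 0 j], isolates [|zeta 0 j|]. *)
Lemma dotv_near_bound z zeta C : 0 <= C ->
  (\forall z' \near z, dotv zeta (z' - z) <= C * `|z' - z|) -> `|zeta| <= C.
Proof.
move=> C0 /nbhs_ballP[e /= e0 H]; apply: norm_mx_le => // i j; rewrite ord1.
pose sg : R := if 0 <= zeta 0 j then 1 else -1.
have sgE : sg * zeta 0 j = `|zeta 0 j|.
  rewrite /sg; case: ifPn => [h|]; first by rewrite mul1r ger0_norm.
  by rewrite -ltNge mulN1r => h; rewrite ltr0_norm.
pose h : 'rV[R]_N := (e / 2 * sg) *: delta_mx 0 j.
have e2 : 0 < e / 2 by rewrite divr_gt0.
have nh : `|h| <= e / 2.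
  rewrite normrZ normrM (gtr0_norm e2) -mulrA ler_piMr ?(ltW e2)//.
  rewrite (_ : `|sg| = 1) ?mul1r; last first.
    by rewrite /sg; case: ifP => _; rewrite ?normrN normr1.
  apply: norm_mx_le => // i' j'; rewrite mxE.
  by case: (_ && _); rewrite ?normr1 ?normr0.
have /H : ball z e (z + h).
  rewrite -ball_normE /= opprD addrA subrr add0r normrN.
  by apply: le_lt_trans nh _; rewrite ltr_pdivrMr// ltr_pMr// ltr1n.
rewrite [z + h]addrC addrK dotvZr dotv_delta -[e / 2 * sg * _]mulrA sgE => H1.
have : e / 2 * `|zeta 0 j| <= e / 2 * C.
  by apply: le_trans H1 _; rewrite mulrC ler_wpM2r.
by rewrite ler_pM2l.
Qed.

Lemma dotv_near_eq0 z zeta :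
  (forall eps, 0 < eps -> \forall z' \near z, dotv zeta (z' - z) <= eps * `|z' - z|) ->
  zeta = 0.
Proof.
move=> H; apply/eqP; rewrite -normr_le0; apply/ler_addgt0Pr => e e0.
by rewrite add0r; apply: (@dotv_near_bound z) (ltW e0) (H e e0).
Qed.

(** Testing the subgradient inequality with [eps = 1] accounts for the extra 1. The bound provides
    the compactness for subgradients at moving points. *)
Lemma regular_subdiff_bounded phi z zeta L : 0 <= L -> calm phi L z ->
  regular_subdiff phi z zeta -> `|zeta| <= L + 1.
Proof.
move=> L0 cal /(_ 1 ltr01) sub; apply: (@dotv_near_bound z); first by rewrite addr_ge0.
near=> z'.
have H1 : `|phi z' - phi z| <= L * `|z' - z| by near: z'; exact: cal.
have H2 : - (1 * `|z' - z|) <= phi z' - phi z - dotv zeta (z' - z) by near: z'; exact: sub.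
have H3 := le_trans (ler_norm _) H1.
lra.
Unshelve. all: by end_near. Qed.

Lemma frechet_regular phi z gam : frechet phi z gam -> regular_subdiff phi z gam.
Proof.
move=> H eps e0; apply: filterS (H _ e0) => z'.
by rewrite lerNl; apply: le_trans; rewrite -normrN; exact: ler_norm.
Qed.

Lemma frechet_calm phi z gam : frechet phi z gam ->
  calm phi (\sum_i `|gam 0 i| + 1) z.
Proof.
move=> H; apply: filterS (H _ ltr01) => z' Hz'.
rewrite -[X in `|X|](subrK (dotv gam (z' - z))).
apply: le_trans (ler_normD _ _) _; rewrite mulrDl addrC.
exact: lerD (norm_dotv_le _ _) Hz'.
Qed.

(** Absorbs the second-order remainders of the outer functions in both chain rules below. *)
Lemma calm_sqr phi z L : 0 <= L -> calm phi L z -> forall eps, 0 < eps ->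
  \forall z' \near z, (phi z' - phi z) ^+ 2 <= eps * `|z' - z|.
Proof.
move=> L0 cal eps e0; near=> z'.
have H1 : `|phi z' - phi z| <= L * `|z' - z| by near: z'; exact: cal.
have H2 : `|z' - z| < eps / (L ^+ 2 + 1).
  near: z'; apply: near_dist_lt; rewrite divr_gt0// ltr_wpDl// sqr_ge0//.
rewrite -real_normK ?num_real//.
apply: (@le_trans _ _ ((L * `|z' - z|) ^+ 2)).
  by rewrite lerXn2r ?nnegrE ?mulr_ge0.
rewrite exprMn expr2 [_ ^+ 2 in X in _ * X]expr2 mulrA ler_wpM2r//.
move: H2; rewrite ltr_pdivlMr ?ltr_wpDl ?sqr_ge0// => /ltW H2.
apply: le_trans H2; rewrite mulrDr mulr1 mulrC expr2 lerDl//.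
Unshelve. all: by end_near. Qed.

Lemma calm_continuous phi z L : 0 <= L -> calm phi L z -> {for z, continuous phi}.
Proof.
move=> L0 cal; apply/(cvgrPdist_lt (F := nbhs z)) => e e0; near=> z'.
have H1 : `|phi z' - phi z| <= L * `|z' - z| by near: z'; exact: cal.
have H2 : `|z' - z| < e / (L + 1).
  near: z'; apply: near_dist_lt; rewrite divr_gt0// ltr_wpDl//.
rewrite distrC; apply: le_lt_trans H1 _.
move: H2; rewrite ltr_pdivlMr ?ltr_wpDl//; apply: le_lt_trans.
by rewrite mulrDr mulr1 mulrC lerDl.
Unshelve. all: by end_near. Qed.

Lemma upper_gradD phi1 phi2 z gam1 gam2 :
  upper_grad phi1 z gam1 -> upper_grad phi2 z gam2 ->
  upper_grad (fun w => phi1 w + phi2 w) z (gam1 + gam2).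
Proof.
move=> H1 H2 eps e0; have e2 : 0 < eps / 2 by rewrite divr_gt0.
apply: filterS2 (H1 _ e2) (H2 _ e2) => z'; rewrite dotvDl; lra.
Qed.

Lemma upper_grad0 z : upper_grad (fun=> 0) z 0.
Proof. by move=> eps e0; near=> z'; rewrite dotv0l !subrr mulr_ge0// ltW. Unshelve. all: by end_near. Qed.

Lemma upper_grad_sum (I : finType) (phi : I -> 'rV[R]_N -> R) z (gam : I -> 'rV[R]_N) :
  (forall i, upper_grad (phi i) z (gam i)) ->
  upper_grad (fun w => \sum_i phi i w) z (\sum_i gam i).
Proof.
move=> H; elim: (index_enum I) => [|i s IH].
  have := upper_grad0 z; congr upper_grad; last by rewrite big_nil.
  by apply/funext => w; rewrite big_nil.
have := upper_gradD (H i) IH; congr upper_grad; last by rewrite big_cons.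
by apply/funext => w; rewrite big_cons.
Qed.

Lemma upper_gradZ phi z gam k : 0 <= k -> upper_grad phi z gam ->
  upper_grad (fun w => k * phi w) z (k *: gam).
Proof.
move=> k0 H eps e0; have ek : 0 < eps / (k + 1) by rewrite divr_gt0// ltr_wpDl.
apply: filterS (H _ ek) => z' /(ler_wpM2l k0) le1.
rewrite dotvZl -!mulrBr; apply: le_trans le1 _.
rewrite mulrA ler_wpM2r// mulrA ler_pdivrMr ?ltr_wpDl//.
rewrite mulrDr mulr1 [k * _]mulrC lerDl; exact: ltW.
Qed.

(** Applied to a minimum of functions: the piece attaining it at [z] lies above it and touches it
    there. *)
Lemma upper_grad_touch phi psi z gam : (forall w, phi w <= psi w) -> phi z = psi z ->
  upper_grad psi z gam -> upper_grad phi z gam.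
Proof.
move=> le eqz H eps e0; apply: filterS (H _ e0) => z'; apply: le_trans.
by rewrite eqz !lerD2r.
Qed.

Lemma upper_grad_sq z z0 :
  upper_grad (fun w => dotv (w - z0) (w - z0) / 2) z (z - z0).
Proof.
move=> eps e0; near=> z'.
have -> : dotv (z' - z0) (z' - z0) / 2 - dotv (z - z0) (z - z0) / 2
   - dotv (z - z0) (z' - z) = dotv (z' - z) (z' - z) / 2.
  have -> : z' - z0 = (z' - z) + (z - z0) by rewrite addrA subrK.
  move: (z' - z) (z - z0) => a b.
  rewrite !dotvDl !dotvDr (dotvC b a); lra.
have H : `|z' - z| < eps / (N%:R + 1).
  by near: z'; apply: near_dist_lt; rewrite divr_gt0// ltr_wpDl.
rewrite ler_pdivrMr//; apply: le_trans (dotv_sq_le _) _.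
move: H; rewrite ltr_pdivlMr ?ltr_wpDl// => /ltW.
have := normr_ge0 (z' - z); move: (`|z' - z|) => t t0 H.
have := ler_wpM2l t0 H; nra.
Unshelve. all: by end_near. Qed.

(** Chain rule in which the outer function only needs a quadratic upper bound at [phi z]: the linear
    part is handled by differentiability of [phi], the square by calmness. *)
Lemma upper_grad_comp phi (psi : R -> R) z gam p :
  (forall t, psi t <= psi (phi z) + p * (t - phi z) + (t - phi z) ^+ 2) ->
  frechet phi z gam -> upper_grad (fun w => psi (phi w)) z (p *: gam).
Proof.
move=> Hpsi Hphi eps e0.
have L0 : 0 <= \sum_i `|gam 0 i| + 1 by rewrite addr_ge0// sumr_ge0.
have e2 : 0 < eps / 2 by rewrite divr_gt0.
have ep : 0 < eps / 2 / (`|p| + 1) by rewrite divr_gt0// ltr_wpDl.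
apply: filterS2 (Hphi _ ep) (calm_sqr L0 (frechet_calm Hphi) e2) => z' H1 H2.
rewrite dotvZl; have := Hpsi (phi z'); set d := dotv _ _ => H3.
have H4 : p * (phi z' - phi z - d) <= eps / 2 * `|z' - z|.
  apply: le_trans (ler_norm _) _; rewrite normrM.
  apply: (@le_trans _ _ (`|p| * (eps / 2 / (`|p| + 1) * `|z' - z|))).
    by rewrite ler_wpM2l.
  rewrite mulrA ler_wpM2r// mulrA ler_pdivrMr ?ltr_wpDl//.
  rewrite mulrDr mulr1 [`|p| * _]mulrC lerDl; exact: ltW.
lra.
Qed.

(** Fermat's rule with the superdifferentiable terms moved to the other side; this is what replaces
    a sum rule, and it is exact at the point [z]. *)
Lemma upper_grad_min phi psi z gam :
  (\forall z' \near z, phi z + psi z <= phi z' + psi z') ->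
  upper_grad psi z gam -> regular_subdiff phi z (- gam).
Proof.
move=> Hmin H eps e0; apply: filterS2 Hmin (H _ e0) => z'; rewrite dotvNl; lra.
Qed.

(** This and the next two bounds feed [upper_grad_comp]: each outer function has a 1-Lipschitz
    derivative, so its second-order remainder is at most the square of the increment. *)
Lemma half_sqr_expand (c t : R) :
  t ^+ 2 / 2 <= c ^+ 2 / 2 + c * (t - c) + (t - c) ^+ 2.
Proof. by have := sqr_ge0 (t - c); nra. Qed.

Lemma half_sqr_max_expand (c t : R) :
  (Num.max t 0) ^+ 2 / 2 <= (Num.max c 0) ^+ 2 / 2 + Num.max c 0 * (t - c) + (t - c) ^+ 2.
Proof.
have [c0|c0] := leP c 0; have [t0|t0] := leP t 0; have := sqr_ge0 (t - c);
  rewrite ?expr0n/=; nra.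
Qed.

Lemma half_sqr_min_expand (c t : R) :
  (Num.min t 0) ^+ 2 / 2 <= (Num.min c 0) ^+ 2 / 2 + Num.min c 0 * (t - c) + (t - c) ^+ 2.
Proof.
have [c0|c0] := leP c 0; have [t0|t0] := leP t 0; have := sqr_ge0 (t - c);
  rewrite ?expr0n/=; nra.
Qed.

(** Removes the outer function from a subgradient of the penalized nonsmooth constraint. The
    quadratic upper bound turns the subgradient inequality into [dotv zeta (z' - z) <= p * (phi z' -
    phi z) + o(|z' - z|)]; for [p > 0] one divides by [p], for [p = 0] this forces [zeta = 0]. *)
Lemma regular_subdiff_half_sqr_max phi z zeta k L : 0 <= L -> calm phi L z -> 0 <= k ->
  regular_subdiff (fun w => k * (Num.max (phi w) 0 ^+ 2 / 2)) z zeta ->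
  let p := k * Num.max (phi z) 0 in
  (p = 0 -> zeta = 0) /\ (0 < p -> regular_subdiff phi z (p^-1 *: zeta)).
Proof.
move=> L0 cal k0 H p.
have key eps : 0 < eps -> \forall z' \near z,
    dotv zeta (z' - z) <= p * (phi z' - phi z) + eps * `|z' - z|.
  move=> e0; have e2 : 0 < eps / 2 by rewrite divr_gt0.
  have ek : 0 < eps / 2 / (k + 1) by rewrite divr_gt0// ltr_wpDl.
  apply: filterS2 (H _ e2) (calm_sqr L0 cal ek) => z' H1 H2.
  have H3 := ler_wpM2l k0 (half_sqr_max_expand (phi z) (phi z')).
  have H4 : k * (phi z' - phi z) ^+ 2 <= eps / 2 * `|z' - z|.
    apply: le_trans (ler_wpM2l k0 H2) _.
    rewrite mulrA ler_wpM2r// mulrA ler_pdivrMr ?ltr_wpDl//.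
    rewrite mulrDr mulr1 [k * _]mulrC lerDl; exact: ltW.
  by rewrite /p; lra.
split=> [p0|p0].
  apply: (@dotv_near_eq0 z) => eps e0; apply: filterS (key _ e0) => z'.
  by rewrite p0 mul0r add0r.
move=> eps e0; apply: filterS (key _ (mulr_gt0 p0 e0)) => z' H1.
rewrite dotvZl lerBrDr.
rewrite -(ler_pM2l p0) mulrDr mulrA divff ?gt_eqF// mul1r.
lra.
Qed.

End Frechet.

Lemma differentiable_frechet (R : realType) (N : nat) (phi : 'rV[R]_N -> R) z :
  differentiable phi z -> frechet phi z (grad phi z).
Proof.
move=> dphi eps e0.
have dE h : 'd phi z h = dotv (grad phi z) h.
  rewrite {1}[h]row_sum_delta linear_sum /=; apply: eq_bigr => i _.
  by rewrite linearZ /= mxE deriveE// mulrC.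
have := diff_locallyx dphi; set r := 'o _ => Hr.
have := littleoP [littleo of r] e0.
rewrite [X in _ -> X](near_shift 0 z); apply: filterS => h /=.
rewrite subr0 addrK Hr dE => H.
rewrite [X in `|X|](_ : _ = r h)//.
by move: (phi z) (dotv _ _) (r h) => a b c; ring.
Qed.

(** * Compactness and the complementarity penalty *)

Lemma fmap_ultra (S T : Type) (f : S -> T) (U : set_system S) :
  UltraFilter U -> UltraFilter (fmap f U).
Proof.
move=> UU; split=> [|G GG sub]; first exact: fmap_proper_filter.
apply/seteqP; split=> // A GA.
have [//|UnA] := in_ultra_setVsetC (f @^-1` A) UU.
have GnA : G (~` A) by apply: sub.
by have [x []] := filter_ex (filterI GA GnA).
Qed.

Lemma cvg_max (R : realType) (T : Type) (G : set_system T) {FG : Filter G}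
    (f g : T -> R) (a b : R) :
  f x @[x --> G] --> a -> g x @[x --> G] --> b ->
  Num.max (f x) (g x) @[x --> G] --> Num.max a b.
Proof.
move=> fa gb; rewrite maxr_absE (_ : (fun x => _) =
    (fun x => (f x + g x + `|f x - g x|) / 2)); last first.
  by apply/funext => x; rewrite maxr_absE.
apply: cvgM; last exact: cvg_cst.
by apply: cvgD; [exact: cvgD|apply: cvg_norm; exact: cvgB].
Qed.

Lemma cvg_min (R : realType) (T : Type) (G : set_system T) {FG : Filter G}
    (f g : T -> R) (a b : R) :
  f x @[x --> G] --> a -> g x @[x --> G] --> b ->
  Num.min (f x) (g x) @[x --> G] --> Num.min a b.
Proof.
move=> fa gb; rewrite minr_absE (_ : (fun x => _) =
    (fun x => (f x + g x - `|f x - g x|) / 2)); last first.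
  by apply/funext => x; rewrite minr_absE.
apply: cvgM; last exact: cvg_cst.
by apply: cvgB; [exact: cvgD|apply: cvg_norm; exact: cvgB].
Qed.

Lemma cvg_dotv (R : realType) (T : Type) (G : set_system T) {FG : Filter G} N
    (f g : T -> 'rV[R]_N) (a b : 'rV[R]_N) :
  f x @[x --> G] --> a -> g x @[x --> G] --> b ->
  dotv (f x) (g x) @[x --> G] --> dotv a b.
Proof.
by move=> fa gb; apply: cvg_sum => i _; apply: cvgM; exact: cvg_coord.
Qed.

Definition rball (R : realType) N (zs : 'rV[R]_N) (r : R) := [set z | `|z - zs| <= r].

Lemma compact_rball (R : realType) N (zs : 'rV[R]_N) r : 0 < r -> compact (rball zs r).
Proof.
move=> r0; apply: bounded_closed_compact.
  exists (r + `|zs|); split; first exact: num_real.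
  move=> M ltM z /= zr; apply: le_trans (ltW ltM).
  rewrite -[X in `|X|](subrK zs).
  by apply: le_trans (ler_normD _ _) _; rewrite lerD2r.
rewrite (_ : rball zs r = closed_ball zs r); first exact: closed_ball_closed.
by rewrite closed_ballE//; apply/seteqP; split=> z /=; rewrite /rball /closed_ball_ /= distrC.
Qed.

(** Along an ultrafilter any number of bounded quantities converge at once, which replaces
    successive extraction of subsequences. *)
Lemma ultra_cvg (R : realType) N (T : Type) (U : set_system T) (f : T -> 'rV[R]_N) C :
  UltraFilter U -> (\forall t \near U, `|f t| <= C) -> exists l : 'rV[R]_N, f t @[t --> U] --> l.
Proof.
move=> UU fC.
have := @compact_rball R N 0 (Num.max C 1); rewrite compact_ultra lt_max ltr01 orbT.
move=> /(_ isT (fmap f U) (fmap_ultra f UU)) [|l [_ fl]]; last by exists l.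
by apply: filterS fC => t /= ftC; rewrite /rball /= subr0 le_max ftC.
Qed.

Lemma ultra_cvg_real (R : realType) (T : Type) (U : set_system T) (f : T -> R) C :
  UltraFilter U -> (\forall t \near U, `|f t| <= C) -> exists l : R, f t @[t --> U] --> l.
Proof.
move=> UU fC.
have := @segment_compact R (- C) C; rewrite compact_ultra.
move=> /(_ (fmap f U) (fmap_ultra f UU)) [|l [_ fl]]; last by exists l.
by apply: filterS fC => t /=; rewrite in_itv /= ler_norml.
Qed.

(* Half the squared distance of [(g, h)] to the complementarity set
   [{0 <= s _|_ t >= 0}], the union of two half-axes. *)
Definition compl_pen (R : realType) (g h : R) : R :=
  Num.min (Num.min g 0 ^+ 2 / 2 + h ^+ 2 / 2) (g ^+ 2 / 2 + Num.min h 0 ^+ 2 / 2).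

Lemma compl_pen_ge0 (R : realType) (g h : R) : 0 <= compl_pen g h.
Proof. by rewrite le_min !addr_ge0// divr_ge0// sqr_ge0. Qed.

Lemma compl_pen_eq0 (R : realType) (g h : R) :
  compl_pen g h = 0 <-> [/\ 0 <= g, 0 <= h & g * h = 0].
Proof.
rewrite /compl_pen; split=> [|[g0 h0 gh]].
  have H (a b : R) : a ^+ 2 / 2 + b ^+ 2 / 2 = 0 -> a = 0 /\ b = 0.
    move=> ab; have a2 := sqr_ge0 a; have b2 := sqr_ge0 b.
    have /eqP : a ^+ 2 = 0 by lra.
    have /eqP : b ^+ 2 = 0 by lra.
    by rewrite !sqrf_eq0 => /eqP -> /eqP ->.
  rewrite [Num.min (_ + _) _]minElt; case: ifP => _ /H[].
    by move=> /eqP + ->; rewrite minElt; case: ltP => g0; rewrite ?mulr0// (lt_eqF g0).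
  by move=> -> /eqP; rewrite minElt; case: ltP => h0; rewrite ?mul0r// (lt_eqF h0).
have [|] := eqVneq g 0 => [->|gN0].
  rewrite minxx (min_r h0) expr0n /= mul0r !add0r min_r//.
  by rewrite divr_ge0// sqr_ge0.
move/eqP: gh; rewrite mulf_eq0 (negbTE gN0) /= => /eqP ->.
by rewrite minxx (min_r g0) expr0n /= mul0r !addr0 min_l// divr_ge0// sqr_ge0.
Qed.

(** The coefficients are the derivatives of whichever piece attains the minimum. That piece being
    the smaller one excludes opposite signs. The last two conclusions record which component can
    carry a multiplier: near an index where [psi] vanishes and [phi] is positive they force [p = 0],
    and symmetrically [q = 0]. *)
Lemma upper_grad_compl_pen (R : realType) N (phi psi : 'rV[R]_N -> R) z gam del :
  frechet phi z gam -> frechet psi z del ->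
  exists p q : R, [/\ upper_grad (fun w => compl_pen (phi w) (psi w)) z (p *: gam + q *: del),
    (p < 0 /\ q < 0) \/ p * q = 0,
    p != 0 -> phi z != 0 /\ (phi z < 0 \/ phi z <= psi z) &
    q != 0 -> psi z != 0 /\ (psi z < 0 \/ psi z <= phi z)].
Proof.
move=> Hphi Hpsi.
have sqrt_le (a b : R) : 0 <= b -> a ^+ 2 <= b ^+ 2 -> a <= b.
  move=> b0; have [a0|a0 _] := leP 0 a; last exact: ltW (lt_le_trans a0 b0).
  by rewrite ler_pXn2r ?nnegrE.
have u1 := upper_grad_comp (half_sqr_min_expand (phi z)) Hphi.
have u2 := upper_grad_comp (half_sqr_expand (psi z)) Hpsi.
have u3 := upper_grad_comp (half_sqr_expand (phi z)) Hphi.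
have u4 := upper_grad_comp (half_sqr_min_expand (psi z)) Hpsi.
have [le1|/ltW le1] := leP (Num.min (phi z) 0 ^+ 2 / 2 + psi z ^+ 2 / 2)
   (phi z ^+ 2 / 2 + Num.min (psi z) 0 ^+ 2 / 2).
- exists (Num.min (phi z) 0), (psi z); split.
  + apply: upper_grad_touch (upper_gradD u1 u2) => [w|].
      by rewrite /compl_pen ge_min lexx.
    by rewrite /compl_pen min_l.
  + have [g0|g0] := ltP (phi z) 0; last by right; rewrite mul0r.
    have [h0|h0|->] := ltgtP (psi z) 0; [by left| |by right; rewrite mulr0].
    (* With [phi z < 0 < psi z] the first piece exceeds the second by [psi z ^+ 2 / 2], against the
       choice of the piece. *)
    move: le1; rewrite (min_r (ltW h0)) (min_l (ltW g0)) expr0n /= mul0r addr0.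
    by rewrite gerDl; have := exprn_gt0 2 h0; lra.
  + have [g0|g0] := ltP (phi z) 0; last by rewrite eqxx.
    by move=> g1; split => //; left.
  + move=> h1; split => //; have [|h0] := ltP (psi z) 0; first by left.
    right; move: le1; rewrite (min_r h0) expr0n /= mul0r addr0.
    have [g0|g0] := ltP (phi z) 0; last first.
      by rewrite expr0n /= mul0r add0r => le1; apply: sqrt_le => //; lra.
    rewrite gerDl => le1; have : 0 < psi z ^+ 2 by rewrite exprn_even_gt0.
    lra.
- exists (phi z), (Num.min (psi z) 0); split.
  + apply: upper_grad_touch (upper_gradD u3 u4) => [w|].
      by rewrite /compl_pen ge_min lexx orbT.
    by rewrite /compl_pen min_r.
  + have [h0|h0] := ltP (psi z) 0; last by right; rewrite mulr0.
    have [g0|g0|->] := ltgtP (phi z) 0; [by left| |by right; rewrite mul0r].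
    move: le1; rewrite (min_r (ltW g0)) (min_l (ltW h0)) expr0n /= mul0r add0r.
    by rewrite gerDr; have := exprn_gt0 2 g0; lra.
  + move=> h1; split => //; have [|h0] := ltP (phi z) 0; first by left.
    right; move: le1; rewrite (min_r h0) expr0n /= mul0r add0r.
    have [g0|g0] := ltP (psi z) 0; last first.
      by rewrite expr0n /= mul0r addr0 => le1; apply: sqrt_le => //; lra.
    rewrite gerDr => le1; have : 0 < phi z ^+ 2 by rewrite exprn_even_gt0.
    lra.
  + have [g0|g0] := ltP (psi z) 0; last by rewrite eqxx.
    by move=> g1; split => //; left.
Qed.

(** * Quadratic penalization *)

(** Pointwise differentiability only; continuity of the gradients enters later, and only at [zs]. *)
Definition smooth (R : realType) N (phi : 'rV[R]_N -> R) :=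
  forall z, frechet phi z (grad phi z).

Lemma frechet_continuous (R : realType) N (phi : 'rV[R]_N -> R) z gam :
  frechet phi z gam -> {for z, continuous phi}.
Proof.
move=> /frechet_calm; apply: calm_continuous.
by rewrite addr_ge0// sumr_ge0.
Qed.

(* Approximate M-stationarity at [z], with the subgradient of [F] taken at another point
   [z1] and an error [z - zs]. *)
Record approx_stationary (R : realType) (N : nat) (T E C : finType)
    (F th0 : 'rV[R]_N -> R) (th : T -> 'rV[R]_N -> R) (e : E -> 'rV[R]_N -> R)
    (cG cH : C -> 'rV[R]_N -> R) (zs z1 z eta w : 'rV[R]_N)
    (lam0 : R) (lam : T -> R) (mu : E -> R) (a b : C -> R) : Prop := {
  approx_objective : regular_subdiff F z1 eta;
  approx_equation : 0 = eta + (z - zs) + (lam0 *: w + \sum_i lam i *: grad (th i) z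
    + \sum_j mu j *: grad (e j) z
    + \sum_i - a i *: grad (cG i) z + \sum_i - b i *: grad (cH i) z);
  approx_lam0_ge0 : 0 <= lam0;
  approx_lam0_subdiff : lam0 != 0 -> 0 < th0 z /\ regular_subdiff th0 z w;
  approx_lam0_eq0 : lam0 = 0 -> w = 0;
  approx_lam_ge0 : forall i, 0 <= lam i;
  approx_lam_active : forall i, lam i != 0 -> 0 < th i z;
  approx_mu : forall j, mu j != 0 -> e j z != 0;
  approx_compl : forall i, (0 < a i /\ 0 < b i) \/ a i * b i = 0;
  approx_a : forall i, a i != 0 -> cG i z != 0 /\ (cG i z < 0 \/ cG i z <= cH i z);
  approx_b : forall i, b i != 0 -> cH i z != 0 /\ (cH i z < 0 \/ cH i z <= cG i z) }.

Section Penalty.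
Variables (R : realType) (N : nat) (T E C : finType).
Variables (F th0 : 'rV[R]_N -> R) (th : T -> 'rV[R]_N -> R) (e : E -> 'rV[R]_N -> R)
  (cG cH : C -> 'rV[R]_N -> R) (zs : 'rV[R]_N).

Definition penalty (z : 'rV[R]_N) : R :=
  Num.max (th0 z) 0 ^+ 2 / 2 + (\sum_i Num.max (th i z) 0 ^+ 2 / 2
  + \sum_j e j z ^+ 2 / 2 + \sum_i compl_pen (cG i z) (cH i z)).

Definition feasible_system (z : 'rV[R]_N) : Prop :=
  [/\ th0 z <= 0, forall i, th i z <= 0, forall j, e j z = 0 &
      forall i, [/\ 0 <= cG i z, 0 <= cH i z & cG i z * cH i z = 0]].

(** The square of the distance to [zs] carries no factor [k]: it makes the local minimizer strict,
    so that penalized minimizers are driven to [zs], while its gradient [z - zs] tends to zero. *)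
Definition penalized (k : R) (w : 'rV[R]_N * 'rV[R]_N) : R :=
  F w.1 + dotv (w.2 - zs) (w.2 - zs) / 2
  + k * (dotv (w.1 - w.2) (w.1 - w.2) / 2 + penalty w.2).

Lemma penalty_ge0 z : 0 <= penalty z.
Proof.
rewrite !addr_ge0 ?divr_ge0 ?sqr_ge0// sumr_ge0// => i _;
  by rewrite ?compl_pen_ge0 ?divr_ge0 ?sqr_ge0.
Qed.

Lemma penalty_eq0 z : penalty z = 0 <-> feasible_system z.
Proof.
have sq0 (t : R) : 0 <= t ^+ 2 / 2 by rewrite divr_ge0 ?sqr_ge0.
have sq2 (t : R) : t ^+ 2 / 2 = 0 -> t = 0.
  by move=> t0; apply/eqP; rewrite -sqrf_eq0; apply/eqP; lra.
have sqm (t : R) : Num.max t 0 ^+ 2 / 2 = 0 <-> t <= 0.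
  split=> [/sq2 <-|t0]; first by rewrite le_max lexx.
  by rewrite max_r// expr0n mul0r.
have s1 : 0 <= \sum_i Num.max (th i z) 0 ^+ 2 / 2 by exact: sumr_ge0.
have s2 : 0 <= \sum_j e j z ^+ 2 / 2 by exact: sumr_ge0.
have s3 : 0 <= \sum_i compl_pen (cG i z) (cH i z).
  by apply: sumr_ge0 => i _; exact: compl_pen_ge0.
rewrite /penalty; split=> [|[z0 zT zE zC]].
  have := sq0 (Num.max (th0 z) 0); set t0 := _ / 2 => t00 pen0.
  split.
  - by apply/sqm; rewrite -/t0; lra.
  - have s10 : \sum_i Num.max (th i z) 0 ^+ 2 / 2 = 0 by lra.
    by move=> i; apply/sqm; apply: (psumr_eq0P _ s10).
  - have s20 : \sum_j e j z ^+ 2 / 2 = 0 by lra.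
    by move=> i; apply/sq2; apply: (psumr_eq0P _ s20).
  - have s30 : \sum_i compl_pen (cG i z) (cH i z) = 0 by lra.
    move=> i; apply/compl_pen_eq0; apply: (psumr_eq0P _ s30) => // j _.
    exact: compl_pen_ge0.
rewrite (iffRL (sqm _) z0) !big1 ?addr0// => i _; first exact/compl_pen_eq0.
  by rewrite zE expr0n mul0r.
exact/sqm.
Qed.

Hypotheses (th_smooth : forall i, smooth (th i)) (e_smooth : forall j, smooth (e j))
  (cG_smooth : forall i, smooth (cG i)) (cH_smooth : forall i, smooth (cH i)).

Lemma cvg_penalty (S : Type) (G : set_system S) {FG : Filter G} (u : S -> 'rV[R]_N) z :
  {for z, continuous th0} -> u x @[x --> G] --> z -> penalty (u x) @[x --> G] --> penalty z.
Proof.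
move=> th0c uz.
have half2 (f : S -> R) (a : R) : f x @[x --> G] --> a -> f x ^+ 2 / 2 @[x --> G] --> a ^+ 2 / 2.
  move=> fa; apply: cvgM; last exact: cvg_cst.
  by rewrite expr2 (_ : (fun x => _) = (fun x => f x * f x))//; exact: cvgM.
have comp (phi : 'rV[R]_N -> R) : {for z, continuous phi} -> phi (u x) @[x --> G] --> phi z.
  by move=> phic; exact: cvg_comp uz phic.
have smc (phi : 'rV[R]_N -> R) : smooth phi -> phi (u x) @[x --> G] --> phi z.
  by move=> phis; apply/comp/frechet_continuous/phis.
apply: cvgD; first by apply: half2; apply: cvg_max; [exact: comp|exact: cvg_cst].
apply: cvgD; first apply: cvgD.
- by apply: cvg_sum => i _; apply: half2; apply: cvg_max; [exact: smc|exact: cvg_cst].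
- by apply: cvg_sum => i _; apply: half2; exact: smc.
- apply: cvg_sum => i _; apply: cvg_min; apply: cvgD; apply: half2;
    do ?[exact: smc|apply: cvg_min; [exact: smc|exact: cvg_cst]].
Qed.

Lemma cvg_penalized (S : Type) (G : set_system S) {FG : Filter G} (u1 u2 : S -> 'rV[R]_N)
    z1 z2 k : {for z1, continuous F} -> {for z2, continuous th0} ->
  u1 x @[x --> G] --> z1 -> u2 x @[x --> G] --> z2 ->
  penalized k (u1 x, u2 x) @[x --> G] --> penalized k (z1, z2).
Proof.
move=> Fc th0c uz1 uz2; rewrite /penalized /=.
have uzs : u2 x - zs @[x --> G] --> z2 - zs by apply: cvgB => //; exact: cvg_cst.
have u12 : u1 x - u2 x @[x --> G] --> z1 - z2 by exact: cvgB.
apply: cvgD; first apply: cvgD.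
- exact: cvg_comp uz1 Fc.
- by apply: cvgM; [exact: cvg_dotv|exact: cvg_cst].
- apply: cvgM; first exact: cvg_cst.
  apply: cvgD; last exact: cvg_penalty.
  by apply: cvgM; [exact: cvg_dotv|exact: cvg_cst].
Qed.

Variables (LF L0 r : R).
Hypotheses (LF_ge0 : 0 <= LF) (L0_ge0 : 0 <= L0) (r_gt0 : 0 < r).
Hypotheses (F_calm : forall z, rball zs r z -> calm F LF z)
  (th0_calm : forall z, rball zs r z -> calm th0 L0 z)
  (zs_feasible : feasible_system zs)
  (zs_min : forall z, rball zs r z -> feasible_system z -> F zs <= F z).

Lemma penalized_minimizer k : exists w : 'rV[R]_N * 'rV[R]_N,
  [/\ rball zs r w.1, rball zs r w.2 &
      forall z1 z2, rball zs r z1 -> rball zs r z2 -> penalized k w <= penalized k (z1, z2)].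
Proof.
pose B := rball zs r `*` rball zs r.
have cB : compact B by apply: compact_setX; exact: compact_rball.
have Bzs : B (zs, zs) by split; rewrite /rball /= subrr normr0 ltW.
have [||[z1 z2] zB zmin] := @compact_EVT_min _ R (penalized k) B _ cB.
- by exists (zs, zs).
- apply: continuous_in_subspaceT => -[z1 z2]; rewrite inE => -[/= z1B z2B].
  rewrite /continuous_at (_ : penalized k = (fun w => penalized k (w.1, w.2))); last first.
    by apply/funext => -[].
  apply: cvg_penalized.
  + exact: calm_continuous LF_ge0 (F_calm z1B).
  + exact: calm_continuous L0_ge0 (th0_calm z2B).
  + exact: cvg_fst.
  + exact: cvg_snd.
- move: zB; rewrite inE => -[z1B z2B]; exists (z1, z2); split => // y1 y2 y1B y2B.
  by apply: zmin; rewrite inE.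
Qed.

(** Comparison with [(zs, zs)], where the penalized value is [F zs], bounds the penalty by a bounded
    quantity over [k]. In the limit both components coincide at a feasible point, and optimality of
    [zs] leaves no room for a positive distance to [zs]. *)
Lemma penalized_minimizer_near eps : 0 < eps -> exists k (w : 'rV[R]_N * 'rV[R]_N),
  [/\ 0 < k, `|w.1 - zs| < eps, `|w.2 - zs| < eps &
      forall z1 z2, rball zs r z1 -> rball zs r z2 -> penalized k w <= penalized k (z1, z2)].
Proof.
move=> eps0.
have [w Hw] := choice (fun n : nat => penalized_minimizer n.+1%:R).
have wB1 n : rball zs r (w n).1 by have [] := Hw n.
have wB2 n : rball zs r (w n).2 by have [] := Hw n.
have zsB : rball zs r zs by rewrite /rball /= subrr normr0 ltW.
have bound n (u : 'rV[R]_N) : rball zs r u -> `|u| <= r + `|zs|.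
  move=> ur; rewrite -[X in `|X|](subrK zs).
  by apply: le_trans (ler_normD _ _) _; rewrite lerD2r.
have [U [UU Usub]] := ultraFilterLemma (F := \oo) _.
have [p1 wp1] : exists p1 : 'rV[R]_N, (w n).1 @[n --> U] --> p1.
  by apply: (ultra_cvg (C := r + `|zs|) UU); apply: nearW => n; exact: bound.
have [p2 wp2] : exists p2 : 'rV[R]_N, (w n).2 @[n --> U] --> p2.
  by apply: (ultra_cvg (C := r + `|zs|) UU); apply: nearW => n; exact: bound.
have ballP (u : nat -> 'rV[R]_N) p : (forall n, rball zs r (u n)) ->
    u n @[n --> U] --> p -> rball zs r p.
  move=> ur up; rewrite /rball /=.
  apply: (@ler_cvg_to _ U _ _ (fun n => `|u n - zs|) (fun=> r)).
  - by apply: cvg_norm; apply: cvgB => //; exact: cvg_cst.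
  - exact: cvg_cst.
  - by apply: nearW => n; exact: ur.
have p1B := ballP _ _ wB1 wp1; have p2B := ballP _ _ wB2 wp2.
have Fc z : rball zs r z -> {for z, continuous F}.
  by move=> zB; exact: calm_continuous LF_ge0 (F_calm zB).
have th0c z : rball zs r z -> {for z, continuous th0}.
  by move=> zB; exact: calm_continuous L0_ge0 (th0_calm zB).
have penalized_zs k : penalized k (zs, zs) = F zs.
  rewrite /penalized /= subrr dotv0l (iffRL (penalty_eq0 _) zs_feasible).
  by rewrite mul0r !addr0 mulr0 addr0.
have wle n : penalized n.+1%:R (w n) <= F zs.
  by rewrite -(penalized_zs n.+1%:R); have [_ _] := Hw n; exact.
have q0 (x : 'rV[R]_N) : 0 <= dotv x x / 2 by rewrite divr_ge0 ?dotv_ge0.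
pose W (v : 'rV[R]_N * 'rV[R]_N) := dotv (v.1 - v.2) (v.1 - v.2) / 2 + penalty v.2.
have W0 v : 0 <= W v by rewrite addr_ge0 ?penalty_ge0.
have cF : F (w n).1 @[n --> U] --> F p1 by exact: cvg_comp wp1 (Fc _ p1B).
have c12 : (w n).1 - (w n).2 @[n --> U] --> p1 - p2 by exact: cvgB.
have c2s : (w n).2 - zs @[n --> U] --> p2 - zs by apply: cvgB => //; exact: cvg_cst.
have cW : W (w n) @[n --> U] --> W (p1, p2).
  apply: cvgD; last by apply: cvg_penalty => //; exact: th0c.
  by apply: cvgM; [exact: cvg_dotv|exact: cvg_cst].
have h0 : harmonic n @[n --> U] --> (0 : R).
  by apply: cvg_trans cvg_harmonic => A /= HA; exact: Usub.
(* Zero is read as the limit of [harmonic n] times the convergent sequence [F zs - F (w n).1]. *)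
have WE : W (p1, p2) <= 0.
  rewrite -(mul0r (F zs - F p1)).
  apply: (@ler_cvg_to _ U _ _ (fun n => W (w n)) (fun n => harmonic n * (F zs - F (w n).1))) => //.
    by apply: cvgM => //; apply: cvgB => //; exact: cvg_cst.
  apply: nearW => n /=; have := wle n; rewrite /penalized -/(W (w n)) => Hn.
  rewrite /harmonic /= mulrC ler_pdivlMr ?ltr0n//.
  by have := q0 ((w n).2 - zs); lra.
have pen0 : penalty p2 = 0.
  by apply/eqP; rewrite eq_le penalty_ge0 andbT; have := q0 (p1 - p2); move: WE; rewrite /W /=; lra.
have p12 : p1 = p2.
  have d0 : dotv (p1 - p2) (p1 - p2) <= 0.
    by have := WE; rewrite /W /= pen0; lra.
  apply/eqP; rewrite -subr_eq0 -normr_eq0 -sqrf_eq0 eq_le sqr_ge0 andbT.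
  exact: le_trans (sqr_norm_le_dotv _) d0.
(* Dropping the nonnegative penalty before the limit keeps the localizing square. *)
have le_p : F p1 + dotv (p2 - zs) (p2 - zs) / 2 <= F zs.
  apply: (@ler_cvg_to _ U _ _ (fun n => F (w n).1 + dotv ((w n).2 - zs) ((w n).2 - zs) / 2)
    (fun=> F zs)).
  - by apply: cvgD => //; apply: cvgM; [exact: cvg_dotv|exact: cvg_cst].
  - exact: cvg_cst.
  - apply: nearW => n; have := wle n; rewrite /penalized -/(W (w n)).
    by have := W0 (w n); have := ltr0Sn R n; nra.
have pzs : p2 = zs.
  have := zs_min p2B (iffLR (penalty_eq0 _) pen0); rewrite -p12 => lep.
  apply/eqP; rewrite -subr_eq0 -normr_eq0 -sqrf_eq0 eq_le sqr_ge0 andbT.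
  apply: le_trans (sqr_norm_le_dotv _) _; move: le_p; rewrite -p12; lra.
have : \forall n \near U, `|(w n).1 - zs| < eps /\ `|(w n).2 - zs| < eps.
  move: wp1 wp2; rewrite p12 pzs => /cvgrPdistC_lt H1 /cvgrPdistC_lt H2.
  exact: filterI (H1 _ eps0) (H2 _ eps0).
move=> /filter_ex[n [n1 n2]]; exists n.+1%:R, (w n); split => //.
by have [] := Hw n.
Qed.

(** Minimality is exploited in each variable with the other fixed. In [z1] only [F] is nonsmooth; in
    [z] only the penalized [th0] is, everything else having an upper gradient. *)
Lemma exists_approx_stationary eps : 0 < eps -> exists z1 z eta w lam0 lam mu a b,
  [/\ `|z1 - zs| < eps, `|z - zs| < eps &
      approx_stationary F th0 th e cG cH zs z1 z eta w lam0 lam mu a b].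
Proof.
move=> eps0; have er0 : 0 < Num.min eps r by rewrite lt_min eps0.
have [k [[z1 z] /= [k0 z1e ze kmin]]] := penalized_minimizer_near er0.
move: z1e ze; rewrite !lt_min => /andP[z1e z1r] /andP[ze zr].
have nearB (x : 'rV[R]_N) : `|x - zs| < r -> \forall x' \near x, rball zs r x'.
  move=> xr; near=> x'; rewrite /rball /=; rewrite -(subrK x x') -addrA.
  apply: le_trans (ler_normD _ _) _; rewrite -lerBrDr ltW//.
  by near: x'; apply: near_dist_lt; rewrite subr_gt0.
have z1B : rball zs r z1 by exact: ltW.
have zB : rball zs r z by exact: ltW.
have kge0 := ltW k0.
have Ho : regular_subdiff F z1 (- (k *: (z1 - z))).
  apply: upper_grad_min (upper_gradZ kge0 (upper_grad_sq z1 z)).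
  apply: filterS (nearB _ z1r) => x xB.
  by have := kmin x z xB zB; rewrite /penalized /=; lra.
have cpl i := upper_grad_compl_pen (cG_smooth i z) (cH_smooth i z).
have [p cpl2] := choice cpl; have [q Hpq] := choice cpl2.
have up_th i := upper_gradZ kge0 (upper_grad_comp (half_sqr_max_expand (th i z)) (th_smooth i z)).
have up_e j := upper_gradZ kge0 (upper_grad_comp (half_sqr_expand (e j z)) (e_smooth j z)).
have up_c i : upper_grad (fun x => k * compl_pen (cG i x) (cH i x)) z
    (k *: (p i *: grad (cG i) z + q i *: grad (cH i) z)).
  by have [up _ _ _] := Hpq i; exact: upper_gradZ.
have up := upper_gradD (upper_gradD (upper_grad_sq z zs) (upper_gradZ kge0 (upper_grad_sq z z1)))
  (upper_gradD (upper_gradD (upper_grad_sum up_th) (upper_grad_sum up_e)) (upper_grad_sum up_c)).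
set gam := (X in upper_grad _ _ X) in up; pose zeta := - gam.
have Hth0 : regular_subdiff (fun x => k * (Num.max (th0 x) 0 ^+ 2 / 2)) z zeta.
  apply: upper_grad_min up; apply: filterS (nearB _ zr) => x xB.
  have := kmin z1 x z1B xB; rewrite /penalized /penalty /=.
  have sw (u : 'rV[R]_N) : dotv (u - z1) (u - z1) = dotv (z1 - u) (z1 - u).
    by rewrite -(opprB z1 u) dotvNl dotvNr opprK.
  rewrite !sw -!mulr_sumr; lra.
have := regular_subdiff_half_sqr_max L0_ge0 (th0_calm zB) kge0 Hth0.
set lam0 := k * _ => -[zeta0 zetapos].
have lam0_ge0 : 0 <= lam0 by rewrite mulr_ge0// le_max lexx orbT.
(* For [lam0 = 0] the convention [0^-1 = 0] gives [w = 0], which agrees with [zeta = 0]. *)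
pose w := lam0^-1 *: zeta.
have zetaE : zeta = lam0 *: w.
  have [l0|l0] := eqVneq lam0 0; first by rewrite l0 scale0r zeta0.
  by rewrite /w scalerA divff// scale1r.
exists z1, z, (- (k *: (z1 - z))), w, lam0, (fun i => k * Num.max (th i z) 0),
  (fun j => k * e j z), (fun i => - (k * p i)), (fun i => - (k * q i)).
split => //; split => //.
(* The coupling gradient in [z] is [k *: (z - z1)], exactly the subgradient of [F] found at [z1];
   hence the two conditions merge into one equation. *)
- rewrite -zetaE /zeta.
  have sumZ (I : finType) (c : I -> R) (g : I -> 'rV[R]_N) :
      \sum_i (k * c i) *: g i = \sum_i k *: (c i *: g i).
    by apply: eq_bigr => l _; rewrite scalerA.
  have sC : \sum_i k *: (p i *: grad (cG i) z + q i *: grad (cH i) z) =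
      \sum_i - - (k * p i) *: grad (cG i) z + \sum_i - - (k * q i) *: grad (cH i) z.
    by rewrite -big_split; apply: eq_bigr => l _; rewrite !opprK scalerDr !scalerA.
  have -> : - (k *: (z1 - z)) = k *: (z - z1) by rewrite -scalerN opprB.
  rewrite /gam sC !sumZ.
  move: (k *: (z - z1)) (z - zs) (\sum_i _) (\sum_i _) (\sum_i _) (\sum_i _).
  by move=> v1 v2 v3 v4 v5 v6; apply/rowP => l; rewrite !mxE; ring.
- move=> l0; have lpos : 0 < lam0 by rewrite lt_neqAle eq_sym l0.
  split; last exact: zetapos.
  by move: lpos; rewrite /lam0 pmulr_rgt0// lt_max ltxx orbF.
- by move=> l0; rewrite /w l0 invr0 scale0r.
- by move=> i; rewrite mulr_ge0// le_max lexx orbT.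
- move=> i; apply: contraNT; rewrite -leNgt => thi.
  by rewrite max_r// mulr0.
- by move=> j; apply: contra => /eqP ->; rewrite mulr0.
- move=> i; have [_ [[p0 q0]|pq0] _ _] := Hpq i.
    by left; rewrite !oppr_gt0 !pmulr_rlt0.
  by right; rewrite mulrNN mulrACA pq0 mulr0.
- move=> i; rewrite oppr_eq0 mulf_eq0 gt_eqF//=; by have [_ _ + _] := Hpq i; exact.
- move=> i; rewrite oppr_eq0 mulf_eq0 gt_eqF//=; by have [_ _ _] := Hpq i; exact.
Unshelve. all: by end_near.
Qed.

End Penalty.

(** * Multiplier reduction and passage to the limit under RCPLD *)

(** Multipliers on [S] have free sign, so they may be re-expanded in the basis [S0]; the others must
    keep their signs, so they are thinned out modulo the span of [S0] and the discrepancy is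
    absorbed by the basis. *)
Lemma reduce_multipliers (R : realFieldType) (V : vectType R) (K : finType)
    (S0 S : {set K}) (v : K -> V) (c : K -> R) (x : V) :
  S0 \subset S -> indep S0 v ->
  (<<[seq v k | k in S]>> <= <<[seq v k | k in S0]>>)%VS ->
  0 = x + \sum_k c k *: v k ->
  exists c' : K -> R, [/\ 0 = x + \sum_k c' k *: v k,
    forall k, k \in S -> k \notin S0 -> c' k = 0,
    forall k, k \notin S -> c' k != 0 -> 0 < c' k * c k &
    forall d : K -> R, (forall k, k \notin S0 -> c' k = 0 -> d k = 0) ->
      \sum_k d k *: v k = 0 -> forall k, d k = 0].
Proof.
move=> S0S ind0 Sspan eq0.
pose c1 k := if k \in S then 0 else c k.
have [c2 [c2U c2pos c2ind]] := caratheodory <<[seq v k | k in S0]>>%VS v c1.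
have c2S k : k \in S -> c2 k = 0.
  by move=> kS; apply/eqP/negPn/negP => /c2pos; rewrite /c1 kS mulr0 ltxx.
have sumS (d : K -> R) (A : {set K}) :
    \sum_k (if k \in A then d k else 0) *: v k = \sum_(k in A) d k *: v k.
  rewrite [RHS]big_mkcond /=; apply: eq_bigr => k _.
  by case: ifP => _; rewrite ?scale0r.
have xU : - x - \sum_k c2 k *: v k \in <<[seq v k | k in S0]>>%VS.
  have -> : - x - \sum_k c2 k *: v k =
      \sum_(k in S) c k *: v k + (\sum_k c1 k *: v k - \sum_k c2 k *: v k).
    have -> : - x = \sum_k c k *: v k.
      by apply/esym/eqP; rewrite -addr_eq0 addrC -eq0.
    rewrite addrA; congr (_ - _).
    rewrite -(sumS c) -big_split; apply: eq_bigr => k _ /=.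
    by rewrite /c1; case: ifP => _; rewrite scale0r ?addr0 ?add0r.
  rewrite memvD//; apply: (subvP Sspan); apply/mem_span_image; by exists c.
have /mem_span_image[d dE] := xU.
exists (fun k => c2 k + if k \in S0 then d k else 0); split.
- under eq_bigr do rewrite scalerDl.
  by rewrite big_split /= sumS -dE [X in x + X]addrC subrK subrr.
- by move=> k kS /negbTE ->; rewrite addr0 c2S.
- move=> k kS; have kS0 : k \notin S0 by apply: contra kS; exact: (fintype.subsetP S0S).
  by rewrite (negbTE kS0) addr0 => /c2pos; rewrite /c1 (negbTE kS).
- move=> f f0 fsum.
  (* Moving the [S0] part across puts the remaining combination in the span of [S0]; minimality of
     the support kills it, and independence of [S0] kills the rest. *)
  pose f1 k := if k \in S0 then 0 else f k.
  have fE : \sum_k f k *: v k = \sum_(k in S0) f k *: v k + \sum_k f1 k *: v k.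
    rewrite -(sumS f) -big_split; apply: eq_bigr => k _ /=.
    by rewrite /f1; case: ifP => _; rewrite scale0r ?addr0 ?add0r.
  have f1_0 : forall k, f1 k = 0.
    apply: c2ind => [k c2k|].
      rewrite /f1; case: ifPn => // kS0; apply: f0 => //.
      by rewrite c2k add0r (negbTE kS0).
    have -> : \sum_k f1 k *: v k = \sum_(k in S0) (- f k) *: v k.
      rewrite [RHS](eq_bigr (fun k => - (f k *: v k))) => [|k _]; last by rewrite scaleNr.
      by rewrite sumrN; apply/eqP; rewrite -addr_eq0 addrC -fE fsum.
    by apply/mem_span_image; exists (fun k => - f k).
  have f_S0 := ind0 f.
  move=> k; have [kS0|kS0] := boolP (k \in S0).
    apply: f_S0 => //; apply: (etrans _ fsum); rewrite fE [X in _ = _ + X]big1 ?addr0// => l _.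
    by rewrite f1_0 scale0r.
  by have := f1_0 k; rewrite /f1 (negbTE kS0).
Qed.

(** With [cvg_invn], turns limits along an ultrafilter into limits of sequences: the [k]-th index is
    chosen within tolerance [1 / (k + 1)]. *)
Lemma ultra_diagonal (U : set_system nat) (Q : nat -> nat -> Prop) :
  UltraFilter U -> (forall k, \forall n \near U, Q k n) ->
  exists phi : nat -> nat, forall k, Q k (phi k).
Proof.
move=> UU H; have H' k : exists n, Q k n by exact: filter_ex (H k).
by have [phi Hphi] := choice H'; exists phi.
Qed.

Lemma cvg_invn (R : realType) (V : normedModType R) (u : nat -> V) (l : V) :
  (forall k, `|u k - l| < k.+1%:R^-1) -> u k @[k --> \oo] --> l.
Proof.
move=> H; apply/cvgrPdistC_lt => eps eps0.
have := near_infty_natSinv_lt (PosNum eps0); apply: filterS => k /=.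
exact: lt_trans.
Qed.

Section Reduced.
Variables (R : realType) (N : nat) (T E C : finType).
Variables (F : 'rV[R]_N -> R) (theta : option T -> 'rV[R]_N -> R)
  (e : E -> 'rV[R]_N -> R) (cG cH : C -> 'rV[R]_N -> R).
Variables (Itheta : {set option T}) (I J K : {set C}) (zs : 'rV[R]_N).

(* [w] stands for a subgradient of the only nonsmooth constraint [theta None]. *)
Definition constraint_grad (z w : 'rV[R]_N) : option T + (E + (C + C)) -> 'rV[R]_N :=
  fun_sum (fun i => if i is Some _ then grad (theta i) z else w)
    (fun_sum (fun j => grad (e j) z)
      (fun_sum (fun i => grad (cG i) z) (fun i => grad (cH i) z))).

Definition multiplier_set (I4 : {set option T}) (I1 : {set E}) (I2 I3 : {set C}) :
    {set option T + (E + (C + C))} :=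
  set_sum I4 (set_sum I1 (set_sum I2 I3)).

Lemma constraint_grad_image z w I4 I1 I2 I3 :
  [seq constraint_grad z w k | k in multiplier_set I4 I1 I2 I3] =
  [seq constraint_grad z w (inl i) | i in I4] ++ grad_family e cG cH I1 I2 I3 z.
Proof. by rewrite /grad_family !image_sum. Qed.

Lemma constraint_grad_image0 z w I1 I2 I3 :
  [seq constraint_grad z w k | k in multiplier_set finset.set0 I1 I2 I3] =
  grad_family e cG cH I1 I2 I3 z.
Proof. by rewrite constraint_grad_image /image_mem enum_set0. Qed.

(** The function [c] stores the multipliers of [cG] and [cH] with opposite sign, making the equation
    one sum. [reduced_indep] concerns the basis together with the support of [c]. [reduced_w] serves
    to bound [w], and [reduced_trivial] later excludes [z = zs] when the multipliers blow up. *)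
Record reduced_stationary (I1 : {set E}) (I2 I3 : {set C}) (z1 z eta w : 'rV[R]_N)
    (c : option T + (E + (C + C)) -> R) : Prop := {
  reduced_objective : regular_subdiff F z1 eta;
  reduced_equation : 0 = eta + (z - zs) + \sum_k c k *: constraint_grad z w k;
  reduced_theta_ge0 : forall i, 0 <= c (inl i);
  reduced_theta_active : forall i, c (inl i) != 0 -> i \in Itheta;
  reduced_subdiff : c (inl None) != 0 -> regular_subdiff (theta None) z w;
  reduced_w : w = 0 \/ regular_subdiff (theta None) z w;
  reduced_e : forall j, c (inr (inl j)) != 0 -> j \in I1;
  reduced_G : forall i, c (inr (inr (inl i))) != 0 -> i \in I2 :|: J;
  reduced_H : forall i, c (inr (inr (inr i))) != 0 -> i \in I3 :|: J;
  reduced_sign : forall i, i \in J ->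
    (0 < - c (inr (inr (inl i))) /\ 0 < - c (inr (inr (inr i)))) \/
    c (inr (inr (inl i))) * c (inr (inr (inr i))) = 0;
  reduced_indep : forall d, (forall k, k \notin multiplier_set finset.set0 I1 I2 I3 ->
      c k = 0 -> d k = 0) ->
    \sum_k d k *: constraint_grad z w k = 0 -> forall k, d k = 0;
  reduced_trivial : z = zs -> forall k, c k = 0 }.

Lemma multiplier_sum (c : option T + (E + (C + C)) -> R) z w :
  \sum_k c k *: constraint_grad z w k =
  (c (inl None) *: w + \sum_i c (inl (Some i)) *: grad (theta (Some i)) z)
  + (\sum_j c (inr (inl j)) *: grad (e j) z
  + (\sum_i c (inr (inr (inl i))) *: grad (cG i) z
  + \sum_i c (inr (inr (inr i))) *: grad (cH i) z)).
Proof.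
rewrite big_sumType /= big_sumType /= big_sumType /=; congr (_ + _).
rewrite (bigD1 None)//=; congr (_ + _).
rewrite (reindex_omap Some id)/=; last by case.
by apply: eq_bigl => i; rewrite eqxx.
Qed.

Hypotheses (zs_feasible : feasible_system (theta None) (theta \o Some) e cG cH zs)
  (Itheta_active : forall i, i \notin Itheta -> theta i zs < 0)
  (I_active : forall i, i \in I -> cG i zs = 0 /\ 0 < cH i zs)
  (J_active : forall i, i \in J -> cG i zs = 0 /\ cH i zs = 0)
  (K_active : forall i, i \in K -> 0 < cG i zs /\ cH i zs = 0)
  (IJK : forall i, [|| i \in I, i \in J | i \in K]).

(** What persists near [zs]. The strict inequalities on [I] and [K] are those contradicting the
    alternatives in [approx_b] and [approx_a]. The placeholder 0 for the subgradient is invisible,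
    as the basis contains no [theta] index. *)
Definition good_point (I1 : {set E}) (I2 I3 : {set C}) (z : 'rV[R]_N) : Prop :=
  [/\ indep (multiplier_set finset.set0 I1 I2 I3) (constraint_grad z 0),
   (<<grad_family e cG cH [set: E]%SET I K z>> <= <<grad_family e cG cH I1 I2 I3 z>>)%VS,
   forall i, i \notin Itheta -> theta i z < 0,
   forall i, i \in I -> 0 < cH i z /\ cG i z < cH i z &
   forall i, i \in K -> 0 < cG i z /\ cH i z < cG i z].

Lemma reduce_approx_stationary (I1 : {set E}) (I2 I3 : {set C})
    z1 z eta w lam0 lam mu a b :
  I2 \subset I -> I3 \subset K -> good_point I1 I2 I3 z ->
  approx_stationary F (theta None) (theta \o Some) e cG cH zs z1 z eta w lam0 lam mu a b ->
  exists c, reduced_stationary I1 I2 I3 z1 z eta w c.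
Proof.
move=> I2I I3K [ind0 spanU Hth HI HK] A.
pose c : option T + (E + (C + C)) -> R :=
  fun_sum (fun i => if i is Some j then lam j else lam0)
    (fun_sum mu (fun_sum (fun i => - a i) (fun i => - b i))).
have eqc : 0 = eta + (z - zs) + \sum_k c k *: constraint_grad z w k.
  by rewrite multiplier_sum /= {1}(approx_equation A) !addrA.
have aK i : i \in K -> a i = 0.
  move=> iK; have [g0 hg] := HK i iK.
  by apply/eqP/negPn/negP => /(approx_a A)[_]; lra.
have bI i : i \in I -> b i = 0.
  move=> iI; have [g0 hg] := HI i iI.
  by apply/eqP/negPn/negP => /(approx_b A)[_]; lra.
have JI i : i \in J -> i \notin I.
  by move=> /J_active[_ h0]; apply/negP => /I_active[_]; rewrite h0 ltxx.
have JK i : i \in J -> i \notin K.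
  by move=> /J_active[g0 _]; apply/negP => /K_active[]; rewrite g0 ltxx.
have IK i : i \in I -> i \notin K.
  by move=> /I_active[g0 _]; apply/negP => /K_active[]; rewrite g0 ltxx.
have wP : w = 0 \/ regular_subdiff (theta None) z w.
  have [/(approx_lam0_eq0 A)|/(approx_lam0_subdiff A)[_]] := eqVneq lam0 0; by [left|right].
have indw (S : {set E + (C + C)}) w' : indep (set_sum finset.set0 S) (constraint_grad z 0) ->
    indep (set_sum finset.set0 S) (constraint_grad z w').
  move=> H d d0; apply: H; rewrite -[RHS]d0 !big_set_sum /= !big_set0; congr (_ + _).
(* At [zs] all multipliers vanish by feasibility and no reduction is made, so that [reduced_trivial]
   holds; there [reduced_indep] is just independence of the basis. *)
have [zzs|zzs] := eqVneq z zs.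
  have c0 k : c k = 0.
    have [z0 zT zE zC] := zs_feasible.
    case: k => [[j|]|[j|[i|i]]] /=.
    - by apply/eqP/negPn/negP => /(approx_lam_active A); rewrite zzs ltNge zT.
    - by apply/eqP/negPn/negP => /(approx_lam0_subdiff A)[]; rewrite zzs ltNge z0.
    - by apply/eqP/negPn/negP => /(approx_mu A); rewrite zzs zE eqxx.
    - apply/eqP; rewrite oppr_eq0; apply/negPn/negP => ai.
      have [g0 _] := approx_a A ai; rewrite zzs in g0.
      have /or3P[/I_active[/eqP]|/J_active[/eqP]|/aK/eqP] := IJK i.
      + by rewrite (negbTE g0).
      + by rewrite (negbTE g0).
      + by rewrite (negbTE ai).
    - apply/eqP; rewrite oppr_eq0; apply/negPn/negP => bi.
      have [h0 _] := approx_b A bi; rewrite zzs in h0.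
      have /or3P[/bI/eqP|/J_active[_ /eqP]|/K_active[_ /eqP]] := IJK i.
      + by rewrite (negbTE bi).
      + by rewrite (negbTE h0).
      + by rewrite (negbTE h0).
  exists c; constructor.
  - exact: approx_objective A.
  - exact: eqc.
  - by move=> i; rewrite c0.
  - by move=> i; rewrite c0 eqxx.
  - by rewrite c0 eqxx.
  - exact: wP.
  - by move=> j; rewrite c0 eqxx.
  - by move=> i; rewrite c0 eqxx.
  - by move=> i; rewrite c0 eqxx.
  - by move=> i _; right; rewrite !c0 mulr0.
  - move=> d d0 dsum k.
    have dS0 l : l \notin multiplier_set finset.set0 I1 I2 I3 -> d l = 0.
      by move=> lS; exact: d0.
    have [kS|/dS0//] := boolP (k \in multiplier_set finset.set0 I1 I2 I3).
    apply: (indw _ w ind0) kS; apply: (etrans _ dsum).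
    rewrite big_mkcond /=; apply: eq_bigr => l _.
    by case: ifPn => // /dS0 ->; rewrite scale0r.
  - by move=> _; exact: c0.
have [||||c' [c'eq c'0 c'pos c'ind]] := @reduce_multipliers R _ _
  (multiplier_set finset.set0 I1 I2 I3)
  (multiplier_set finset.set0 [set: E]%SET I K) (constraint_grad z w) c (eta + (z - zs)).
- apply/fintype.subsetP => -[i|[j|[i|i]]]; rewrite !inE//=; exact: fintype.subsetP.
- exact: indw.
- by rewrite !constraint_grad_image0.
- exact: eqc.
have c'S k : k \notin multiplier_set finset.set0 [set: E]%SET I K -> c' k != 0 ->
    c k != 0.
  move=> kS /(c'pos _ kS) ck; by apply: contraTN ck => /eqP ->; rewrite mulr0 ltxx.
exists c'; constructor.
- exact: approx_objective A.
- exact: c'eq.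
- move=> i; have [->//|ci] := eqVneq (c' (inl i)) 0.
  have := c'pos (inl i); rewrite !inE => /(_ isT ci).
  have ci0 : 0 <= c (inl i).
    by case: i ci => [i|] _ /=; [exact: approx_lam_ge0 A i|exact: approx_lam0_ge0 A].
  move=> H; rewrite leNgt; apply/negP => /ltW ci'.
  by have := mulr_le0_ge0 ci' ci0; rewrite leNgt H.
- move=> i ci; have : c (inl i) != 0 by apply: c'S => //; rewrite !inE.
  apply: contraNT => /Hth thi.
  case: i ci thi => [i|] _ thi /=.
    by apply/negPn/negP => /(approx_lam_active A); rewrite ltNge ltW.
  by apply/negPn/negP => /(approx_lam0_subdiff A)[]; rewrite ltNge ltW.
- move=> ci; have : c (inl None) != 0 by apply: c'S => //; rewrite !inE.
  by move=> /(approx_lam0_subdiff A)[].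
- exact: wP.
- by move=> j; apply: contraNT => jI; rewrite c'0 ?inE.
- move=> i ci; rewrite inE; have /or3P[iI|->|iK] := IJK i; rewrite ?orbT//.
    apply/orP; left; apply: contraNT ci => iI2.
    by rewrite c'0 ?inE.
  have /c'S/(_ ci) : inr (inr (inl i)) \notin multiplier_set finset.set0 [set: E]%SET I K.
    by rewrite !inE /=; apply/negP => /IK; rewrite iK.
  by rewrite /= aK// oppr0 eqxx.
- move=> i ci; rewrite inE; have /or3P[iI|->|iK] := IJK i; rewrite ?orbT//.
    have /c'S/(_ ci) : inr (inr (inr i)) \notin multiplier_set finset.set0 [set: E]%SET I K.
      by rewrite !inE /=; exact: IK.
    by rewrite /= bI// oppr0 eqxx.
  apply/orP; left; apply: contraNT ci => iI3.
  by rewrite c'0 ?inE.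
(* Indices of [J] lie outside the reduced set, so nonzero new multipliers have the signs of the old
   ones and the alternative is inherited. *)
- move=> i iJ.
  have [ci|ci] := eqVneq (c' (inr (inr (inl i)))) 0; first by right; rewrite ci mul0r.
  have [di|di] := eqVneq (c' (inr (inr (inr i)))) 0; first by right; rewrite di mulr0.
  have nI := JI i iJ; have nK := JK i iJ.
  have := c'pos (inr (inr (inl i))); rewrite !inE /= nI => /(_ isT ci) c1.
  have := c'pos (inr (inr (inr i))); rewrite !inE /= nK => /(_ isT di) c2.
  have [[a0 b0]|ab0] := approx_compl A i.
    by left; split; nra.
  by move/eqP: ab0; rewrite mulf_eq0 => /orP[]/eqP H;
    [move: c1|move: c2]; rewrite H oppr0 mulr0 ltxx.
- exact: c'ind.
- by move=> zzs'; rewrite zzs' eqxx in zzs.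
Qed.

Hypotheses (theta_smooth : forall i, smooth (theta (Some i)))
  (e_smooth : forall j, smooth (e j))
  (cG_smooth : forall i, smooth (cG i)) (cH_smooth : forall i, smooth (cH i)).
Hypotheses
  (theta_C1 : forall i, {for zs, continuous (grad (theta (Some i)))})
  (e_C1 : forall j, {for zs, continuous (grad (e j))})
  (cG_C1 : forall i, {for zs, continuous (grad (cG i))})
  (cH_C1 : forall i, {for zs, continuous (grad (cH i))}).
Variables (LF L0 : R).
Hypotheses (LF_ge0 : 0 <= LF) (L0_ge0 : 0 <= L0).
Hypotheses (F_calm : \forall z \near zs, calm F LF z)
  (theta0_calm : \forall z \near zs, calm (theta None) L0 z).
Hypothesis zs_min : \forall z \near zs,
  feasible_system (theta None) (theta \o Some) e cG cH z -> F zs <= F z.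
Hypothesis zs_RCPLD : RCPLD theta e cG cH Itheta I J K zs.

Lemma smooth_near_lt (phi psi : 'rV[R]_N -> R) :
  {for zs, continuous phi} -> {for zs, continuous psi} -> phi zs < psi zs ->
  \forall z \near zs, phi z < psi z.
Proof.
move=> phic psic lt.
have dc : psi z - phi z @[z --> zs] --> psi zs - phi zs by apply: (cvgB psic phic).
have := cvgr_gt _ dc 0; rewrite subr_gt0 => /(_ _ lt).
by apply: filterS => z; rewrite subr_gt0.
Qed.

Lemma theta_continuous i : {for zs, continuous (theta i)}.
Proof.
case: i => [i|]; first exact: frechet_continuous (theta_smooth i zs).
exact: calm_continuous L0_ge0 (nbhs_singleton theta0_calm).
Qed.

(** Independence of the basis is an open condition. By constant rank the ambient span keeps the
    dimension given by the number of basis vectors, so they continue to span it. *)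
Lemma near_good_point (I1 : {set E}) (I2 I3 : {set C}) : I2 \subset I -> I3 \subset K ->
  basis_of <<grad_family e cG cH [set: E]%SET I K zs>>%VS
              (grad_family e cG cH I1 I2 I3 zs) ->
  \forall z \near zs, good_point I1 I2 I3 z.
Proof.
move=> I2I I3K /andP[/eqP span_zs free_zs].
have [rank_cst _] := zs_RCPLD.
have ind_near : \forall z \near zs,
    indep (multiplier_set finset.set0 I1 I2 I3) (constraint_grad z 0).
  apply: (@indep_near R _ (nbhs zs) _ N _ _ (fun z => constraint_grad z 0) (constraint_grad zs 0)).
    case=> [i|[j|[i|i]]]; rewrite !inE // => _.
    - exact: e_C1. - exact: cG_C1. - exact: cH_C1.
  by apply/free_image; rewrite constraint_grad_image0.
have c0 (x : R) : {for zs, continuous (fun=> x)} by exact: (@cst_continuous _ _ x zs).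
have th_near : \forall z \near zs, forall i, i \notin Itheta -> theta i z < 0.
  apply: (@filter_forall _ _ (fun i z => _) (nbhs zs)) => i; have [iI|iI] := boolP (i \in Itheta); first exact: nearW.
  have := smooth_near_lt (@theta_continuous i) (c0 0).
  by move=> /(_ (Itheta_active iI)); apply: filterS.
have Gc i : {for zs, continuous (cG i)} by exact: frechet_continuous (cG_smooth i zs).
have Hc i : {for zs, continuous (cH i)} by exact: frechet_continuous (cH_smooth i zs).
have pos_near (phi : 'rV[R]_N -> R) : {for zs, continuous phi} -> 0 < phi zs -> \forall z \near zs, 0 < phi z.
  exact: smooth_near_lt (c0 0).
have I_near : \forall z \near zs, forall i, i \in I -> 0 < cH i z /\ cG i z < cH i z.
  apply: (@filter_forall _ _ (fun i z => _) (nbhs zs)) => i; have [iI|iI] := boolP (i \in I); last exact: nearW.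
  have [g0 h0] := I_active iI.
  have := smooth_near_lt (Gc i) (Hc i); rewrite g0 => /(_ h0).
  by apply: filterS2 (pos_near _ (Hc i) h0).
have K_near : \forall z \near zs, forall i, i \in K -> 0 < cG i z /\ cH i z < cG i z.
  apply: (@filter_forall _ _ (fun i z => _) (nbhs zs)) => i; have [iK|iK] := boolP (i \in K); last exact: nearW.
  have [g0 h0] := K_active iK.
  have := smooth_near_lt (Hc i) (Gc i); rewrite h0 => /(_ g0).
  by apply: filterS2 (pos_near _ (Gc i) g0).
near=> z.
have indz : indep (multiplier_set finset.set0 I1 I2 I3) (constraint_grad z 0) by near: z.
split => //.
- have dimz : \dim <<grad_family e cG cH [set: E]%SET I K z>>%VS =
      \dim <<grad_family e cG cH [set: E]%SET I K zs>>%VS by near: z.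
  have free_z : free (grad_family e cG cH I1 I2 I3 z).
    by rewrite -(constraint_grad_image0 z 0); apply/free_image.
  have sub : (<<grad_family e cG cH I1 I2 I3 z>> <=
      <<grad_family e cG cH [set: E]%SET I K z>>)%VS.
    apply: sub_span => x; rewrite !mem_cat => /or3P[] /mapP[j];
      rewrite mem_enum => jI ->; apply/or3P.
    + by apply: Or31; apply: map_f; rewrite mem_enum inE.
    + by apply: Or32; apply: map_f; rewrite mem_enum; exact: (fintype.subsetP I2I).
    + by apply: Or33; apply: map_f; rewrite mem_enum; exact: (fintype.subsetP I3K).
  have /eqP <- // : <<grad_family e cG cH I1 I2 I3 z>>%VS ==
      <<grad_family e cG cH [set: E]%SET I K z>>%VS.
  rewrite -(dimv_leqif_eq sub) dimz -span_zs.
  rewrite (eqP free_z) (eqP free_zs) !size_cat !size_map.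
  by rewrite eqxx.
- by near: z.
- by near: z.
- by near: z.
Unshelve. all: by end_near.
Qed.

Lemma exists_reduced_stationary (I1 : {set E}) (I2 I3 : {set C}) : I2 \subset I -> I3 \subset K ->
  basis_of <<grad_family e cG cH [set: E]%SET I K zs>>%VS
              (grad_family e cG cH I1 I2 I3 zs) ->
  forall eps, 0 < eps -> exists z1 z eta w c,
    [/\ `|z1 - zs| < eps, `|z - zs| < eps, `|eta| <= LF + 1, `|w| <= L0 + 1 &
      reduced_stationary I1 I2 I3 z1 z eta w c].
Proof.
move=> I2I I3K basis eps eps0.
have good_near := near_good_point I2I I3K basis.
pose near_props z := [/\ calm F LF z, calm (theta None) L0 z,
    feasible_system (theta None) (theta \o Some) e cG cH z -> F zs <= F z &
    good_point I1 I2 I3 z].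
have /nbhs_ballP[d /= d0 Hd] : nbhs zs near_props.
  near=> z; split; by near: z.
have dB z : `|z - zs| < d -> near_props z.
  by move=> zd; apply: Hd; rewrite -ball_normE /= distrC.
(* The penalization uses a closed ball; half the radius places it inside the open ball where the
   local properties hold. *)
have d20 : 0 < d / 2 by rewrite divr_gt0.
have d2B z : rball zs (d / 2) z -> `|z - zs| < d.
  by move=> zr; apply: le_lt_trans zr _; rewrite ltr_pdivrMr// ltr_pMr// ltr1n.
have mp : 0 < Num.min eps d by rewrite lt_min eps0.
have calmF z : rball zs (d / 2) z -> calm F LF z by move=> /d2B /dB[].
have calm0 z : rball zs (d / 2) z -> calm (theta None) L0 z by move=> /d2B /dB[].
have minz z : rball zs (d / 2) z ->
    feasible_system (theta None) (theta \o Some) e cG cH z -> F zs <= F z.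
  by move=> /d2B /dB[].
have [z1 [z [eta [w [lam0 [lam [mu [a [b [z1e ze A]]]]]]]]]] :=
  exists_approx_stationary theta_smooth e_smooth cG_smooth cH_smooth LF_ge0 L0_ge0 d20
  calmF calm0 zs_feasible minz mp.
move: z1e ze; rewrite !lt_min => /andP[z1e z1d] /andP[ze zd].
have [F1 _ _ _] := dB _ z1d; have [_ th1 _ good] := dB _ zd.
have [c Hc] := reduce_approx_stationary I2I I3K good A.
exists z1, z, eta, w, c; split => //.
  exact: regular_subdiff_bounded LF_ge0 F1 (reduced_objective Hc).
have [->|] := reduced_w Hc; first by rewrite normr0 addr_ge0.
exact: regular_subdiff_bounded.
Unshelve. all: by end_near.
Qed.

Lemma exists_multiplier_basis : exists (I1 : {set E}) (I2 I3 : {set C}),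
  [/\ I2 \subset I, I3 \subset K &
    basis_of <<grad_family e cG cH [set: E]%SET I K zs>>%VS
             (grad_family e cG cH I1 I2 I3 zs)].
Proof.
have [S [SA Sfree Sspan]] := exists_basis
  (multiplier_set finset.set0 [set: E]%SET I K) (constraint_grad zs 0).
exists [set j | inr (inl j) \in S]%SET, [set i | inr (inr (inl i)) \in S]%SET,
  [set i | inr (inr (inr i)) \in S]%SET.
have SE : multiplier_set finset.set0 [set j | inr (inl j) \in S]%SET
    [set i | inr (inr (inl i)) \in S]%SET [set i | inr (inr (inr i)) \in S]%SET = S.
  apply/setP => -[i|[j|[i|i]]]; rewrite !inE//=.
  by apply/esym/negP => /(fintype.subsetP SA); rewrite !inE.
split.
- by apply/fintype.subsetP => i; rewrite inE => /(fintype.subsetP SA); rewrite !inE.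
- by apply/fintype.subsetP => i; rewrite inE => /(fintype.subsetP SA); rewrite !inE.
- by rewrite /basis_of -!(constraint_grad_image0 zs 0) SE Sspan eqxx.
Qed.

(** M-type multiplier rule for an abstract system with one nonsmooth inequality. Nothing is claimed
    about [w] when [lam None] vanishes, because its subgradient property is only known where the
    multiplier is nonzero. *)
Lemma multiplier_limit : exists (xi w : 'rV[R]_N) (lam : option T -> R) (mu : E -> R)
    (a b : C -> R),
  [/\ limiting_subdiff F zs xi,
      lam None != 0 -> limiting_subdiff (theta None) zs w,
      forall i, 0 <= lam i &
      forall i, i \notin Itheta -> lam i = 0] /\
  0 = xi + lam None *: w + \sum_i lam (Some i) *: grad (theta (Some i)) zs
      + \sum_j mu j *: grad (e j) zs
      - \sum_i a i *: grad (cG i) zs - \sum_i b i *: grad (cH i) zs /\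
  [/\ forall i, i \in I -> b i = 0, forall i, i \in K -> a i = 0 &
      forall i, i \in J -> (0 < a i /\ 0 < b i) \/ a i * b i = 0].
Proof.
have [I1 [I2 [I3 [I2I I3K basis]]]] := exists_multiplier_basis.
pose Ix : finType := (option T + (E + (C + C)))%type.
pose D : Type := ('rV[R]_N * 'rV[R]_N * 'rV[R]_N * 'rV[R]_N * (Ix -> R))%type.
pose P (n : nat) (x : D) :=
  [/\ `|x.1.1.1.1 - zs| < n.+1%:R^-1, `|x.1.1.1.2 - zs| < n.+1%:R^-1,
      `|x.1.1.2| <= LF + 1, `|x.1.2| <= L0 + 1 &
      reduced_stationary I1 I2 I3 x.1.1.1.1 x.1.1.1.2 x.1.1.2 x.1.2 x.2].
have exP n : exists x, P n x.
  have n0 : 0 < n.+1%:R^-1 :> R by rewrite invr_gt0 ltr0n.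
  have [z1 [z [eta [w [c H]]]]] := exists_reduced_stationary I2I I3K basis n0.
  by exists (z1, z, eta, w, c).
have [x xP] := choice exP.
pose z1 n := (x n).1.1.1.1; pose z n := (x n).1.1.1.2; pose eta n := (x n).1.1.2.
pose w n := (x n).1.2; pose c n := (x n).2.
have z1z n : `|z1 n - zs| < n.+1%:R^-1 by have [] := xP n.
have zz n : `|z n - zs| < n.+1%:R^-1 by have [] := xP n.
have etaB n : `|eta n| <= LF + 1 by have [] := xP n.
have wB n : `|w n| <= L0 + 1 by have [] := xP n.
have red n : reduced_stationary I1 I2 I3 (z1 n) (z n) (eta n) (w n) (c n) by have [] := xP n.
have {xP exP} cz : z n @[n --> \oo] --> zs by exact: cvg_invn.
(* The summand 1 is the coefficient of the objective, so [tau] and the scaled multipliers have total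
   l1-norm one. *)
pose M n := 1 + \sum_k `|c n k|; pose tau n := (M n)^-1.
have M1 n : 1 <= M n by rewrite lerDl sumr_ge0.
have M0 n : 0 < M n by exact: lt_le_trans ltr01 (M1 n).
have tau0 n : 0 < tau n by rewrite invr_gt0.
have tau1 n : tau n <= 1 by rewrite invf_le1.
have norm1 n : tau n + \sum_k `|tau n * c n k| = 1.
  rewrite (eq_bigr (fun k => tau n * `|c n k|)) => [|k _].
    by rewrite -mulr_sumr -[X in X + _]mulr1 -mulrDr mulVf// gt_eqF.
  by rewrite normrM gtr0_norm.
have tcB n k : `|tau n * c n k| <= 1.
  rewrite -(norm1 n) (bigD1 k)//= addrCA lerDl; apply: addr_ge0; [exact: ltW|exact: sumr_ge0].
have [U [UU Usub]] := ultraFilterLemma (F := \oo) _.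
have czU : z n @[n --> U] --> zs by apply: cvg_trans cz => A /= HA; exact: Usub.
have [xi xiE] : exists xi : 'rV[R]_N, eta n @[n --> U] --> xi.
  by apply: (ultra_cvg UU); apply: nearW.
have [ws wsE] : exists ws : 'rV[R]_N, w n @[n --> U] --> ws.
  by apply: (ultra_cvg UU); apply: nearW.
have [t tE] : exists t : R, tau n @[n --> U] --> t.
  by apply: (ultra_cvg_real (C := 1) UU); apply: nearW => m; rewrite gtr0_norm.
have /choice[cs csE] : forall k, exists l : R, tau n * c n k @[n --> U] --> l.
  by move=> k; apply: (ultra_cvg_real (C := 1) UU); apply: nearW => n.
have cV k : constraint_grad (z n) (w n) k @[n --> U] --> constraint_grad zs ws k.
  case: k => [[i|]|[j|[i|i]]] /=; last 4 first.
  - exact: wsE.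
  - exact: cvg_comp czU (@e_C1 j).
  - exact: cvg_comp czU (@cG_C1 i).
  - exact: cvg_comp czU (@cH_C1 i).
  - exact: cvg_comp czU (@theta_C1 i).
have lim_eq : 0 = t *: xi + \sum_k cs k *: constraint_grad zs ws k.
  pose f n := tau n *: (eta n + (z n - zs)) +
    \sum_k (tau n * c n k) *: constraint_grad (z n) (w n) k.
  have f0 n : f n = 0.
    rewrite /f (eq_bigr (fun k => tau n *: (c n k *: constraint_grad (z n) (w n) k))).
      by rewrite -scaler_sumr -scalerDr -(reduced_equation (red n)) scaler0.
    by move=> k _; rewrite scalerA.
  have fl : f n @[n --> U] --> t *: (xi + (zs - zs)) + \sum_k cs k *: constraint_grad zs ws k.
    apply: cvgD.
      by apply: cvgZ => //; apply: cvgD => //; apply: cvgB => //; exact: cvg_cst.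
    by apply: cvg_sum => k _; apply: cvgZ; [exact: csE|exact: cV].
  rewrite subrr addr0 in fl; apply: (cvg_unique _ _ fl); first exact: norm_hausdorff.
  by rewrite (_ : f = fun=> 0); [exact: cvg_cst|apply/funext].
have lim_norm : t + \sum_k `|cs k| = 1.
  have fl : tau n + \sum_k `|tau n * c n k| @[n --> U] --> t + \sum_k `|cs k|.
    by apply: cvgD => //; apply: cvg_sum => k _; apply: cvg_norm; exact: csE.
  apply/esym; apply: (cvg_unique _ _ fl); first exact: norm_hausdorff.
  rewrite (_ : (fun n => tau n + _) = fun=> 1); first exact: cvg_cst.
  by apply/funext.
have t0 : 0 <= t.
  apply: (ler_cvg_to (cvg_cst 0) tE); apply: nearW => n; exact: ltW.
(* Along an ultrafilter each multiplier is eventually nonzero or eventually zero; with finitely many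
   indices the support is eventually the fixed set [S]. *)
pose S := [set k : Ix | `[< \forall n \near U, c n k != 0 >]]%SET.
have S_near : \forall n \near U, forall k, (c n k != 0) = (k \in S).
  apply: (@filter_forall _ Ix (fun k n => _) U) => k.
  have [kS|kS] := boolP (k \in S).
    by move: kS; rewrite inE => /asboolP; apply: filterS => n ->.
  have [H|] := in_ultra_setVsetC [set n | c n k != 0] UU.
    by move: kS; rewrite inE => /asboolPn.
  by apply: filterS => n /= /negP/negbTE.
have csS k : k \notin S -> cs k = 0.
  move=> kS; apply: (cvg_unique _ (csE k)); first exact: norm_hausdorff.
  apply: cvg_near_cst; apply: filterS S_near => n /(_ k).
  by rewrite (negbTE kS) => /negbFE/eqP ->; rewrite mulr0.
clearbody S.
have cs_theta_ge0 i : 0 <= cs (inl i).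
  apply: (ler_cvg_to (cvg_cst 0) (csE (inl i))); apply: nearW => n.
  by rewrite mulr_ge0 ?(ltW (tau0 n)) ?(reduced_theta_ge0 (red n)).
have [n0 Sn0] := filter_ex S_near.
have S_theta i : inl i \in S -> i \in Itheta.
  by rewrite -Sn0; exact: reduced_theta_active (red n0) i.
have S_e j : inr (inl j) \in S -> j \in I1.
  by rewrite -Sn0; exact: reduced_e (red n0) j.
have S_G i : inr (inr (inl i)) \in S -> i \in I2 :|: J.
  by rewrite -Sn0; exact: reduced_G (red n0) i.
have S_H i : inr (inr (inr i)) \in S -> i \in I3 :|: J.
  by rewrite -Sn0; exact: reduced_H (red n0) i.
pose a i := - cs (inr (inr (inl i))); pose b i := - cs (inr (inr (inr i))).
have cs_sign i : i \in J -> (0 < a i /\ 0 < b i) \/ a i * b i = 0.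
  move=> iJ; pose cg n := c n (inr (inr (inl i))); pose ch n := c n (inr (inr (inr i))).
  have [SG|SG] := boolP (inr (inr (inl i)) \in S); last first.
    by right; rewrite /a csS// oppr0 mul0r.
  have [SH|SH] := boolP (inr (inr (inr i)) \in S); last first.
    by right; rewrite /b csS// oppr0 mulr0.
  (* With both indices in the support the product is nonzero, leaving only the strict alternative.
     In the limit the strict signs weaken, but then one factor is zero. *)
  have neg : \forall n \near U, cg n < 0 /\ ch n < 0.
    apply: filterS S_near => n Sn; have := reduced_sign (red n) iJ.
    rewrite !oppr_gt0 => -[//|/eqP].
    by rewrite mulf_eq0 -[_ == 0]negbK -[X in _ || X]negbK !Sn SG SH.
  have a0 : 0 <= a i.
    rewrite oppr_ge0; apply: (ler_cvg_to (csE _) (cvg_cst 0)).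
    by apply: filterS neg => n [g0 _]; rewrite ltW// pmulr_rlt0.
  have b0 : 0 <= b i.
    rewrite oppr_ge0; apply: (ler_cvg_to (csE _) (cvg_cst 0)).
    by apply: filterS neg => n [_ h0]; rewrite ltW// pmulr_rlt0.
  have [->|ai] := eqVneq (a i) 0; first by right; rewrite mul0r.
  have [->|bi] := eqVneq (b i) 0; first by right; rewrite mulr0.
  by left; rewrite !lt_neqAle a0 b0 eq_sym ai eq_sym bi.
have diag (G : nat -> Prop) : (\forall n \near U, G n) -> exists phi : nat -> nat,
    [/\ forall k, G (phi k), z1 (phi k) @[k --> \oo] --> zs, z (phi k) @[k --> \oo] --> zs,
        eta (phi k) @[k --> \oo] --> xi & w (phi k) @[k --> \oo] --> ws].
  move=> GU.
  pose Q k n := [/\ G n, `|z1 n - zs| < k.+1%:R^-1, `|z n - zs| < k.+1%:R^-1,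
    `|eta n - xi| < k.+1%:R^-1 & `|w n - ws| < k.+1%:R^-1].
  have z1U : z1 n @[n --> U] --> zs.
    by apply: cvg_trans (cvg_invn z1z) => A /= HA; exact: Usub.
  have /(ultra_diagonal UU)[phi Hphi] : forall k, \forall n \near U, Q k n.
    move=> k; have k0 : 0 < k.+1%:R^-1 :> R by rewrite invr_gt0 ltr0n.
    have near_lim (u : nat -> 'rV[R]_N) (l : 'rV[R]_N) : u n @[n --> U] --> l ->
        \forall n \near U, `|u n - l| < k.+1%:R^-1.
      by move=> /cvgrPdistC_lt; apply.
    have h1 := near_lim _ _ z1U; have h2 := near_lim _ _ czU.
    have h3 := near_lim _ _ xiE; have h4 := near_lim _ _ wsE.
    by near=> n; split; near: n.
  exists phi; split=> [k||||]; first by have [] := Hphi k.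
  - by apply: cvg_invn => k; have [] := Hphi k.
  - by apply: cvg_invn => k; have [] := Hphi k.
  - by apply: cvg_invn => k; have [] := Hphi k.
  - by apply: cvg_invn => k; have [] := Hphi k.

have IJ i : i \in I -> i \notin J.
  by move=> /I_active[_ h0]; apply/negP => /J_active[_ h1]; rewrite h1 ltxx in h0.
have KJ i : i \in K -> i \notin J.
  by move=> /K_active[g0 _]; apply/negP => /J_active[g1 _]; rewrite g1 ltxx in g0.
have IK i : i \in I -> i \notin K.
  by move=> /I_active[g0 _]; apply/negP => /K_active[]; rewrite g0 ltxx.
have a_supp i : a i != 0 -> i \in I2 :|: J.
  rewrite oppr_eq0 => ai; apply: S_G; apply: contraNT ai => /csS ->; exact: eqxx.
have b_supp i : b i != 0 -> i \in I3 :|: J.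
  rewrite oppr_eq0 => bi; apply: S_H; apply: contraNT bi => /csS ->; exact: eqxx.
have w_sub : inl None \in S -> \forall n \near U, regular_subdiff (theta None) (z n) (w n).
  move=> SN; apply: filterS S_near => n Sn; apply: (reduced_subdiff (red n)).
  by rewrite Sn.
(* Either the objective survives and one divides by [t], or the limit equation involves constraints
   alone and RCPLD applies. *)
have {t0} [t0|t0] : 0 < t \/ t = 0 by move: t0; rewrite le_eqVlt => /orP[/eqP|]; [right|left].
  exists xi, ws, (fun i => cs (inl i) / t), (fun j => cs (inr (inl j)) / t),
    (fun i => a i / t), (fun i => b i / t).
  have tN0 : t != 0 by rewrite gt_eqF.
  split; last split.
  - split.
    + have [phi [_ z1phi _ etaphi _]] := diag (fun=> True) (nearW _ (fun=> Logic.I)).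
      exists (z1 \o phi), (eta \o phi); split => // k.
      exact: reduced_objective (red (phi k)).
    + rewrite mulf_eq0 negb_or => /andP[cN _].
      have NS : inl None \in S by apply: contraNT cN => /csS ->.
      have [phi [wphi _ zphi _ wsphi]] := diag _ (w_sub NS).
      by exists (z \o phi), (w \o phi).
    + by move=> i; rewrite divr_ge0// ltW.
    + move=> i iI; rewrite csS ?mul0r//; apply: contra iI; exact: S_theta.
  - have := congr1 (fun v => t^-1 *: v) lim_eq.
    rewrite scaler0 scalerDr scalerA mulVf// scale1r multiplier_sum => eq_t; rewrite [LHS]eq_t.
    have sumD (Q : finType) (g : Q -> R) (v : Q -> 'rV[R]_N) :
        \sum_i (g i / t) *: v i = t^-1 *: \sum_i g i *: v i.
      by rewrite scaler_sumr; apply: eq_bigr => i _; rewrite scalerA mulrC.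
    rewrite /a /b; under [X in _ = _ - X - _]eq_bigr do rewrite mulNr scaleNr.
    under [X in _ = _ - X]eq_bigr do rewrite mulNr scaleNr.
    rewrite !sumrN !opprK !sumD [cs (inl None) / t]mulrC -scalerA.
    by rewrite !scalerDr !addrA.
  - split=> [i iI|i iK|i /cs_sign[[a0 b0]|ab0]].
    + apply/eqP; rewrite mulf_eq0; apply/orP; left; apply: contraTT iI => /b_supp.
      rewrite inE => /orP[/(fintype.subsetP I3K)|]; first by apply: contraL; exact: IK.
      by apply: contraL; exact: IJ.
    + apply/eqP; rewrite mulf_eq0; apply/orP; left; apply: contraTT iK => /a_supp.
      rewrite inE => /orP[/(fintype.subsetP I2I)|]; first exact: IK.
      by apply: contraL; exact: KJ.
    + by left; rewrite !divr_gt0.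
    + by right; rewrite mulrACA ab0 mul0r.
exfalso.
pose I4 := [set i | inl i \in S]%SET.
pose I5 := [set i in J | inr (inr (inl i)) \in S]%SET.
pose I6 := [set i in J | inr (inr (inr i)) \in S]%SET.
have I4I : I4 \subset Itheta by apply/fintype.subsetP => i; rewrite inE; exact: S_theta.
have I5J : I5 \subset J by apply/fintype.subsetP => i; rewrite inE => /andP[].
have I6J : I6 \subset J by apply/fintype.subsetP => i; rewrite inE => /andP[].
(* At [z n = zs] all multipliers vanish and [tau n = 1], impossible once [tau] is close to 0. *)
have z_neq : \forall n \near U, z n != zs.
  have : \forall n \near U, tau n < 1.
    by move: tE; rewrite t0 => /cvgr_lt; apply.
  apply: filterS => n; apply: contraTN => /eqP zzs.
  rewrite /tau /M big1 ?addr0 ?invr1 ?ltxx// => k _.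
  by rewrite (reduced_trivial (red n) zzs) normr0.
have GU : \forall n \near U, [/\ forall k, (c n k != 0) = (k \in S), z n != zs &
    inl None \in S -> regular_subdiff (theta None) (z n) (w n)].
  have [NS|NS] := boolP (inl None \in S).
    have h3 := w_sub NS.
    by near=> n; split; [near: n|near: n|move=> _; near: n].
  by near=> n; split; [near: n|near: n|move=> NS1; case/negP: NS].
have [phi [Gphi _ zphi _ wphi]] := diag _ GU.
have regS (i : T) y : regular_subdiff (theta (Some i)) y (grad (theta (Some i)) y).
  exact: frechet_regular (theta_smooth i y).
have [_ /(_ I1 I2 I3 I2I I3K basis I4 I5 I6 I4I I5J I6J)] := zs_RCPLD.
move=> /(_ (fun i => constraint_grad zs ws (inl i)) (fun i => cs (inl i))
  (fun j => cs (inr (inl j))) a b).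
have p1 i : i \in I4 -> limiting_subdiff (theta i) zs (constraint_grad zs ws (inl i)).
  rewrite inE; case: i => [i|] iS /=.
    exists (fun=> zs), (fun=> grad (theta (Some i)) zs); split; [exact: cvg_cst..|].
    by move=> _; exact: regS.
  exists (z \o phi), (w \o phi); split => // k.
  by have [_ _] := Gphi k; exact.
(* Since [t = 0], the normalization leaves total weight one for the constraint multipliers, so one
   of them is nonzero. *)
have p3 : [|| [exists i in I4, cs (inl i) != 0], [exists j in I1, cs (inr (inl j)) != 0],
         [exists i in I2 :|: I5, a i != 0] | [exists i in I3 :|: I6, b i != 0]].
  have [k ck] : exists k, cs k != 0.
    apply: contrapT => H; have := lim_norm; rewrite t0 add0r big1.
      by move=> /esym/eqP; rewrite oner_eq0.
    move=> k _; apply/eqP; rewrite normr_eq0; apply/negPn/negP => ck.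
    by apply: H; exists k.
  have kS : k \in S by apply: contraNT ck => /csS ->.
  apply/or4P; case: k ck kS => [i|[j|[i|i]]] ck kS.
  - by apply: Or41; apply/existsP; exists i; rewrite inE kS.
  - by apply: Or42; apply/existsP; exists j; rewrite S_e.
  - apply: Or43; apply/existsP; exists i; rewrite /a oppr_eq0 ck andbT.
    by have := S_G i kS; rewrite !inE kS andbT.
  - apply: Or44; apply/existsP; exists i; rewrite /b oppr_eq0 ck andbT.
    by have := S_H i kS; rewrite !inE kS andbT.
have p4 i : i \notin I2 :|: I5 -> a i = 0.
  move=> iI; apply/eqP; apply: contraNT iI => ai.
  have kS : inr (inr (inl i)) \in S.
    by apply: contraNT ai => /csS; rewrite /a => ->; rewrite oppr0.
  by have := S_G i kS; rewrite !inE kS andbT.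
have p5 i : i \notin I3 :|: I6 -> b i = 0.
  move=> iI; apply/eqP; apply: contraNT iI => bi.
  have kS : inr (inr (inr i)) \in S.
    by apply: contraNT bi => /csS; rewrite /b => ->; rewrite oppr0.
  by have := S_H i kS; rewrite !inE kS andbT.
have p7 : 0 = \sum_(i in I4) cs (inl i) *: constraint_grad zs ws (inl i)
     + \sum_(j in I1) cs (inr (inl j)) *: grad (e j) zs
     - \sum_(i in I2 :|: I5) a i *: grad (cG i) zs
     - \sum_(i in I3 :|: I6) b i *: grad (cH i) zs.
  rewrite {1}lim_eq t0 scale0r add0r big_sumType /= big_sumType /= big_sumType /=.
  have sumI (Q : finType) (A : {set Q}) (g : Q -> R) (v : Q -> 'rV[R]_N) :
      (forall i, i \notin A -> g i = 0) -> \sum_i g i *: v i = \sum_(i in A) g i *: v i.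
    move=> gA; rewrite [RHS]big_mkcond; apply: eq_bigr => i _.
    by case: ifPn => // /gA ->; rewrite scale0r.
  have sumN (Q : finType) (g : Q -> R) (v : Q -> 'rV[R]_N) :
      \sum_i g i *: v i = - \sum_i - g i *: v i.
    by rewrite -sumrN; apply: eq_bigr => i _; rewrite scaleNr opprK.
  rewrite [X in _ + (_ + (X + _))]sumN [X in _ + (_ + (_ + X))]sumN.
  rewrite (sumI _ (I2 :|: I5) a)// (sumI _ (I3 :|: I6) b)// !addrA.
  congr (_ + _ - _ - _); apply: sumI => k kI; apply: csS; apply: contra kI.
    by rewrite inE.
  exact: S_e.
move=> /(_ p1 (fun i _ => cs_theta_ge0 i) p3 p4 p5 cs_sign p7 (z \o phi)
  (fun k i => constraint_grad (z (phi k)) (w (phi k)) (inl i)) zphi) H.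
have h1 k : (z \o phi) k != zs by have [] := Gphi k.
have h2 i : i \in I4 -> forall k, limiting_subdiff (theta i) ((z \o phi) k)
    (constraint_grad (z (phi k)) (w (phi k)) (inl i)).
  case: i => [i|] iI k /=.
    exists (fun=> z (phi k)), (fun=> grad (theta (Some i)) (z (phi k))).
    by split; [exact: cvg_cst..|move=> _; exact: regS].
  exists (fun=> z (phi k)), (fun=> w (phi k)); split; [exact: cvg_cst..|].
  by move=> _; have [_ _ ] := Gphi k; apply; move: iI; rewrite inE.
have h3 i : i \in I4 -> (fun k => constraint_grad (z (phi k)) (w (phi k)) (inl i)) @ \oo -->
    constraint_grad zs ws (inl i).
  case: i => [i|] iI /=; last exact: wphi.
  exact: cvg_comp zphi (@theta_C1 i).
(* RCPLD declares this family dependent, yet every index outside the basis belongs to [S], hence to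
   the support of [c], and [reduced_indep] makes it independent. *)
have [n _ /(_ n (leqnn n)) /negP] := H h1 h2 h3; apply.
rewrite -constraint_grad_image; apply/free_image => d dsum k kS.
pose d1 l := if l \in multiplier_set I4 I1 (I2 :|: I5) (I3 :|: I6) then d l else 0.
have : d1 k = 0.
  apply: (reduced_indep (red (phi n))) => [l lS0 cl|].
    have [Sphi _ _] := Gphi n; have lS : l \notin S by rewrite -Sphi cl eqxx.
    rewrite /d1; case: ifPn => // lM; exfalso; apply/negP: lS; apply/negPn.
    move: lM lS0; case: l cl => [i|[j|[i|i]]] _; rewrite !inE //=.
    - by move=> ->.
    - by move=> /orP[->|/andP[]].
    - by move=> /orP[->|/andP[]].
  apply: (etrans _ dsum); rewrite [RHS]big_mkcond; apply: eq_bigr => l _.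
  by rewrite /d1; case: ifP => // _; rewrite scale0r.
by rewrite /d1 kS.
Unshelve. all: by end_near.
Qed.

End Reduced.

(** * Continuously differentiable functions *)

(** A directional derivative sees only the restriction to a line, so the two functions may live on
    different spaces; this identifies blocks of a gradient with partial gradients. *)
Lemma derive_congr (R : numFieldType) (V V' W : normedModType R) (f : V -> W) (g : V' -> W)
    (a v : V) (a' v' : V') :
  (forall h : R, f (h *: v + a) = g (h *: v' + a')) -> 'D_v f a = 'D_v' g a'.
Proof.
move=> fg; have fa : f a = g a' by have := fg 0; rewrite !scale0r !add0r.
rewrite /derive (_ : (fun h => _) =
    (fun h => h^-1 *: ((g \o shift a') (h *: v') - g a')))//.
by apply/funext => h; rewrite /= fg fa.
Qed.

Lemma cvg_row (R : realType) (T : Type) (F : set_system T) {FF : Filter F} N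
    (f : T -> 'rV[R]_N) (l : 'rV[R]_N) :
  (forall j, f x 0 j @[x --> F] --> l 0 j) -> f x @[x --> F] --> l.
Proof.
move=> H; apply/cvgrPdist_le => eps eps0.
have : \forall x \near F, forall j, `|l 0 j - f x 0 j| <= eps.
  apply: (@filter_forall _ _ (fun j x => _) F) => j.
  by have /cvgrPdist_le := H j; apply.
apply: filterS => x Hx; apply: norm_mx_le; first exact: ltW.
by move=> i j; rewrite ord1 !mxE.
Qed.

Section C1.
Variables (R : realType) (N : nat).
Implicit Types (phi psi : 'rV[R]_N -> R).

Lemma C1_smooth phi : continuously_differentiable phi -> smooth phi.
Proof. by move=> [d _] z; exact: differentiable_frechet. Qed.

Lemma C1_grad_continuous phi : continuously_differentiable phi -> continuous (grad phi).
Proof.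
move=> [_ c] z; apply: (@cvg_row _ _ (nbhs z) _) => j; rewrite mxE.
rewrite (_ : (fun x => grad phi x 0 j) = 'D_(delta_mx 0 j) phi); first exact: c.
by apply/funext => x; rewrite mxE.
Qed.

Lemma C1_cst (c : R) : continuously_differentiable (fun _ : 'rV[R]_N => c).
Proof.
split=> [z|v z]; first exact: differentiable_cst.
rewrite (_ : 'D_v _ = fun=> 0); first exact: cst_continuous.
by apply/funext => x; exact: derive_cst.
Qed.

Lemma C1_add phi psi : continuously_differentiable phi ->
  continuously_differentiable psi -> continuously_differentiable (fun z => phi z + psi z).
Proof.
move=> [d1 c1] [d2 c2]; split=> [z|v z]; first exact: differentiableD.
rewrite (_ : 'D_v _ = fun z => 'D_v phi z + 'D_v psi z); last first.
  by apply/funext => x; rewrite -deriveD//; exact: diff_derivable.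
exact: (cvgD (c1 v z) (c2 v z)).
Qed.

Lemma C1_opp phi : continuously_differentiable phi ->
  continuously_differentiable (fun z => - phi z).
Proof.
move=> [d1 c1]; split=> [z|v z]; first exact: differentiableN.
rewrite (_ : 'D_v _ = fun z => - 'D_v phi z); last first.
  by apply/funext => x; rewrite -deriveN//; exact: diff_derivable.
exact: (cvgN (c1 v z)).
Qed.

Lemma C1_mul phi psi : continuously_differentiable phi ->
  continuously_differentiable psi -> continuously_differentiable (fun z => phi z * psi z).
Proof.
move=> [d1 c1] [d2 c2]; split=> [z|v z]; first exact: differentiableM.
rewrite (_ : 'D_v _ = fun z => phi z * 'D_v psi z + psi z * 'D_v phi z); last first.
  by apply/funext => x; rewrite -[RHS]deriveM//; exact: diff_derivable.
have phic := differentiable_continuous (d1 z).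
have psic := differentiable_continuous (d2 z).
exact: (cvgD (cvgM phic (c2 v z)) (cvgM psic (c1 v z))).
Qed.

Lemma C1_sum (I : finType) (phi : I -> 'rV[R]_N -> R) :
  (forall i, continuously_differentiable (phi i)) ->
  continuously_differentiable (fun z => \sum_i phi i z).
Proof.
move=> H; elim: (index_enum I) => [|i s IH].
  rewrite (_ : (fun z => _) = fun=> 0); first exact: C1_cst.
  by apply/funext => z; rewrite big_nil.
rewrite (_ : (fun z => _) = fun z => phi i z + \sum_(j <- s) phi j z); first exact: C1_add.
by apply/funext => z; rewrite big_cons.
Qed.

Lemma C1_coord m k (phi : 'rV[R]_N -> 'M[R]_(m, k)) i j :
  continuously_differentiable phi -> continuously_differentiable (fun z => phi z i j).
Proof.
move=> [d1 c1]; split=> [z|v z].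
  apply: (@differentiable_comp _ _ _ _ phi (fun M : 'M[R]_(m, k) => M i j)) => //.
  exact: differentiable_coord.
rewrite (_ : 'D_v _ = fun z => 'D_v phi z i j); last first.
  by apply/funext => x; rewrite derive_mx ?mxE//; exact: diff_derivable.
exact: (@cvg_coord R _ (nbhs z) _ m k ('D_v phi) ('D_v phi z) i j (c1 v z)).
Qed.

Lemma C1_comp_linear M (L : {linear 'rV[R]_N -> 'rV[R]_M}) (phi : 'rV[R]_M -> R) :
  continuous L -> continuously_differentiable phi ->
  continuously_differentiable (fun z => phi (L z)).
Proof.
move=> Lc [d1 c1]; split=> [z|v z].
  apply: (@differentiable_comp _ _ _ _ L phi) => //; exact: linear_differentiable.
rewrite (_ : 'D_v _ = fun z => 'D_(L v) phi (L z)); last first.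
  by apply/funext => x; apply: derive_congr => h; rewrite linearP.
exact: (cvg_comp _ _ (Lc z) (c1 (L v) (L z))).
Qed.

End C1.

Lemma C1_linear_coord (R : realType) N M (L : {linear 'rV[R]_N -> 'rV[R]_M}) i :
  continuous L -> continuously_differentiable (fun z => L z 0 i).
Proof.
move=> Lc; have Ld z : differentiable L z by exact: linear_differentiable.
split=> [z|v z].
  apply: (@differentiable_comp _ _ _ _ L (fun M : 'rV[R]_M => M 0 i)) => //.
  exact: differentiable_coord.
rewrite (_ : 'D_v _ = fun=> L v 0 i); first exact: cst_continuous.
apply/funext => x; have -> : L v 0 i = ('D_v L x) 0 i by rewrite deriveE// diff_lin.
by rewrite derive_mx ?mxE//; exact: diff_derivable.
Qed.

(* Exact penalization with the equality constraints [z = zs], whose only feasible point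
   is [zs]. *)
Lemma limiting_subdiff_nonempty (R : realType) N (phi : 'rV[R]_N -> R) (zs : 'rV[R]_N) L :
  0 <= L -> (\forall z \near zs, calm phi L z) -> exists xi, limiting_subdiff phi zs xi.
Proof.
move=> L0 /nbhs_ballP[d /= d0 Hd].
have d20 : 0 < d / 2 by rewrite divr_gt0.
have calm_phi z : rball zs (d / 2) z -> calm phi L z.
  move=> zr; apply: Hd; rewrite -ball_normE /= distrC.
  by apply: le_lt_trans zr _; rewrite ltr_pdivrMr// ltr_pMr// ltr1n.
pose e (j : 'I_N) (z : 'rV[R]_N) := z 0 j - zs 0 j.
have idc : continuous (idfun : 'rV[R]_N -> 'rV[R]_N) by move=> z.
have e_smooth j : smooth (e j).
  by apply: C1_smooth; apply: C1_add; [exact: (C1_linear_coord (L := idfun))|exact: C1_cst].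
(* The empty index type switches off the inequality and complementarity constraints. *)
pose none (i : void) (z : 'rV[R]_N) : R := 0.
have none_smooth i : smooth (none i) by case: i.
have calm0 z : rball zs (d / 2) z -> calm (fun=> 0) 0 z.
  by move=> _; rewrite /calm; near=> z'; rewrite subrr normr0 mul0r.
have feas0 : feasible_system (fun=> 0) none e none none zs.
  by split => // j; rewrite /e subrr.
have min0 z : rball zs (d / 2) z -> feasible_system (fun=> 0) none e none none z ->
    phi zs <= phi z.
  move=> _ [_ _ ez _]; rewrite (_ : z = zs)//; apply/rowP => j.
  by have /eqP := ez j; rewrite subr_eq0 => /eqP.
have exP n : exists x : 'rV[R]_N * 'rV[R]_N,
    [/\ `|x.1 - zs| < n.+1%:R^-1, `|x.2| <= L + 1 & regular_subdiff phi x.1 x.2].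
  have : 0 < Num.min n.+1%:R^-1 (d / 2) by rewrite lt_min invr_gt0 ltr0n.
  move=> /(exists_approx_stationary none_smooth e_smooth none_smooth none_smooth
    L0 (lexx 0) d20 calm_phi calm0 feas0 min0).
  move=> [z1 [z [eta [w [lam0 [lam [mu [a [b []]]]]]]]]].
  rewrite lt_min => /andP[z1n z1d] _ A; exists (z1, eta); split => //=.
    apply: regular_subdiff_bounded L0 _ (approx_objective A).
    by apply: calm_phi; exact: ltW.
  exact: approx_objective A.
have [x xP] := choice exP.
have [U [UU Usub]] := ultraFilterLemma (F := \oo) _.
have [xi xiE] : exists xi : 'rV[R]_N, (x n).2 @[n --> U] --> xi.
  by apply: (ultra_cvg (C := L + 1) UU); apply: nearW => n; have [] := xP n.
have cx : (x n).1 @[n --> U] --> zs.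
  have : (x n).1 @[n --> \oo] --> zs by apply: cvg_invn => k; have [] := xP k.
  by move=> cx; apply: cvg_trans cx => A /= HA; exact: Usub.
pose Q k n := `|(x n).1 - zs| < k.+1%:R^-1 /\ `|(x n).2 - xi| < k.+1%:R^-1.
have /(ultra_diagonal UU)[f Hf] : forall k, \forall n \near U, Q k n.
  move=> k; have k0 : 0 < k.+1%:R^-1 :> R by rewrite invr_gt0 ltr0n.
  have h1 : \forall n \near U, `|(x n).1 - zs| < k.+1%:R^-1.
    by move: cx => /cvgrPdistC_lt; apply.
  have h2 : \forall n \near U, `|(x n).2 - xi| < k.+1%:R^-1.
    by move: xiE => /cvgrPdistC_lt; apply.
  by near=> n; split; near: n.
exists xi, (fun k => (x (f k)).1), (fun k => (x (f k)).2); split.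
- by apply: cvg_invn => k; have [] := Hf k.
- by apply: cvg_invn => k; have [] := Hf k.
- by move=> k; have [] := xP (f k).
Unshelve. all: by end_near.
Qed.

(** * Block structure of the variables *)

Section Blocks.
Variables (R : realType) (d s m n : nat).
Implicit Types (z : 'rV[R]_(d + s + m + n)) (w : 'rV[R]_(d + s)).

Definition blocks w (u : 'rV[R]_m) (v : 'rV[R]_n) : 'rV[R]_(d + s + m + n) :=
  row_mx (row_mx w u) v.

Lemma blocksK z : blocks (xyz z) (uz z) (vz z) = z.
Proof. by rewrite /blocks !hsubmxK. Qed.

Lemma xyz_blocks w u v : xyz (blocks w u v) = w.
Proof. by rewrite /xyz !row_mxKl. Qed.

Lemma uz_blocks w u v : uz (blocks w u v) = u.
Proof. by rewrite /uz row_mxKl row_mxKr. Qed.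

Lemma vz_blocks w u v : vz (blocks w u v) = v.
Proof. by rewrite /vz row_mxKr. Qed.

Lemma blocks_linear h w u v w' u' v' :
  h *: blocks w u v + blocks w' u' v' = blocks (h *: w + w') (h *: u + u') (h *: v + v').
Proof. by rewrite /blocks !scale_row_mx !add_row_mx. Qed.

Lemma delta_lshift a b (j : 'I_a) :
  delta_mx 0 (lshift b j) = row_mx (delta_mx 0 j) 0 :> 'rV[R]_(a + b).
Proof.
apply/rowP => k; rewrite -[k]splitK; case: (fintype.split k) => l /=.
  by rewrite row_mxEl !mxE eq_lshift.
by rewrite row_mxEr !mxE eq_rlshift.
Qed.

Lemma delta_rshift a b (j : 'I_b) :
  delta_mx 0 (rshift a j) = row_mx 0 (delta_mx 0 j) :> 'rV[R]_(a + b).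
Proof.
apply/rowP => k; rewrite -[k]splitK; case: (fintype.split k) => l /=.
  by rewrite row_mxEl !mxE eq_lrshift.
by rewrite row_mxEr !mxE eq_rshift.
Qed.

Lemma row_mx00 a b : row_mx 0 0 = 0 :> 'rV[R]_(a + b).
Proof. exact: row_mx0. Qed.

Lemma xyz_grad (Phi : 'rV[R]_(d + s + m + n) -> R) z :
  xyz (grad Phi z) = grad (fun w => Phi (blocks w (uz z) (vz z))) (xyz z).
Proof.
apply/rowP => j; rewrite !mxE; apply: derive_congr => h.
rewrite -{1}[z]blocksK !delta_lshift -/(blocks _ 0 0) blocks_linear.
by rewrite !scaler0 !add0r.
Qed.

Lemma uz_grad (Phi : 'rV[R]_(d + s + m + n) -> R) z :
  uz (grad Phi z) = grad (fun u => Phi (blocks (xyz z) u (vz z))) (uz z).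
Proof.
apply/rowP => j; rewrite !mxE; apply: derive_congr => h.
rewrite -{1}[z]blocksK !delta_lshift delta_rshift -/(blocks 0 _ 0) blocks_linear.
by rewrite !scaler0 !add0r.
Qed.

Lemma vz_grad (Phi : 'rV[R]_(d + s + m + n) -> R) z :
  vz (grad Phi z) = grad (fun v => Phi (blocks (xyz z) (uz z) v)) (vz z).
Proof.
apply/rowP => j; rewrite !mxE; apply: derive_congr => h.
rewrite -{1}[z]blocksK delta_rshift -row_mx00 -/(blocks 0 0 _) blocks_linear.
by rewrite !scaler0 !add0r.
Qed.

Lemma grad_cst N (c : R) (x : 'rV[R]_N) : grad (fun=> c) x = 0.
Proof. by apply/rowP => j; rewrite !mxE; exact: derive_cst. Qed.

Lemma norm_xyz_le z : `|xyz z| <= `|z|.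
Proof. by apply: norm_mx_le => // i j; rewrite !mxE; exact: norm_coord_le. Qed.

Lemma xyzB z z' : xyz (z - z') = xyz z - xyz z'.
Proof. by rewrite /xyz !linearB. Qed.

Lemma continuous_xyz : continuous (@xyz R d s m n).
Proof.
move=> z.
exact: (cvg_comp _ _ (@continuous_lsubmx R _ _ _ z) (@continuous_lsubmx R _ _ _ (lsubmx z))).
Qed.

Lemma near_xyz (Q : 'rV[R]_(d + s) -> Prop) z :
  (\forall w \near xyz z, Q w) -> \forall z' \near z, Q (xyz z').
Proof. by move=> H; exact: (@continuous_xyz z _ H). Qed.

Lemma calm_xyz phi L z : 0 <= L -> calm phi L (xyz z) -> calm (phi \o @xyz R d s m n) L z.
Proof.
move=> L0 /near_xyz; apply: filterS => z' /= H; apply: le_trans H _.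
by rewrite ler_wpM2l// -xyzB norm_xyz_le.
Qed.

Lemma dotv_blocks w u v w' u' v' :
  dotv (blocks w u v) (blocks w' u' v') = dotv w w' + dotv u u' + dotv v v'.
Proof.
rewrite /dotv big_split_ord big_split_ord /=; congr (_ + _ + _);
  by apply: eq_bigr => i _; rewrite /blocks ?row_mxEl ?row_mxEr.
Qed.

(** Perturbing one block at a time: in the [u] and [v] blocks the function is constant, so the
    linear term is [o] of the increment and must vanish. *)
Lemma regular_subdiff_xyz phi z zeta :
  regular_subdiff (phi \o @xyz R d s m n) z zeta ->
  [/\ regular_subdiff phi (xyz z) (xyz zeta), uz zeta = 0 & vz zeta = 0].
Proof.
move=> H.
have zetaE := blocksK zeta; have zE := blocksK z.
have normb w u v : `|blocks w u v| <= `|w| + `|u| + `|v|.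
  apply: norm_mx_le.
    by rewrite !addr_ge0.
  move=> i j; rewrite -[j]splitK; case: (fintype.split j) => [k|k] /=; last first.
    by rewrite /blocks row_mxEr; apply: le_trans (norm_coord_le _ _ _) _; rewrite lerDr addr_ge0.
  rewrite /blocks row_mxEl -[k]splitK; case: (fintype.split k) => l /=.
    by rewrite row_mxEl; apply: le_trans (norm_coord_le _ _ _) _; rewrite -addrA lerDl addr_ge0.
  rewrite row_mxEr; apply: le_trans (norm_coord_le _ _ _) _.
  by rewrite addrAC lerDr addr_ge0.
have bB w u v : blocks w u v - z = blocks (w - xyz z) (u - uz z) (v - vz z).
  by rewrite -{1}zE -[X in X - _]scale1r -scaleN1r scale1r addrC blocks_linear !scaleN1r
    ![- _ + _]addrC.
split.
- move=> eps eps0; have /nbhs_ballP[r /= r0 Hr] := H _ eps0.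
  apply: filterS (near_dist_lt (xyz z) r0) => w' wr.
  have nb : `|blocks w' (uz z) (vz z) - z| <= `|w' - xyz z|.
    by rewrite bB !subrr; apply: le_trans (normb _ _ _) _; rewrite !normr0 !addr0.
  have /Hr /= : ball z r (blocks w' (uz z) (vz z)).
    by rewrite -ball_normE /= distrC; exact: le_lt_trans nb wr.
  rewrite xyz_blocks bB !subrr -[zeta in dotv zeta]zetaE dotv_blocks !(dotvC _ 0) !dotv0l !addr0.
  apply: le_trans; rewrite lerN2 ler_wpM2l ?(ltW eps0)//.
  by apply: le_trans (normb _ _ _) _; rewrite !normr0 !addr0.
- apply: (@dotv_near_eq0 _ _ (uz z)) => eps eps0; have /nbhs_ballP[r /= r0 Hr] := H _ eps0.
  apply: filterS (near_dist_lt (uz z) r0) => u' ur.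
  have nb : `|blocks (xyz z) u' (vz z) - z| <= `|u' - uz z|.
    by rewrite bB !subrr; apply: le_trans (normb _ _ _) _; rewrite !normr0 add0r !addr0.
  have /Hr /= : ball z r (blocks (xyz z) u' (vz z)).
    by rewrite -ball_normE /= distrC; exact: le_lt_trans nb ur.
  rewrite xyz_blocks -[zeta in dotv zeta]zetaE [X in dotv _ X]bB !subrr dotv_blocks.
  rewrite !(dotvC _ 0) !dotv0l !add0r addr0 lerN2 => le1; apply: le_trans le1 _.
  by rewrite ler_wpM2l// ltW.
- apply: (@dotv_near_eq0 _ _ (vz z)) => eps eps0; have /nbhs_ballP[r /= r0 Hr] := H _ eps0.
  apply: filterS (near_dist_lt (vz z) r0) => v' vr.
  have nb : `|blocks (xyz z) (uz z) v' - z| <= `|v' - vz z|.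
    by rewrite bB !subrr; apply: le_trans (normb _ _ _) _; rewrite !normr0 !add0r.
  have /Hr /= : ball z r (blocks (xyz z) (uz z) v').
    by rewrite -ball_normE /= distrC; exact: le_lt_trans nb vr.
  rewrite xyz_blocks -[zeta in dotv zeta]zetaE [X in dotv _ X]bB !subrr dotv_blocks.
  rewrite !(dotvC _ 0) !dotv0l !add0r lerN2 => le1; apply: le_trans le1 _.
  by rewrite ler_wpM2l// ltW.
Qed.

Lemma limiting_subdiff_xyz phi z xi :
  limiting_subdiff (phi \o @xyz R d s m n) z xi ->
  [/\ limiting_subdiff phi (xyz z) (xyz xi), uz xi = 0 & vz xi = 0].
Proof.
move=> [zk [xik [zkz xikxi sub]]].
split.
- exists (fun k => xyz (zk k)), (fun k => xyz (xik k)); split.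
  + exact: cvg_comp zkz (@continuous_xyz z).
  + exact: cvg_comp xikxi (@continuous_xyz xi).
  + by move=> k; have [] := regular_subdiff_xyz (sub k).
- apply/rowP => j; rewrite [RHS]mxE.
  have : uz (xik k) 0 j @[k --> \oo] --> uz xi 0 j.
    rewrite !mxE (_ : (fun k => _) = fun k => xik k 0 (lshift n (rshift (d + s) j))).
      exact: cvg_coord.
    by apply/funext => k; rewrite !mxE.
  rewrite (_ : (fun k => _) = fun=> 0); last first.
    by apply/funext => k; have [_ -> _] := regular_subdiff_xyz (sub k); rewrite mxE.
  by move=> c0; apply: (cvg_unique _ c0); [exact: norm_hausdorff|exact: cvg_cst].
- apply/rowP => j; rewrite [RHS]mxE.
  have : vz (xik k) 0 j @[k --> \oo] --> vz xi 0 j.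
    rewrite !mxE (_ : (fun k => _) = fun k => xik k 0 (rshift (d + s + m) j)).
      exact: cvg_coord.
    by apply/funext => k; rewrite !mxE.
  rewrite (_ : (fun k => _) = fun=> 0); last first.
    by apply/funext => k; have [_ _ ->] := regular_subdiff_xyz (sub k); rewrite mxE.
  by move=> c0; apply: (cvg_unique _ c0); [exact: norm_hausdorff|exact: cvg_cst].
Qed.

End Blocks.

(** * The combined program *)

Lemma lipschitz_around_calm (R : realType) N (phi : 'rV[R]_N -> R) z :
  lipschitz_around phi z -> exists2 L, 0 <= L & \forall w \near z, calm phi L w.
Proof.
(* The constant is only provided strictly above some [M] of unknown sign; [Num.max M 0 + 1] is such
   a constant and nonnegative. *)
move=> [A Az [M [_ HM]]]; exists (Num.max M 0 + 1); first by rewrite addr_ge0// le_max lexx orbT.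
have {HM}lip : forall x y, A x -> A y -> `|phi x - phi y| <= (Num.max M 0 + 1) * `|x - y|.
  move=> x y Ax Ay; have ltM : M < Num.max M 0 + 1.
    by rewrite ltr_pwDr// le_max lexx.
  by have := HM _ ltM (x, y); apply.
have : nbhs z (interior A) by exact: nbhs_interior.
apply: filterS => w; rewrite /interior => Aw; have Aww := nbhs_singleton Aw.
by apply: filterS Aw => w' Aw'; exact: lip.
Qed.

Lemma C1_calm (R : realType) N (phi : 'rV[R]_N -> R) (z : 'rV[R]_N) :
  continuously_differentiable phi -> exists2 L, 0 <= L & \forall w \near z, calm phi L w.
Proof.
move=> C; have Cs := C1_smooth C; have Cg := C1_grad_continuous C.
(* One unit pays for the differentiability remainder at [w], the other for the variation of the
   gradient between [z] and [w]. *)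
exists (\sum_i `|grad phi z 0 i| + 1 + 1); first by rewrite !addr_ge0// sumr_ge0.
have cs : \sum_i `|grad phi w 0 i| @[w --> z] --> \sum_i `|grad phi z 0 i|.
  have sum_norm (T : Type) (G : set_system T) (FG : Filter G) (g : T -> 'rV[R]_N) (l : 'rV[R]_N) :
      g x @[x --> G] --> l -> \sum_i `|g x 0 i| @[x --> G] --> \sum_i `|l 0 i|.
    by move=> gl; apply: cvg_sum => i _; apply: cvg_norm; exact: cvg_coord.
  exact: sum_norm (Cg z).
have : \forall w \near z, \sum_i `|grad phi w 0 i| <= \sum_i `|grad phi z 0 i| + 1.
  move: cs => /cvgr_le; apply; by rewrite ltrDl.
apply: filterS => w lew; apply: filterS (frechet_calm (Cs w)) => w' H.
by apply: le_trans H _; rewrite ler_wpM2r// lerD2r.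
Qed.

Lemma calmB (R : realType) N (phi psi : 'rV[R]_N -> R) L1 L2 z :
  calm phi L1 z -> calm psi L2 z -> calm (fun w => phi w - psi w) (L1 + L2) z.
Proof.
move=> H1 H2; rewrite /calm; near=> w; rewrite mulrDl.
have -> : phi w - psi w - (phi z - psi z) = (phi w - phi z) - (psi w - psi z) by ring.
apply: le_trans (ler_normB _ _) _; apply: lerD; by near: w.
Unshelve. all: by end_near.
Qed.

Lemma calm_lsubmx (R : realType) a b (phi : 'rV[R]_a -> R) L (w : 'rV[R]_(a + b)) :
  0 <= L -> calm phi L (lsubmx w) -> calm (fun w => phi (lsubmx w)) L w.
Proof.
move=> L0 H; have : \forall w' \near w,
    `|phi (lsubmx w') - phi (lsubmx w)| <= L * `|lsubmx w' - lsubmx w|.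
  exact: (@continuous_lsubmx R _ _ _ w _ H).
apply: filterS => w' /= le1; apply: le_trans le1 _; rewrite ler_wpM2l// -linearB.
by apply: norm_mx_le => // i j; rewrite mxE norm_coord_le.
Qed.

Lemma jacobian_coord (R : realType) N k (phi : 'rV[R]_N -> 'rV[R]_k) w i j :
  differentiable phi w -> 'J phi w i j = grad (fun x => phi x 0 j) w 0 i.
Proof.
move=> dphi; rewrite [RHS]mxE.
have := deriveEjacobian (delta_mx 0 i) dphi; rewrite derive_mx; last exact: diff_derivable.
move=> /(congr1 (fun M : 'rV[R]_k => M 0 j)); rewrite mxE => ->.
by rewrite -rowE [RHS]mxE.
Qed.

Lemma mulmx_jacobian (R : realType) N k (phi : 'rV[R]_N -> 'rV[R]_k) w (lam : 'rV[R]_k) :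
  differentiable phi w ->
  lam *m ('J phi w)^T = \sum_j lam 0 j *: grad (fun x => phi x 0 j) w.
Proof.
move=> dphi; rewrite mulmx_sum_row; apply: eq_bigr => j _; congr (_ *: _).
by apply/rowP => i; rewrite [LHS]mxE [LHS]mxE jacobian_coord.
Qed.

Section Program.
Variables (R : realType) (d s m n p q : nat) (P : program R d s m n p q).
Hypotheses (G_C1 : continuously_differentiable (conG P))
  (H_C1 : continuously_differentiable (conH P))
  (f_C1 : continuously_differentiable (lowf P))
  (g_C1 : continuously_differentiable (lowg P))
  (h_C1 : continuously_differentiable (lowh P))
  (fy_C1 : continuously_differentiable (grady (lowf P)))
  (gy_C1 : continuously_differentiable (Jy (lowg P)))
  (hy_C1 : continuously_differentiable (Jy (lowh P))).

Lemma C1_xyz (phi : 'rV[R]_(d + s) -> R) : continuously_differentiable phi ->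
  continuously_differentiable (fun z : 'rV[R]_(d + s + m + n) => phi (xyz z)).
Proof.
apply: (@C1_comp_linear R _ _ (lsubmx \o lsubmx : {linear 'rV[R]_(d + s + m + n) -> 'rV[R]_(d + s)}) phi).
exact: (@continuous_xyz R d s m n).
Qed.

Lemma C1_uz i : continuously_differentiable (fun z : 'rV[R]_(d + s + m + n) => uz z 0 i).
Proof.
apply: (@C1_linear_coord R _ _ (rsubmx \o lsubmx : {linear 'rV[R]_(d + s + m + n) -> 'rV[R]_m})).
by move=> z; exact: (cvg_comp _ _ (@continuous_lsubmx R _ _ _ z) (@continuous_rsubmx R _ _ _ (lsubmx z))).
Qed.

Lemma C1_vz i : continuously_differentiable (fun z : 'rV[R]_(d + s + m + n) => vz z 0 i).
Proof.
apply: (@C1_linear_coord R _ _ (rsubmx : {linear 'rV[R]_(d + s + m + n) -> 'rV[R]_n})).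
exact: continuous_rsubmx.
Qed.

Lemma gradyL_coord w u v j : gradyL P w u v 0 j =
  grady (lowf P) w 0 j + \sum_i u 0 i * Jy (lowg P) w j i + \sum_i v 0 i * Jy (lowh P) w j i.
Proof.
by rewrite /gradyL !mxE; congr (_ + _ + _); apply: eq_bigr => i _; rewrite !mxE.
Qed.

Lemma C1_gradyL j : continuously_differentiable
  (fun z : 'rV[R]_(d + s + m + n) => gradyL P (xyz z) (uz z) (vz z) 0 j).
Proof.
rewrite (_ : (fun z => _) = fun z => grady (lowf P) (xyz z) 0 j
   + \sum_i uz z 0 i * Jy (lowg P) (xyz z) j i + \sum_i vz z 0 i * Jy (lowh P) (xyz z) j i).
  apply: C1_add; first apply: C1_add.
  - exact: C1_xyz (C1_coord 0 j fy_C1).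
  - by apply: C1_sum => i; apply: C1_mul; [exact: C1_uz|exact: C1_xyz (C1_coord j i gy_C1)].
  - by apply: C1_sum => i; apply: C1_mul; [exact: C1_vz|exact: C1_xyz (C1_coord j i hy_C1)].
by apply/funext => z; rewrite gradyL_coord.
Qed.

Lemma equalityH j z : equality P (lshift s (lshift n j)) z = conH P (xyz z) 0 j.
Proof. by rewrite /equality !row_mxEl. Qed.

Lemma equalityh j z : equality P (lshift s (rshift q j)) z = lowh P (xyz z) 0 j.
Proof. by rewrite /equality row_mxEl row_mxEr. Qed.

Lemma equalityL j z : equality P (rshift (q + n) j) z = gradyL P (xyz z) (uz z) (vz z) 0 j.
Proof. by rewrite /equality row_mxEr. Qed.

Lemma C1_equality j : continuously_differentiable (equality P j).
Proof.
rewrite -[j]splitK; case: (fintype.split j) => [k|k] /=; last first.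
  have := C1_gradyL k; congr continuously_differentiable.
  by apply/funext => z; rewrite equalityL.
rewrite -[k]splitK; case: (fintype.split k) => l /=.
  have := C1_xyz (C1_coord 0 l H_C1); congr continuously_differentiable.
  by apply/funext => z; rewrite equalityH.
have := C1_xyz (C1_coord 0 l h_C1); congr continuously_differentiable.
by apply/funext => z; rewrite equalityh.
Qed.

Lemma C1_compG i : continuously_differentiable (@compG R d s m n p q P i).
Proof. exact: C1_opp (C1_xyz (C1_coord 0 i g_C1)). Qed.

Lemma C1_theta i : continuously_differentiable (@theta R d s m n p q P (Some i)).
Proof. exact: C1_xyz (C1_coord 0 i G_C1). Qed.

Lemma differentiable_gradyL u v w : differentiable (fun w => gradyL P w u v) w.
Proof.
have [df _] := fy_C1; have [dg _] := gy_C1; have [dh _] := hy_C1.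
have mul k (x : 'rV[R]_k) (Phi : 'rV[R]_(d + s) -> 'M[R]_(s, k)) :
    differentiable Phi w -> differentiable (fun w => x *m (Phi w)^T) w.
  move=> dPhi; pose L := (mulmx x \o trmx : {linear 'M[R]_(s, k) -> 'rV[R]_s}).
  apply: (@differentiable_comp _ _ _ _ Phi L) => //; apply: linear_differentiable.
  move=> M; apply: (@cvg_row _ _ (nbhs M) _) => j; rewrite !mxE.
  rewrite (_ : (fun M : 'M[R]_(s, k) => _) = fun M : 'M[R]_(s, k) => \sum_i x 0 i * M j i); last first.
    by apply/funext => M'; rewrite !mxE; apply: eq_bigr => i _; rewrite mxE.
  rewrite (_ : \sum_j0 _ = \sum_i x 0 i * M j i); last by apply: eq_bigr => i _; rewrite mxE.
  apply: cvg_sum => i _; apply: cvgM; first exact: cvg_cst.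
  exact: (@coord_continuous R s k j i M).
apply: differentiableD; last exact: mul.
by apply: differentiableD => //; exact: mul.
Qed.

Lemma value_gap_calm w : value_lipschitz_around P (lsubmx w) ->
  exists2 L, 0 <= L & \forall w' \near w, calm (value_gap P) L w'.
Proof.
move=> [_ /lipschitz_around_calm[L2 L20 H2]].
have [L1 L10 H1] := C1_calm w f_C1.
exists (L1 + L2); first by rewrite addr_ge0.
have H3 : \forall w' \near w, calm (fun x' => fine (value_fun P x')) L2 (lsubmx w').
  exact: (@continuous_lsubmx R _ _ _ w _ H2).
apply: filterS2 H1 H3 => w' c1 c2.
exact: calmB c1 (calm_lsubmx L20 c2).
Qed.

Definition CP_system z := feasible_system (theta P None) (theta P \o Some) (equality P)
  (compG P) (@compH R d s m n) z.

(** Finiteness is essential because [fine] sends infinite values to 0. Componentwise complementarity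
    follows from the vanishing inner product, a sum of nonnegative terms. *)
Lemma CP_systemP z : value_fun P (lsubmx (xyz z)) \is a fin_num ->
  CP_system z <-> feasible P z.
Proof.
move=> Vfin.
have gapE : ((lowf P (xyz z))%:E - value_fun P (lsubmx (xyz z)))%E =
    (value_gap P (xyz z))%:E.
  by rewrite -[in LHS](fineK Vfin) -EFinB.
have oppE i : (- lowg P (xyz z)) 0 i = compG P i z by rewrite mxE.
rewrite /CP_system /feasible /= gapE lee_fin; split.
  move=> [z0 zG zE zC]; split => //; split.
  - exact: zG.
  - by apply/rowP => j; rewrite -equalityH zE mxE.
  - by apply/rowP => j; rewrite -equalityh zE mxE.
  - by apply/rowP => j; rewrite -equalityL zE mxE.
  - split=> [i|i|] /=; first by rewrite oppE; have [+ _ _] := zC i.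
      by have [_ + _] := zC i.
    by rewrite /dotv big1// => i _; rewrite oppE; have [_ _] := zC i.
move=> [z0 [zG zH zh zL [/= g0 u0 gu]]]; split => //.
- move=> j; rewrite -[j]splitK; case: (fintype.split j) => [k|k] /=; last first.
    by rewrite equalityL zL mxE.
  rewrite -[k]splitK; case: (fintype.split k) => l /=.
    by rewrite equalityH zH mxE.
  by rewrite equalityh zh mxE.
- move=> i; have g0i : 0 <= compG P i z by rewrite -oppE.
  split => //; first exact: u0.
  by rewrite -oppE; apply: (psumr_eq0P _ gu) => // j _; rewrite mulr_ge0.
Qed.

End Program.

(** * Gradients of the constraint functions by blocks *)

Lemma gradN (R : realType) N (phi : 'rV[R]_N -> R) z : differentiable phi z ->
  grad (fun w => - phi w) z = - grad phi z.
Proof.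
by move=> dphi; apply/rowP => j; rewrite !mxE deriveN//; exact: diff_derivable.
Qed.

(** Covers the blocks with affine dependence: [gradyL] in [u] and in [v], and [compH] in [u]. *)
Lemma grad_affine (R : realType) N (c : R) (a : 'rV[R]_N) z :
  grad (fun w => c + dotv a w) z = a.
Proof.
apply/rowP => j; rewrite !mxE.
rewrite /derive; apply: cvg_lim => //; apply: cvg_near_cst.
apply: filterS (nbhs_dnbhs_neq (0 : R)) => h h0 /=.
rewrite dotvDr dotvZr dotv_delta.
have -> : c + (h * a 0 j + dotv a z) - (c + dotv a z) = h * a 0 j by ring.
by rewrite [LHS]mulrA mulVf// mul1r.
Qed.

Section Blocks.
Variables (R : realType) (d s m n p q : nat) (P : program R d s m n p q)
  (zs : 'rV[R]_(d + s + m + n)).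

Lemma grad_xyz_comp (phi : 'rV[R]_(d + s) -> R) :
  [/\ xyz (grad (fun z : 'rV[R]_(d + s + m + n) => phi (xyz z)) zs) = grad phi (xyz zs),
      uz (grad (fun z : 'rV[R]_(d + s + m + n) => phi (xyz z)) zs) = 0 &
      vz (grad (fun z : 'rV[R]_(d + s + m + n) => phi (xyz z)) zs) = 0].
Proof.
rewrite xyz_grad uz_grad vz_grad; split.
- apply: (congr1 (fun F => grad F (xyz zs))); apply/funext => w.
  by rewrite xyz_blocks.
- rewrite (_ : (fun u => _) = fun=> phi (xyz zs)) ?grad_cst//.
  by apply/funext => u; rewrite xyz_blocks.
- rewrite (_ : (fun u => _) = fun=> phi (xyz zs)) ?grad_cst//.
  by apply/funext => u; rewrite xyz_blocks.
Qed.

Lemma grad_compH i :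
  [/\ xyz (grad (@compH R d s m n i) zs) = 0,
      uz (grad (@compH R d s m n i) zs) = delta_mx 0 i &
      vz (grad (@compH R d s m n i) zs) = 0].
Proof.
rewrite xyz_grad uz_grad vz_grad /compH; split.
- rewrite (_ : (fun u => _) = fun=> uz zs 0 i) ?grad_cst//.
  by apply/funext => u; rewrite uz_blocks.
- rewrite (_ : (fun u => _) = fun u => 0 + dotv (delta_mx 0 i) u) ?grad_affine//.
  by apply/funext => u; rewrite uz_blocks add0r dotvC dotv_delta.
- rewrite (_ : (fun u => _) = fun=> uz zs 0 i) ?grad_cst//.
  by apply/funext => u; rewrite uz_blocks.
Qed.

Lemma grad_gradyL j :
  let Phi z := gradyL P (xyz z) (uz z) (vz z) 0 j in
  [/\ xyz (grad Phi zs) = grad (fun w => gradyL P w (uz zs) (vz zs) 0 j) (xyz zs),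
      uz (grad Phi zs) = row j (Jy (lowg P) (xyz zs)) &
      vz (grad Phi zs) = row j (Jy (lowh P) (xyz zs))].
Proof.
move=> Phi; rewrite xyz_grad uz_grad vz_grad /Phi; split.
- apply: (congr1 (fun F => grad F (xyz zs))); apply/funext => w.
  by rewrite xyz_blocks uz_blocks vz_blocks.
- rewrite (_ : (fun u => _) = fun u =>
    (grady (lowf P) (xyz zs) 0 j + \sum_i vz zs 0 i * Jy (lowh P) (xyz zs) j i)
     + dotv (row j (Jy (lowg P) (xyz zs))) u) ?grad_affine//.
  apply/funext => u; rewrite xyz_blocks uz_blocks vz_blocks gradyL_coord addrAC.
  by congr (_ + _); apply: eq_bigr => i _; rewrite mulrC [X in _ = X * _]mxE.
- rewrite (_ : (fun u => _) = fun u =>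
    (grady (lowf P) (xyz zs) 0 j + \sum_i uz zs 0 i * Jy (lowg P) (xyz zs) j i)
     + dotv (row j (Jy (lowh P) (xyz zs))) u) ?grad_affine//.
  apply/funext => u; rewrite xyz_blocks uz_blocks vz_blocks gradyL_coord.
  by congr (_ + _); apply: eq_bigr => i _; rewrite mulrC [X in _ = X * _]mxE.
Qed.

End Blocks.

Unset Implicit Arguments.

Theorem theorem5p1 (R : realType) (d s m n p q : nat)
    (P : program R d s m n p q) (zs : 'rV[R]_(d + s + m + n))
    (F_lip : forall w, lipschitz_around (objF P) w)
    (G_C1 : continuously_differentiable (conG P))
    (H_C1 : continuously_differentiable (conH P))
    (f_C1 : continuously_differentiable (lowf P))
    (g_C1 : continuously_differentiable (lowg P))
    (h_C1 : continuously_differentiable (lowh P))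
    (fy_C1 : continuously_differentiable (grady (lowf P)))
    (gy_C1 : continuously_differentiable (Jy (lowg P)))
    (hy_C1 : continuously_differentiable (Jy (lowh P)))
    (zs_sol : local_solution P zs)
    (V_lip : value_lipschitz_around P (lsubmx (xyz zs)))
    (zs_RCPLD : RCPLD_CP P zs) :
  Mstationary P zs.
Proof.
have [zs_feas zs_opt] := zs_sol; have [V_fin _] := V_lip.
(* Needed at all nearby points, since local optimality must be transferred from (CP) to the
   real-valued system. *)
have V_fin_near : \forall z \near zs, value_fun P (lsubmx (xyz z)) \is a fin_num.
  apply: (@near_xyz R d s m n (fun w => value_fun P (lsubmx w) \is a fin_num)).
  exact: (@continuous_lsubmx R _ _ _ (xyz zs) _ V_fin).
have [zs0 zsG zsE zsC] := iffRL (CP_systemP (nbhs_singleton V_fin_near)) zs_feas.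
have [LF LF0 F_calm] := lipschitz_around_calm (F_lip (xyz zs)).
have [L0 L00 gap_calm] := value_gap_calm f_C1 V_lip.
have F_calm' : \forall z \near zs, calm (objF P \o @xyz R d s m n) LF z.
  by apply: filterS (near_xyz F_calm) => z; exact: calm_xyz.
have gap_calm' : \forall z \near zs, calm (theta P None) L0 z.
  by apply: filterS (near_xyz gap_calm) => z; exact: calm_xyz.
have opt' : \forall z \near zs, CP_system P z -> objF P (xyz zs) <= objF P (xyz z).
  by apply: filterS2 zs_opt V_fin_near => z + Vz => + /(CP_systemP Vz).
have act i : i \notin active_theta P zs -> theta P i zs < 0.
  case: i => [i|]; rewrite !inE // => iN; rewrite lt_neqAle; apply/andP; split => //.
  exact: zsG.
have Iact i : i \in Iset P zs -> compG P i zs = 0 /\ 0 < compH (n := n) i zs.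
  by rewrite inE /compG /compH => /andP[/eqP -> ->]; rewrite oppr0.
have Jact i : i \in Jset P zs -> compG P i zs = 0 /\ compH (n := n) i zs = 0.
  by rewrite inE /compG /compH => /andP[/eqP -> /eqP ->]; rewrite oppr0.
have Kact i : i \in Kset P zs -> 0 < compG P i zs /\ compH (n := n) i zs = 0.
  by rewrite inE /compG /compH oppr_gt0 => /andP[-> /eqP].
have IJK i : [|| i \in Iset P zs, i \in Jset P zs | i \in Kset P zs].
  have [g0 u0 /eqP] := zsC i; rewrite !inE /compG /compH in g0 u0 *.
  rewrite oppr_ge0 in g0; rewrite mulf_eq0 oppr_eq0.
  have [->|gN] := eqVneq (lowg P (xyz zs) 0 i) 0.
    by move=> _; have [->|uN] := eqVneq (uz zs 0 i) 0; rewrite ?orbT// lt_neqAle eq_sym uN u0.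
  by move=> /= ->; rewrite andbT lt_neqAle gN g0.
have C1e := C1_equality H_C1 h_C1 fy_C1 gy_C1 hy_C1.
have C1g := C1_compG g_C1; have C1t := C1_theta G_C1.
have C1h i : continuously_differentiable (@compH R d s m n i) by exact: C1_uz.
have [xi [w [lam [mu [a [b [[xiF wV lam0 lamN] [eq0 [bI aK sgnJ]]]]]]]]] :=
  multiplier_limit (And4 zs0 zsG zsE zsC) act Iact Jact Kact IJK
    (fun i => C1_smooth (C1t i)) (fun j => C1_smooth (C1e j))
    (fun i => C1_smooth (C1g i)) (fun i => C1_smooth (C1h i))
    (fun i => @C1_grad_continuous _ _ _ (C1t i) zs) (fun j => @C1_grad_continuous _ _ _ (C1e j) zs)
    (fun i => @C1_grad_continuous _ _ _ (C1g i) zs) (fun i => @C1_grad_continuous _ _ _ (C1h i) zs)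
    LF0 L00 F_calm' gap_calm' opt' zs_RCPLD.
split => //=.
(* Fallback subgradient of [f - V] for the case [lam None = 0]. *)
have [xi0 Hxi0] := limiting_subdiff_nonempty L00 gap_calm.
have [xiF' xiu xiv] := limiting_subdiff_xyz xiF.
have [xiV [xiV_sub lamV_eq lamVu lamVv]] : exists xiV,
    [/\ limiting_subdiff (value_gap P) (xyz zs) xiV,
      xyz (lam None *: w) = lam None *: xiV, uz (lam None *: w) = 0 & vz (lam None *: w) = 0].
  have [->|lN] := eqVneq (lam None) 0.
    exists xi0; rewrite !scale0r; split => //; by rewrite /xyz /uz /vz !linear0.
  have [wV' wu wv] := limiting_subdiff_xyz (wV lN).
  exists (xyz w); split => //; rewrite /xyz /uz /vz !linearZ//=.
    by rewrite -[rsubmx (lsubmx w)]/(uz w) wu scaler0.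
  by rewrite -[rsubmx w]/(vz w) wv scaler0.
pose lamH := \row_j mu (lshift s (lshift n j)); pose lamh := \row_j mu (lshift s (rshift q j)).
pose lamL := \row_j mu (rshift (q + n) j).
have [dH _] := H_C1; have [dh _] := h_C1.
have dL := differentiable_gradyL fy_C1 gy_C1 hy_C1 (uz zs) (vz zs).
exists (lam None), (fun i => lam (Some i)), lamH, lamh, lamL, (\row_i a i), (\row_i b i),
  (xyz xi), xiV.
pose cg i (z : 'rV[R]_(d + s + m + n)) := conG P (xyz z) 0 i.
pose ch i (z : 'rV[R]_(d + s + m + n)) := conH P (xyz z) 0 i.
pose lh i (z : 'rV[R]_(d + s + m + n)) := lowh P (xyz z) 0 i.
pose lg i (z : 'rV[R]_(d + s + m + n)) := - lowg P (xyz z) 0 i.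
pose gL j (z : 'rV[R]_(d + s + m + n)) := gradyL P (xyz z) (uz z) (vz z) 0 j.
have eqE : \sum_j mu j *: grad (equality P j) zs =
    \sum_j lamH 0 j *: grad (ch j) zs + \sum_j lamh 0 j *: grad (lh j) zs
    + \sum_j lamL 0 j *: grad (gL j) zs.
  have eH j : grad (equality P (lshift s (lshift n j))) zs = grad (ch j) zs.
    by apply: (congr1 (fun F => grad F zs)); apply/funext => z; exact: equalityH.
  have eh j : grad (equality P (lshift s (rshift q j))) zs = grad (lh j) zs.
    by apply: (congr1 (fun F => grad F zs)); apply/funext => z; exact: equalityh.
  have eL j : grad (equality P (rshift (q + n) j)) zs = grad (gL j) zs.
    by apply: (congr1 (fun F => grad F zs)); apply/funext => z; exact: equalityL.
  have sumH : \sum_j mu (lshift s (lshift n j)) *: grad (equality P (lshift s (lshift n j))) zs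
      = \sum_j lamH 0 j *: grad (ch j) zs.
    by apply: eq_bigr => j _; rewrite eH [in RHS]mxE.
  have sumh : \sum_j mu (lshift s (rshift q j)) *: grad (equality P (lshift s (rshift q j))) zs
      = \sum_j lamh 0 j *: grad (lh j) zs.
    by apply: eq_bigr => j _; rewrite eh [in RHS]mxE.
  have sumL : \sum_j mu (rshift (q + n) j) *: grad (equality P (rshift (q + n) j)) zs
      = \sum_j lamL 0 j *: grad (gL j) zs.
    by apply: eq_bigr => j _; rewrite eL [in RHS]mxE.
  by rewrite big_split_ord big_split_ord /= sumH sumh sumL.
(* The multiplier equation seen through a linear map; its three block projections give the three
   equations of M-stationarity. *)
pose projected k (L : 'rV[R]_(d + s + m + n) -> 'rV[R]_k) :=
    0 = L xi + L (lam None *: w) + \sum_i lam (Some i) *: L (grad (cg i) zs)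
      + (\sum_j lamH 0 j *: L (grad (ch j) zs) + \sum_j lamh 0 j *: L (grad (lh j) zs)
      + \sum_j lamL 0 j *: L (grad (gL j) zs))
      - \sum_i a i *: L (grad (lg i) zs) - \sum_i b i *: L (grad (compH i) zs).
have proj k (L : {linear 'rV[R]_(d + s + m + n) -> 'rV[R]_k}) : projected k L.
  have sumL (I : finType) (c : I -> R) v : \sum_i c i *: L (v i) = L (\sum_i c i *: v i).
    by rewrite linear_sum; apply: eq_bigr => i _; rewrite linearZ.
  by rewrite /projected !sumL -!linearD -!linearB -eqE -eq0 linear0.
have projx : projected _ (@xyz R d s m n) by exact: (proj _ (lsubmx \o lsubmx)).
have proju : projected _ (@uz R d s m n) by exact: (proj _ (rsubmx \o lsubmx)).
have projv : projected _ (@vz R d s m n) by exact: (proj _ rsubmx).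
have gG i := grad_xyz_comp zs (fun w => conG P w 0 i).
have gH i := grad_xyz_comp zs (fun w => conH P w 0 i).
have gh i := grad_xyz_comp zs (fun w => lowh P w 0 i).
have gg i := grad_xyz_comp zs (fun w => - lowg P w 0 i).
have gl j := grad_gradyL P zs j.
have gC i := @grad_compH R d s m n zs i.
have sum_congr (I : finType) k (c : I -> R) (v v' : I -> 'rV[R]_k) :
    (forall i, v i = v' i) -> \sum_i c i *: v i = \sum_i c i *: v' i.
  by move=> vv'; apply: eq_bigr => i _; rewrite vv'.
have sum_zero (I : finType) k (c : I -> R) (v : I -> 'rV[R]_k) :
    (forall i, v i = 0) -> \sum_i c i *: v i = 0.
  by move=> v0; apply: big1 => i _; rewrite v0 scaler0.
have row_sum k (A : 'M[R]_(s, k)) (l : 'rV[R]_s) : \sum_j l 0 j *: row j A = l *m A.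
  by rewrite mulmx_sum_row.
split; first by split.
split; last split; last split.
- rewrite [LHS]projx lamV_eq.
  rewrite (sum_congr _ _ _ _ (fun i => grad (fun w => conG P w 0 i) (xyz zs))); last first.
    by move=> i; have [] := gG i.
  rewrite (sum_congr _ _ _ _ (fun i => grad (fun w => conH P w 0 i) (xyz zs))); last first.
    by move=> i; have [] := gH i.
  rewrite (sum_congr _ _ _ _ (fun i => grad (fun w => lowh P w 0 i) (xyz zs))); last first.
    by move=> i; have [] := gh i.
  rewrite (sum_congr _ _ _ _ (fun j => grad (fun w => gradyL P w (uz zs) (vz zs) 0 j) (xyz zs)));
    last by move=> j; have [] := gl j.
  rewrite (sum_congr _ _ _ _ (fun i => - grad (fun w => lowg P w 0 i) (xyz zs))); last first.
    move=> i; have [-> _ _] := gg i; rewrite -gradN//.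
    by have [+ _] := C1_coord 0 i g_C1; apply.
  rewrite [X in _ - X]sum_zero; last by move=> i; have [] := gC i.
  rewrite !mulmx_jacobian// subr0.
  have -> : \sum_i lam (Some i) *: grad (fun w => conG P w 0 i) (xyz zs) =
      \sum_(i in activeG P zs) lam (Some i) *: grad (fun w => conG P w 0 i) (xyz zs).
    rewrite [RHS]big_mkcond; apply: eq_bigr => i _; case: ifPn => // iN.
    by rewrite lamN ?scale0r// inE.
  (* The sign comes from the complementarity function being [-g], and the sum shrinks to [I] and [J]
     because [a] vanishes on [K]. *)
  have -> : \sum_i a i *: - grad (fun w => lowg P w 0 i) (xyz zs) =
      - \sum_(i in Iset P zs :|: Jset P zs) (\row_i a i) 0 i *:
        grad (fun w => lowg P w 0 i) (xyz zs).
    rewrite -sumrN [RHS]big_mkcond; apply: eq_bigr => i _; rewrite scalerN mxE.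
    case: ifPn => //; rewrite inE negb_or => /andP[iI iJ].
    by rewrite aK ?scale0r ?oppr0//; have := IJK i; rewrite (negbTE iI) (negbTE iJ).
  by rewrite opprK !addrA.
(* In the [u] block only [gradyL], with the rows of [Jy (lowg P)], and [compH], with unit vectors,
   contribute; this determines [b]. *)
- have := proju; rewrite /projected xiu lamVu.
  rewrite [\sum_i lam _ *: _]sum_zero; last by move=> i; have [] := gG i.
  rewrite [\sum_j lamH _ _ *: _]sum_zero; last by move=> i; have [] := gH i.
  rewrite [\sum_j lamh _ _ *: _]sum_zero; last by move=> i; have [] := gh i.
  rewrite [\sum_i a _ *: _]sum_zero; last by move=> i; have [] := gg i.
  rewrite (sum_congr _ _ _ _ (fun j => row j (Jy (lowg P) (xyz zs)))); last first.
    by move=> j; have [] := gl j.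
  rewrite (sum_congr _ _ _ _ (fun i => delta_mx 0 i)); last by move=> i; have [] := gC i.
  rewrite row_sum !add0r subr0 => ->; congr (_ - _).
  by rewrite [LHS]row_sum_delta; apply: eq_bigr => i _; rewrite mxE.
(* In the [v] block only [gradyL] contributes. *)
- have := projv; rewrite /projected xiv lamVv.
  rewrite [\sum_i lam _ *: _]sum_zero; last by move=> i; have [] := gG i.
  rewrite [\sum_j lamH _ _ *: _]sum_zero; last by move=> i; have [] := gH i.
  rewrite [\sum_j lamh _ _ *: _]sum_zero; last by move=> i; have [] := gh i.
  rewrite [\sum_i a _ *: _]sum_zero; last by move=> i; have [] := gg i.
  rewrite [\sum_i b _ *: _]sum_zero; last by move=> i; have [] := gC i.
  rewrite (sum_congr _ _ _ _ (fun j => row j (Jy (lowh P) (xyz zs)))); last first.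
    by move=> j; have [] := gl j.
  by rewrite row_sum !add0r !subr0.
- split=> [i /bI|i /aK|i /sgnJ]; by rewrite !mxE.
Qed.
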